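(* Let $p\ge1$, let $\xi=(\check{\mathcal T}_0,(\check X^{(0)}_i)_{i\ge1},(\check P^{(0)}_i)_{i\ge1},\check\Lambda_0)$ be a random generalised string of length $L$ (so $\check{\mathcal T}_0=[0,L]$) with $\mathbb E[L^p]<\infty$, and let $\beta\in(0,\infty)$ be such that $\mathbb E\big[\sum_{j\ge1}(\check P^{(0)}_j)^{p\beta}\big]<1$. For $n\ge0$, to obtain $(\check{\mathcal T}_{n+1},(\check X^{(n+1)}_i)_{i\ge1},(\check P^{(n+1)}_i)_{i\ge1},\check\Lambda_{n+1})$ conditionally given the objects of stages $0,\dots,n$, attach to each $\check X^{(n)}_i\in\check{\mathcal T}_n$, $i\ge1$, an independent isometric copy of $\xi$ with metric rescaled by $(\check P^{(n)}_i)^\beta$ and measure and atom masses rescaled by $\check P^{(n)}_i$. Let $\check\mu_n=\check\Lambda_n+\sum_{i\ge1}\check P^{(n)}_i\delta_{\check X^{(n)}_i}$. Then there is a random weighted $\mathbb R$-tree $(\check{\mathcal T},\check\mu)$ such that $$\lim_{n\to\infty}(\check{\mathcal T}_n,\check\mu_n)=(\check{\mathcal T},\check\mu)\quad\text{a.s. in the Gromov-Hausdorff-Prokhorov topology on }\mathbb T_{\rm w}.$$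
   Context: Trees. An $\mathbb R$-tree is a separable metric space $(T,d)$ in which any two points $x,y$ are joined by a unique injective path (up to reparametrisation), this path being isometric to $[0,d(x,y)]$. All trees are rooted. A weighted $\mathbb R$-tree $(T,d,\rho,\mu)$ carries in addition a Borel probability measure $\mu$ on $T$. $\mathbb T_{\rm w}$ is the set of equivalence classes of compact weighted rooted $\mathbb R$-trees under root- and measure-preserving isometries, with the Gromov-Hausdorff-Prokhorov metric $$d_{\rm GHP}((T,d,\rho,\mu),(T',d',\rho',\mu'))=\inf_{\varphi,\varphi'}\max\{\delta(\varphi(\rho),\varphi'(\rho')),\delta_{\rm H}(\varphi(T),\varphi'(T')),\delta_{\rm P}(\varphi_*\mu,\varphi'_*\mu')\},$$ the infimum being over all isometric embeddings $\varphi,\varphi'$ into a common metric space $(\mathcal M,\delta)$; $\delta_{\rm H}$, $\delta_{\rm P}$ are the Hausdorff and Prokhorov distances. Generalised strings. A generalised string is $([0,\ell],(x_i)_{i\ge1},(p_i)_{i\ge1},\lambda)$ with $\ell>0$, points $x_i\in[0,\ell]$ not necessarily distinct, $1>p_1\ge p_2\ge\cdots\ge0$, and $\lambda$ a measure on $[0,\ell]$ with $\sum_{i\ge1}p_i=1-\lambda([0,\ell])$. Its length is $\ell$, its root is $0$. A random generalised string is a random variable valued in such strings. Construction. Attaching a copy of $\xi$ at a point $x$ means identifying its left endpoint $0$ with $x$ (disjoint union, path metric). $\check{\mathcal T}_{n+1}$ is $\check{\mathcal T}_n$ with all rescaled copies attached (one for each index $i$, even when several $\check X_i^{(n)}$ coincide),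 rooted at the left endpoint of $\check{\mathcal T}_0$; $(\check X^{(n+1)}_i,\check P^{(n+1)}_i)_{i\ge1}$ is an enumeration of all locations and rescaled masses of the atoms of the newly attached copies (the stage-$n$ atoms are removed); $\check\Lambda_{n+1}$ is $\check\Lambda_n$ plus the sum of the rescaled $\Lambda$-measures of the newly attached copies. The copies used at all stages are independent of each other and of the past. *)

(* Defs.v *)
From HB Require Import structures.
From mathcomp Require Import all_boot all_order all_algebra.
From mathcomp Require Import all_classical all_reals all_analysis.
From mathcomp Require Import measurable_realfun.
From mathcomp Require Import lra.

Set Implicit Arguments.
Unset Strict Implicit.
Unset Printing Implicit Defensive.

Import Order.TTheory GRing.Theory Num.Def Num.Theory.
Import numFieldNormedType.Exports.

Local Open Scope classical_set_scope.
Local Open Scope ring_scope.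
Local Open Scope ereal_scope.

Section image_measure.
Context {d d' : measure_display} {T : measurableType d} {U : measurableType d'}.
Context {R : realType}.
Variables (m : {measure set T -> \bar R}) (f : T -> U).

(* [pushforward] with the measurability proof as an argument, so that the
   measure structure can be inferred. *)
Definition image_measure (mf : measurable_fun setT f) : set U -> \bar R :=
  pushforward m f.

Variable mf : measurable_fun setT f.

Let image_measure0 : image_measure mf set0 = 0.
Proof. by rewrite /image_measure /pushforward preimage_set0 measure0. Qed.

Let image_measure_ge0 A : 0 <= image_measure mf A.
Proof. exact: measure_ge0. Qed.

Let image_measure_sigma_additive : semi_sigma_additive (image_measure mf).
Proof.
move=> F mF tF mUF; rewrite /image_measure /pushforward preimage_bigcup.
have mpre A : measurable A -> measurable (f @^-1` A).
  by move=> mA; rewrite -[X in measurable X]setTI; exact: mf.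
apply: measure_semi_sigma_additive.
- by move=> n; exact: mpre.
- apply/trivIsetP => /= i j _ _ ij; rewrite -preimage_setI.
  by move/trivIsetP : tF => /(_ _ _ _ _ ij) ->//; rewrite preimage_set0.
- by rewrite -preimage_bigcup; exact: mpre.
Qed.

HB.instance Definition _ := isMeasure.Build _ _ _ (image_measure mf)
  image_measure0 image_measure_ge0 image_measure_sigma_additive.

End image_measure.

(* Measurable types are pointed in the library; we use the root for this. *)
Definition rooted {R : realType} {T : metricType R} (rho : T) : Type := T.

Section rooted.
Context {R : realType} {T : metricType R} (rho : T).
HB.instance Definition _ := Choice.on (rooted rho).
HB.instance Definition _ := isPointed.Build (rooted rho) rho.
End rooted.

Definition borel {R : realType} {T : metricType R} (rho : T) :=
  g_sigma_algebraType (@open T : set_system (rooted rho)).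

Record rmspace (R : realType) := RMSpace {
  rms_space : metricType R ;
  rms_root : rms_space ;
  rms_mu : {measure set (borel rms_root) -> \bar R} }.

(* "Unique up to reparametrisation": every injective path f from x to y is
   f = g \o h on [a, b], with h increasing from [a, b] onto [0, d(x,y)] and g
   the isometric path. *)
Definition Rtree {R : realType} (T : metricType R) : Prop :=
  (exists2 A : set T, countable A & dense A) /\
  forall x y : T, exists g : R -> T,
  [/\ g 0%R = x, g (mdist x y) = y,
      {in `[0%R, mdist x y] &, forall s t, mdist (g s) (g t) = `|s - t|%R}
    & forall (a b : R) (f : R -> T), (a <= b)%R ->
      {within `[a, b], continuous f} -> {in `[a, b] &, injective f} ->
      f a = x -> f b = y ->
      exists h : R -> R,
      [/\ {within `[a, b], continuous h},
          {in `[a, b] &, {homo h : s t / (s < t)%R}},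
          h a = 0%R, h b = mdist x y
        & {in `[a, b], forall t, f t = g (h t)}]].

Definition weighted_Rtree {R : realType} (X : rmspace R) : Prop :=
  [/\ Rtree (rms_space X), compact [set: rms_space X] & rms_mu X setT = 1].

Definition isometric {R : realType} {S T : metricType R} (phi : S -> T) :=
  forall x y, mdist (phi x) (phi y) = mdist x y.

Definition rms_equiv {R : realType} (X Y : rmspace R) : Prop :=
  exists phi : rms_space X -> rms_space Y,
  [/\ isometric phi, range phi = setT, phi (rms_root X) = rms_root Y
    & forall B : set (borel (rms_root Y)), measurable B ->
      rms_mu X (phi @^-1` B) = rms_mu Y B].

Section distances.
Context {R : realType} {M : metricType R}.

Definition enlarge (A : set M) (e : R) : set M :=
  [set x | exists2 a, A a & (mdist a x < e)%R].

Definition hausdorff_dist (A B : set M) : \bar R :=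
  ereal_inf [set e%:E | e in [set e : R |
    [/\ (0 < e)%R, A `<=` enlarge B e & B `<=` enlarge A e]]].

Definition prokhorov_dist (mu nu : set M -> \bar R) : \bar R :=
  ereal_inf [set e%:E | e in [set e : R | (0 < e)%R /\
    forall B : set M, <<s open >> B ->
      mu B <= nu (enlarge B e) + e%:E /\ nu B <= mu (enlarge B e) + e%:E]].

End distances.

Definition dGHP {R : realType} (X Y : rmspace R) : \bar R :=
  ereal_inf [set r | exists (M : metricType R)
    (phi : rms_space X -> M) (psi : rms_space Y -> M),
    [/\ isometric phi, isometric psi
      & r = maxe (mdist (phi (rms_root X)) (psi (rms_root Y)))%:E
              (maxe (hausdorff_dist (range phi) (range psi))
                 (prokhorov_dist (fun B => rms_mu X (phi @^-1` B))
                                 (fun B => rms_mu Y (psi @^-1` B))))]].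

(* [rmspace R] lives in a larger universe than the carriers of [set], so that
   subsets of the types below are written as plain predicates. *)
Record wRtree (R : realType) := WRtree {
  wR_space :> rmspace R ;
  wR_spaceP : weighted_Rtree wR_space }.

Record Tw (R : realType) := TwClass {
  Tw_class : wRtree R -> Prop ;
  Tw_classP : exists X : wRtree R, Tw_class = rms_equiv X }.

Definition Tw_of {R : realType} (X : wRtree R) : Tw R :=
  @TwClass R (fun Y => rms_equiv X Y) (ex_intro _ X erefl).

(* The value of [dGHP X Y] does not depend on the representatives X and Y. *)
Definition Tw_dist {R : realType} (c c' : Tw R) : \bar R :=
  ereal_inf [set r | exists X Y : wRtree R,
    [/\ Tw_class c X, Tw_class c' Y & r = dGHP X Y]].

Definition Tw_open {R : realType} (U : Tw R -> Prop) : Prop :=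
  forall c, U c -> exists2 e : R, (0 < e)%R &
    forall c', Tw_dist c c' < e%:E -> U c'.

Inductive Tw_borel {R : realType} : (Tw R -> Prop) -> Prop :=
| Tw_borel_open U : Tw_open U -> Tw_borel U
| Tw_borelC U : Tw_borel U -> Tw_borel (fun c => ~ U c)
| Tw_borel_bigcup (U : nat -> Tw R -> Prop) :
    (forall n, Tw_borel (U n)) -> Tw_borel (fun c => exists n, U n c).

Definition random_wRtree {R : realType} {d : measure_display}
    {Omega : measurableType d} (T : Omega -> Tw R) : Prop :=
  forall U, Tw_borel U -> measurable [set w | U (T w)].

(* Atoms are indexed from 0; the measure on [0, l] is a measure on R which
   does not charge the complement of [0, l]. *)
Record gstring (R : realType) := GString {
  gs_len : R ;
  gs_len_gt0 : (0 < gs_len)%R ;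
  gs_pos : nat -> R ;
  gs_pos_in : forall i, (0 <= gs_pos i <= gs_len)%R ;
  gs_mass : nat -> {nonneg R} ;
  gs_mass_lt1 : ((gs_mass 0)%:num < 1)%R ;
  gs_mass_noninc : forall i, ((gs_mass i.+1)%:num <= (gs_mass i)%:num)%R ;
  gs_diff : {measure set R -> \bar R} ;
  gs_diff_out : gs_diff (~` `[0%R, gs_len]%classic) = 0 ;
  gs_total : \sum_(i <oo) ((gs_mass i)%:num)%:E =
             1 - gs_diff `[0%R, gs_len]%classic }.

Section gstring_measurable.
Context {R : realType}.

Lemma unit_string : gstring R.
Proof.
refine (@GString R 1%R ltr01 (fun=> 0%R) _ (fun=> (0%:nng)%R) _ _
  (\d_(0%R : R)) _ _).
- by move=> _; rewrite lexx ler01.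
- exact: ltr01.
- by move=> _; exact: lexx.
- change (\d_(0%R : R) (~` `[0%R, 1%R]%classic) = 0 :> \bar R).
  by rewrite diracE memNset//=; apply; rewrite /= in_itv/= lexx ler01.
- change (\sum_(i <oo) (0%R : R)%:E = 1 - \d_(0%R : R) `[0%R, 1%R]%classic).
  by rewrite eseries0// diracE mem_set ?subee//= in_itv/= lexx ler01.
Qed.

HB.instance Definition _ := gen_eqMixin (gstring R).
HB.instance Definition _ := gen_choiceMixin (gstring R).
HB.instance Definition _ := isPointed.Build (gstring R) unit_string.

(* Generators of the coarsest sigma-algebra for which the length, the positions
   and masses of the atoms, and the values of the measure on Borel sets are
   measurable. *)
Definition gstring_cylinder : set_system (gstring R) :=
  preimage_set_system setT (@gs_len R) measurable `|`
  \bigcup_i preimage_set_system setT (fun s => gs_pos s i) measurable `|`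
  \bigcup_i
    preimage_set_system setT (fun s => (gs_mass s i)%:num) measurable `|`
  \bigcup_(D in (measurable : set_system R))
    preimage_set_system setT (fun s => gs_diff s D)
      (measurable : set_system (\bar R)).

HB.instance Definition _ := @isMeasurable.Build default_measure_display
  (gstring R) <<s gstring_cylinder >>
  (@sigma_algebra0 _ setT gstring_cylinder)
  (@sigma_algebraC _ gstring_cylinder)
  (@sigma_algebra_bigcup _ setT gstring_cylinder).

End gstring_measurable.

(* [attach x l] is T with a copy of [0, l i] attached by its left endpoint to
   x i, for each i.  As 0 is identified with x i, the i-th branch contributes
   the points at distance t from x i with 0 < t <= l i. *)
Definition attach {R : realType} {T : metricType R} (x : nat -> T)
    (l : nat -> R) : Type :=
  (T + {b : nat * R | (0 < b.2 <= l b.1)%R})%type.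

Section attach.
Context {R : realType} {T : metricType R} (x : nat -> T) (l : nat -> R).

Definition attach_dist (a b : attach x l) : R :=
  match a, b with
  | inl u, inl v => mdist u v
  | inl u, inr s => mdist u (x (val s).1) + (val s).2
  | inr s, inl u => mdist (x (val s).1) u + (val s).2
  | inr s, inr t =>
      if (val s).1 == (val t).1 then `|(val s).2 - (val t).2|
      else (val s).2 + mdist (x (val s).1) (x (val t).1) + (val t).2
  end%R.

Let attach_distxx a : attach_dist a a = 0%R.
Proof. by case: a => [u|s] /=; rewrite ?mdistxx// eqxx subrr normr0. Qed.

Let attach_dist_positivity a b : attach_dist a b = 0%R -> a = b.
Proof.
case: a b => [u|[[i s] ps]] [v|[[j t] pt]] /=.
- by move/mdist_positivity => ->.
- by have /andP[/= t0 _] := pt; have := mdist_ge0 u (x j) => ? ?; exfalso; lra.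
- by have /andP[/= s0 _] := ps; have := mdist_ge0 (x i) v => ? ?; exfalso; lra.
- have /andP[/= s0 _] := ps; have /andP[/= t0 _] := pt.
  case: eqP => [ij|_]; last by have := mdist_ge0 (x i) (x j) => ? ?; exfalso; lra.
  move/eqP; rewrite normr_eq0 subr_eq0 => /eqP st.
  by congr inr; apply/val_inj; rewrite /= ij st.
Qed.

Let attach_dist_sym a b : attach_dist a b = attach_dist b a.
Proof.
case: a b => [u|s] [v|t] /=.
- exact: metric_sym.
- by rewrite metric_sym.
- by rewrite metric_sym.
- rewrite eq_sym distrC [mdist (x (val s).1) _]metric_sym.
  by case: ifP => // _; lra.
Qed.

Let attach_dist_triangle b a c :
  (attach_dist a c <= attach_dist a b + attach_dist b c)%R.
Proof.
have tri := @metric_triangle R T.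
case: a b c => [u|[[i s] ps]] [v|[[j t] pt]] [w|[[k r] pr]] /=;
  try have /andP[/= s0 _] := ps; try have /andP[/= t0 _] := pt;
  try have /andP[/= r0 _] := pr.
- exact: tri.
- by have := tri u v (x k); lra.
- by have := tri u (x j) w; have := t0; lra.
- case: eqP => [->|_]; first by have := ler_norm (r - t)%R; rewrite distrC; lra.
  by have := tri u (x j) (x k); lra.
- by have := tri (x i) v w; lra.
- case: eqP => [<-|ik]; last by have := tri (x i) v (x k); lra.
  have := mdist_ge0 (x i) v; have := mdist_ge0 v (x i).
  have : (`|s - r| <= s + r)%R by rewrite ler_norml; apply/andP; split; lra.
  by lra.
- case: eqP => [->|_]; first by have := ler_norm (s - t)%R; lra.
  by have := tri (x i) (x j) w; lra.
- have norm0 (p q : R) : (0 < p)%R -> (0 < q)%R -> (`|p - q| <= p + q)%R.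
    by move=> ? ?; rewrite ler_norml; apply/andP; split; lra.
  have [ij|ij] := eqVneq i j; have [jk|jk] := eqVneq j k.
  + by rewrite ij jk eqxx ler_distD.
  + rewrite ij (negbTE jk); have := ler_norm (s - t)%R; lra.
  + rewrite -jk (negbTE ij); have := ler_norm (r - t)%R; rewrite distrC; lra.
  + case: eqP => [<-|_]; last by have := tri (x i) (x j) (x k); lra.
    have := norm0 _ _ s0 r0; have := mdist_ge0 (x i) (x j).
    by have := mdist_ge0 (x j) (x i); lra.
Qed.

HB.instance Definition _ := Choice.on (attach x l).
HB.instance Definition _ := isMetric.Build R (attach x l)
  attach_distxx attach_dist_positivity attach_dist_sym attach_dist_triangle.

End attach.

Lemma lipschitz_continuous {R : realType} {S : metricType R} {T : metricType R}
    (f : S -> T) (K : R) :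
  (forall s t, mdist (f s) (f t) <= K * mdist s t)%R -> continuous f.
Proof.
move=> fK s; apply/cvg_ballP => e e0.
have K1 : (0 < `|K| + 1)%R by rewrite ltr_wpDl.
have d0 : (0 < e / (`|K| + 1))%R by rewrite divr_gt0.
apply: filterS (nbhsx_ballx s _ d0) => t.
rewrite !ballEmdist /= => st; apply: le_lt_trans (fK _ _) _.
apply: (@le_lt_trans _ _ ((`|K| + 1) * mdist s t)%R).
  by apply: ler_wpM2r; [exact: mdist_ge0 | have := ler_norm K; lra].
by rewrite mulrC -ltr_pdivlMr.
Qed.

Section borel_measurable.
Context {R : realType} {T : metricType R} (rho : T).

Lemma measurable_borel {d} {A : measurableType d} (f : A -> borel rho) :
  (forall U : set T, open U -> measurable (f @^-1` U)) -> measurable_fun setT f.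
Proof.
move=> mf; apply: (@measurability _ _ _ _ setT f (@open T)) => //.
by move=> _ [U oU <-]; rewrite setTI; exact: mf.
Qed.

Lemma measurable_lipschitz_R (f : R -> T) (K : R) :
  (forall s t, mdist (f s) (f t) <= K * `|s - t|)%R ->
  measurable_fun setT (f : R -> borel rho).
Proof.
move=> fK; apply: measurable_borel => U oU; apply: open_measurable.
have cf : continuous (f : R^o -> T).
  apply: (@lipschitz_continuous R R^o T f K) => s t.
  suff -> : mdist s t = `|s - t|%R by exact: fK.
  by rewrite distrC.
by move/continuousP : cf; exact.
Qed.

Lemma measurable_lipschitz {S : metricType R} (sigma : S) (f : S -> T) (K : R) :
  (forall s t, mdist (f s) (f t) <= K * mdist s t)%R ->
  measurable_fun setT (f : borel sigma -> borel rho).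
Proof.
move=> fK; apply: measurable_borel => U oU.
apply: sub_sigma_algebra => /=.
by have /continuousP := lipschitz_continuous fK; exact.
Qed.

End borel_measurable.

(* The i-th attached segment as a map on R (truncated outside [0, l i]). *)
Definition branch {R : realType} {T : metricType R} (x : nat -> T)
    (l : nat -> R) (i : nat) (t : R) : attach x l :=
  if insub (i, minr t (l i)) is Some b then inr b else inl (x i).

Lemma branch_lipschitz {R : realType} {T : metricType R} (x : nat -> T)
    (l : nat -> R) (i : nat) (s t : R) :
  (mdist (branch x l i s) (branch x l i t) <= `|s - t|)%R.
Proof.
have st_ge0 : (0 <= `|s - t|)%R by [].
have ts := ler_norm (t - s)%R; rewrite distrC in ts.
have st := ler_norm (s - t)%R.
have q u : (0 < minr u (l i) <= l i)%R = (0 < minr u (l i))%R.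
  by rewrite ge_min lexx orbT andbT.
rewrite /branch; case: insubP => [a /= + va|/=]; rewrite q => pa;
  case: insubP => [b /= + vb|/=]; rewrite q => pb.
- rewrite /mdist /= va vb /= eqxx ler_norml /minr.
  by case: (ltP s (l i)) => ?; case: (ltP t (l i)) => ?; apply/andP; split; lra.
- rewrite /mdist /= va /= mdistxx add0r.
  move: pa pb; rewrite -leNgt /minr.
  by case: (ltP s (l i)) => ?; case: (ltP t (l i)) => ? *; lra.
- rewrite /mdist /= vb /= mdistxx add0r.
  move: pa pb; rewrite -leNgt /minr.
  by case: (ltP s (l i)) => ?; case: (ltP t (l i)) => ? *; lra.
- by rewrite mdistxx.
Qed.

Definition seg {R : realType} (ell : R) : Type :=
  {t : R | (0 <= t <= ell)%R}.

Section seg.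
Context {R : realType} (ell : R).

Let seg_dist (s t : seg ell) : R := `|val s - val t|%R.

Let seg_distxx s : seg_dist s s = 0%R.
Proof. by rewrite /seg_dist subrr normr0. Qed.

Let seg_dist_positivity s t : seg_dist s t = 0%R -> s = t.
Proof.
by move=> /eqP; rewrite normr_eq0 subr_eq0 => /eqP st; exact: val_inj.
Qed.

Let seg_dist_sym s t : seg_dist s t = seg_dist t s.
Proof. exact: distrC. Qed.

Let seg_dist_triangle t s u : (seg_dist s u <= seg_dist s t + seg_dist t u)%R.
Proof. exact: ler_distD. Qed.

HB.instance Definition _ := Choice.on (seg ell).
HB.instance Definition _ := isMetric.Build R (seg ell)
  seg_distxx seg_dist_positivity seg_dist_sym seg_dist_triangle.

End seg.

Section seg_of.
Context {R : realType} (ell : R).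
Hypothesis ell_gt0 : (0 < ell)%R.

Lemma seg_of_subproof (t : R) : (0 <= maxr 0 (minr t ell) <= ell)%R.
Proof. by rewrite le_max lexx ge_max (ltW ell_gt0) ge_min lexx orbT. Qed.

(* The identity of [0, ell], truncated outside. *)
Definition seg_of (t : R) : seg ell :=
  exist (fun u : R => 0 <= u <= ell)%R _ (seg_of_subproof t).

Lemma seg_of_lipschitz (s t : R) :
  (mdist (seg_of s) (seg_of t) <= `|s - t|)%R.
Proof.
have st_ge0 : (0 <= `|s - t|)%R by [].
have ts := ler_norm (t - s)%R; rewrite distrC in ts.
have st := ler_norm (s - t)%R.
rewrite /mdist /= ler_norml /maxr /minr.
case: (ltP s ell) => ?; case: (ltP t ell) => ?; rewrite ?ell_gt0;
  case: (ltP 0%R s) => ?; case: (ltP 0%R t) => ?;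
  by apply/andP; split; have := ell_gt0; lra.
Qed.

End seg_of.

(* A metric space with a root, atoms, and a diffuse measure: the quadruple
   (T_n, (X^(n)_i), (P^(n)_i), Lambda_n). *)
Record stage (R : realType) := Stage {
  st_space : metricType R ;
  st_root : st_space ;
  st_loc : nat -> st_space ;
  st_mass : nat -> {nonneg R} ;
  st_diff : {measure set (borel st_root) -> \bar R} }.

Section construction.
Context {R : realType}.

Section initial_stage.
Variable s : gstring R.
Let f := seg_of (gs_len_gt0 s).

Let measurable_f : measurable_fun setT (f : R -> borel (f 0%R)).
Proof.
apply: (@measurable_lipschitz_R _ _ _ _ 1%R) => u t.
by rewrite mul1r seg_of_lipschitz.
Qed.

Definition initial_stage : stage R :=
  @Stage R (seg (gs_len s)) (f 0%R) (fun i => f (gs_pos s i)) (gs_mass s)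
    (image_measure (gs_diff s) measurable_f).

End initial_stage.

Section next_stage.
Variables (beta : R) (S : stage R) (s : nat -> gstring R).
Variable e : nat -> nat * nat.

(* When the i-th atom has mass 0, [scale i] is 0 and nothing is attached. *)
Let scale i := ((st_mass S i)%:num `^ beta)%R.
Let T' := attach (st_loc S) (fun i => scale i * gs_len (s i))%R.
Let old (u : st_space S) : T' := inl u.
Let copy i (t : R) : T' := branch _ _ i (scale i * t)%R.

Let measurable_old :
  measurable_fun setT (old : borel (st_root S) -> borel (old (st_root S))).
Proof. by apply: (@measurable_lipschitz _ _ _ _ _ _ 1%R) => u v; rewrite mul1r. Qed.

Let measurable_copy i :
  measurable_fun setT (copy i : R -> borel (old (st_root S))).
Proof.
apply: (@measurable_lipschitz_R _ _ _ _ (scale i)) => u t.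
rewrite (le_trans (branch_lipschitz _ _ _ _ _))// -mulrBr normrM.
by rewrite ger0_norm ?powR_ge0.
Qed.

(* The k-th atom of the new stage is the j-th atom of the copy of s i attached
   at the i-th atom of S, where (i, j) = e k. *)
Definition next_stage : stage R :=
  @Stage R T' (old (st_root S))
    (fun k => copy (e k).1 (gs_pos (s (e k).1) (e k).2))
    (fun k => ((st_mass S (e k).1)%:num
               * (gs_mass (s (e k).1) (e k).2)%:num)%:nng%R)
    (measure_add (image_measure (st_diff S) measurable_old)
       (mseries (fun i => mscale (st_mass S i)
          (image_measure (gs_diff (s i)) (measurable_copy i))) 0)).

End next_stage.

Fixpoint stages (beta : R) (s0 : gstring R) (s : nat -> nat -> gstring R)
    (e : nat -> nat -> nat * nat) (n : nat) : stage R :=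
  if n is m.+1 then next_stage beta (stages beta s0 s e m) (s m) (e m)
  else initial_stage s0.

Definition stage_measure (S : stage R) :
    {measure set (borel (st_root S)) -> \bar R} :=
  measure_add (st_diff S)
    (mseries (fun i => mscale (st_mass S i)
       (@dirac _ (borel (st_root S)) (st_loc S i) R)) 0).

Definition stage_rmspace (S : stage R) : rmspace R :=
  @RMSpace R (st_space S) (st_root S) (stage_measure S).

End construction.

Section independence.
Context {R : realType} {d : measure_display} {Omega : measurableType d}.
Variable P : probability Omega R.

Definition mutually_independent {I : choiceType} (F : I -> set_system Omega) :=
  forall (J : seq I) (A : I -> set Omega), uniq J ->
    (forall i, i \in J -> F i (A i)) ->
    P (\bigcap_(i in [set` J]) A i) = \prod_(i <- J) P (A i).

Definition sigma_of {d'} {S : measurableType d'} (X : Omega -> S) :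
    set_system Omega :=
  preimage_set_system setT X measurable.

(* All the objects of stages 0, ..., n are functions of these strings and
   enumerations: stage m.+1 is built from copy m and enum m. *)
Definition past (xi : Omega -> gstring R)
    (copy : nat -> nat -> Omega -> gstring R)
    (enum : nat -> Omega -> nat -> nat * nat) (n : nat) : set_system Omega :=
  <<s sigma_of xi `|`
      \bigcup_(m in `I_n) \bigcup_i sigma_of (copy m i) `|`
      \bigcup_(m in `I_n) \bigcup_k sigma_of (fun w => enum m w k) >>.

End independence.

(* Main.v *)
(* At a fixed sample point the branches glued to stage n have length
   P_i^beta L_i.  By independence the expectation of sum_i (P^(n)_i)^(p beta) is
   m^(n+1), where m < 1 is the mass moment, so the p-th powers of these lengths
   satisfy E[sum_n r^-n sum_i (P_i^beta L_i)^p] < oo as soon as m < r < 1; almost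
   surely all branches of stage n are then shorter than C q^n with q = r^(1/p) < 1.
   The stages and the retractions of stage n + 1 onto stage n thus have a compact
   inverse limit, which is again geodesic and 0-hyperbolic, hence an R-tree.  The
   diffuse measures increase to a measure on the limit; the mass of the atoms is
   transported by coding them as nested intervals.  Each stage embeds in the
   limit, which gives the convergence.
   The limit depends measurably on the sample point because it has countably many
   sections, dense and with measurable mutual distances, together with finitely
   supported measures on them that approximate the limit measure: the class of the
   tree is a continuous function of countably many measurable reals. *)

Require Import Defs.
From HB Require Import structures.
From mathcomp Require Import all_boot all_order all_algebra.
From mathcomp Require Import all_classical all_reals all_analysis.
From mathcomp Require Import measurable_realfun.
From mathcomp Require Import lra ring.

Set Implicit Arguments.
Unset Strict Implicit.
Unset Printing Implicit Defensive.

Import Order.TTheory GRing.Theory Num.Def Num.Theory.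
Import numFieldNormedType.Exports.

Local Open Scope classical_set_scope.
Local Open Scope ring_scope.

(** * Four-point condition and R-trees *)

(** [Rtree] quantifies over all injective paths, a property that does not visibly survive a limit.
    The four-point inequality and the existence of intermediate points do survive, up to errors that
    vanish, so gluing and limits are studied for these two only, and paths reappear in a single
    lemma. Mass may stay on atoms for ever (all of it, when the strings have no diffuse part), so
    the limit measure need not be the sum of the diffuse measures. A compactness argument would give
    a weak limit without a formula; the nested intervals give an explicit image of Lebesgue measure
    whose distance to each stage can be computed. All measures have mass 1, so one of the two
    Prokhorov inequalities implies the other. The limit is a different space at every sample point,
    so measurability is expressed through sections described by real coordinates. Finitely many
    distances do not reveal whether finitely many sections form a net of the whole space; the events
    that they do are therefore parameters of their own. *)

Section geodesic_four_point.
Context {R : realType} {T : metricType R}.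
Implicit Types x y z u v w : T.

(** Twice the Gromov product of [u] and [v] at the base point [r]. *)
Definition dgromov r u v : R := mdist r u + mdist r v - mdist u v.

(** 0-hyperbolicity at [r]: the product of [u] and [v] is at least the smaller of their products
    with [w]. The disjunction keeps every case linear. *)
Definition hyperbolic_at r := forall u v w,
  dgromov r u w <= dgromov r u v \/ dgromov r w v <= dgromov r u v.

Definition four_point := forall x y z t : T,
  mdist x y + mdist z t <= mdist x z + mdist y t \/
  mdist x y + mdist z t <= mdist x t + mdist y z.

Definition geodesic := forall x y (s : R), 0 <= s <= mdist x y ->
  exists2 z, mdist x z = s & mdist z y = mdist x y - s.

Lemma mdistC x y : mdist x y = mdist y x. Proof. exact: metric_sym. Qed.

(** The distances to [r] cancel when the three pairings of four points are compared, so the claim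
    becomes an inequality between sums of two Gromov products at [r]. The lower bounds for the
    products of [x], [y] and of [z], [t], through each of the two other points, imply it. *)
Lemma hyperbolic_four_point r : hyperbolic_at r -> four_point.
Proof.
move=> h x y z t; apply/orP; rewrite -[_ || _]negbK negb_or -!ltNge.
apply/negP => /andP[]; move: (h x y z) (h x y t) (h z t x) (h z t y).
rewrite /dgromov (mdistC z x) (mdistC z y) (mdistC t y).
move=> [] h1 [] h2 [] h3 [] h4 h5 h6; lra.
Qed.

Lemma mdist_diff x u v : `|mdist x u - mdist x v| <= mdist u v.
Proof.
have := metric_triangle x u v; have := metric_triangle x v u.
by rewrite (mdistC v u) ler_norml => *; apply/andP; split; lra.
Qed.

Lemma mdist_cvg {I} {F : set_system I} {FF : Filter F} (x : T) (f : I -> T) u :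
  f @ F --> u -> (fun i => mdist x (f i)) @ F --> mdist x u.
Proof.
move=> /metricType_numDomainType.cvgrPdist_lt fu.
apply/cvgrPdist_lt => e e0; apply: filterS (fu e e0) => i ui.
exact: le_lt_trans (mdist_diff _ _ _) ui.
Qed.

Lemma mdist_continuous x : continuous (mdist x).
Proof. by move=> u; apply: mdist_cvg; exact: cvg_id. Qed.

Hypothesis hT : four_point.

(** The four-point condition for [x], [y], [z], [z'] rules out two different geodesics from [x] to
    [y]. *)
Lemma four_point_on_geodesic x y z z' :
  mdist x z + mdist z y = mdist x y -> mdist x z' + mdist z' y = mdist x y ->
  mdist z z' = `|mdist x z - mdist x z'|.
Proof.
move=> xzy xzy'; apply/eqP; rewrite eq_le mdist_diff andbT.
have := hT x y z z'; rewrite (mdistC y z) (mdistC y z').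
have := ler_norm (mdist x z - mdist x z').
have := ler_norm (mdist x z' - mdist x z); rewrite (distrC (mdist x z')).
by move=> ? ? [] ?; lra.
Qed.

(** A point between [x] and [y] separates them. If the path avoided [z], the points of its image on
    the side of [x], recognised by a positive Gromov product with [x] at [z], would form a nonempty
    open and closed subset of a connected set; but [y] has product 0. *)
Lemma path_cut_point (a b : R) (f : R -> T) x y z : a <= b ->
  {within `[a, b], continuous f} -> f a = x -> f b = y ->
  mdist x z + mdist z y = mdist x y ->
  exists2 t, t \in `[a, b] & f t = z.
Proof.
move=> ab cf fax fby xzy; apply: contrapT => noz.
have fz t : t \in `[a, b] -> f t != z.
  by move=> tab; apply/eqP => ftz; apply: noz; exists t.
have ain : a \in `[a, b] by rewrite in_itv/= lexx.
have bin : b \in `[a, b] by rewrite in_itv/= lexx andbT.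
pose A := f @` `[a, b]%classic.
have cA : connected A.
  by apply: connected_continuous_connected => //; exact: segment_connected.
pose B := [set u | A u /\ 0 < dgromov z x u].
have dzx0 : 0 < mdist z x.
  by rewrite mdist_gt0 eq_sym -fax; exact: fz.
suff AB : B = A.
  have : A y by exists b => //; rewrite /= -fby.
  rewrite -AB => -[_]; rewrite /dgromov (mdistC z x); lra.
have gdiff u v : `|dgromov z x u - dgromov z x v| <= 2 * mdist u v.
  rewrite /dgromov.
  have := mdist_diff z u v; have := mdist_diff x u v.
  by rewrite !ler_norml => /andP[? ?] /andP[? ?]; apply/andP; split; lra.
have gcont : continuous (dgromov z x).
  move=> u; apply: cvgB; last exact: mdist_continuous.
  by apply: cvgD; [exact: cvg_cst|exact: mdist_continuous].
apply: cA.
- exists x; split; first by exists a.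
  by rewrite /dgromov mdistxx; lra.
- exists (dgromov z x @^-1` [set r | 0 < r]).
    by apply: open_comp => [u _|]; [exact: gcont|exact: open_gt].
  by apply/seteqP; split => u [].
(* A ball around [v] whose radius is the distance to [z] stays on the side of [v], so the points not
   on the side of [x] have an open neighbourhood that misses [B]. *)
- exists (~` \bigcup_(v in [set v | A v /\ dgromov z x v <= 0])
      (ball v (mdist z v))).
    rewrite closedC; apply: bigcup_open => v [_ _].
    rewrite ballEmdist.
    rewrite (_ : [set _ | _] = mdist v @^-1` [set r | r < mdist z v])//.
    by apply: open_comp => [u _|]; [exact: mdist_continuous|exact: open_lt].
  apply/seteqP; split => u [Au].
    move=> xu; split => //= -[v [Av xv]]; rewrite ballEmdist/= => vu.
    have := hT x v z u; move: xu xv vu.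
    rewrite /dgromov (mdistC x z) (mdistC v z) => ? ? ?.
    by have := mdist_ge0 z u => ? [] ?; lra.
  move=> nu; split => //; rewrite ltNge; apply/negP => xu; apply: nu.
  exists u => //; apply: ballxx; rewrite mdist_gt0 eq_sym.
  by case: Au => t tab <-; exact: fz.
Qed.

(** The reparametrisation of an injective path is the distance from [x]. It remains to show that the
    path never leaves the geodesic. *)
Lemma geodesic_four_point_Rtree :
  (exists2 A : set T, countable A & dense A) -> geodesic -> Rtree T.
Proof.
move=> sepT gT; split=> // x y; set D := mdist x y.
have D0 : 0 <= D by exact: mdist_ge0.
have /choice[g gP] : forall s, exists z, s \in `[0, D] ->
    mdist x z = s /\ mdist z y = D - s.
  move=> s; case: (boolP (s \in `[0, D])) => sD; last by exists x.
  by have [z ? ?] := gT x y s sD; exists z.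
have gmid s : s \in `[0, D] -> mdist x (g s) + mdist (g s) y = D.
  by move=> sD; have [-> ->] := gP s sD; lra.
have in0 : 0 \in `[0, D] by rewrite in_itv/= lexx.
have inD : D \in `[0, D] by rewrite in_itv/= lexx andbT.
exists g; split.
- by have [/mdist_positivity -> _] := gP _ in0.
- by have [_] := gP _ inD; rewrite subrr => /mdist_positivity.
- move=> s t sD tD.
  by rewrite (four_point_on_geodesic (gmid s sD) (gmid t tD)) !(proj1 (gP _ _)).
move=> a b f ab cf injf fax fby.
pose h t := mdist x (f t).
have ain : a \in `[a, b] by rewrite in_itv/= lexx.
have bin : b \in `[a, b] by rewrite in_itv/= lexx andbT.
have fgh t : t \in `[a, b] -> f t = g (h t).
  (* [s] is the Gromov product of [f t] and [y] at [x], so [z] is the point where the way from [x]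
     to [f t] leaves the geodesic. It is a cut point both between [x] and [f t] and between [f t]
     and [y]; injectivity merges the two visiting times, and [t] lies between them. *)
  move=> tab; pose s := dgromov x (f t) y / 2.
  have sD : s \in `[0, D].
    rewrite in_itv/= /s /dgromov.
    have := metric_triangle (f t) x y; have := metric_triangle x y (f t).
    rewrite (mdistC (f t) x) (mdistC y (f t)) -/D => ? ?.
    by apply/andP; split; lra.
  have [xz zy] := gP s sD; set z := g s in xz zy *.
  have zft : mdist z (f t) = mdist x (f t) - s.
    have := metric_triangle x z (f t); rewrite xz => ?.
    have := hT x y z (f t); rewrite xz (mdistC y z) zy (mdistC y (f t)) -/D.
    have : 2 * s = mdist x (f t) + D - mdist (f t) y.
      by rewrite /s /dgromov -/D; lra.
    by move=> ? [] ?; lra.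
  have [/andP[at_ tb]] : a <= t <= b by move: tab; rewrite in_itv.
  have [t1 t1P ft1] : exists2 t1, t1 \in `[a, t] & f t1 = z.
    apply: (path_cut_point at_ _ fax erefl); last by rewrite xz zft; lra.
    apply: (continuous_subspaceW _ cf) => u /=; rewrite !in_itv/= => /andP[-> /=].
    by move/le_trans; apply.
  have [t2 t2P ft2] : exists2 t2, t2 \in `[t, b] & f t2 = z.
    apply: (path_cut_point tb _ erefl fby); last first.
      by rewrite mdistC zft zy /s /dgromov -/D; lra.
    apply: (continuous_subspaceW _ cf) => u /=; rewrite !in_itv/= => /andP[tu ->].
    by rewrite (le_trans at_ tu).
  have t12 : t1 = t2.
    apply: injf; rewrite ?ft1 ?ft2//; move: t1P t2P; rewrite !in_itv/=.
      by move=> /andP[-> /le_trans ->].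
    by move=> _ /andP[/(le_trans at_) -> ->].
  have tt1 : t = t1.
    apply/eqP; rewrite eq_le {1}t12.
    by move: t1P t2P; rewrite !in_itv/= => /andP[_ ->] /andP[->].
  by rewrite /h {1 2}tt1 ft1 xz.
have ch : {within `[a, b], continuous h}.
  by move=> t; apply: mdist_cvg; exact: cf.
have ha : h a = 0 by rewrite /h fax mdistxx.
have hb : h b = D by rewrite /h fby.
exists h; split=> //.
have injh : {in `[a, b] &, injective h}.
  by move=> s t sab tab hst; apply: injf => //; rewrite !fgh// hst.
have [ba|{}ab] := leP b a.
  move=> s t; rewrite !in_itv/= => /andP[as_ _] /andP[_ tb] st.
  by have := le_lt_trans as_ (lt_le_trans st (le_trans tb ba)); rewrite ltxx.
have hmono : {in `[a, b] &, {mono h : s t / s <= t}}.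
  move=> s t sab tab; apply: (itv_continuous_inj_le _ ch injh sab tab).
  by exists a, b; split=> //; rewrite ha hb.
by move=> s t sab tab; rewrite (leW_mono_in hmono).
Qed.

End geodesic_four_point.

(** * Compactness and enlargements *)

Section compact_metric.
Context {R : realType}.

Lemma ultra_fmap {T U : Type} (f : T -> U) (F : set_system T) :
  UltraFilter F -> UltraFilter (f @ F).
Proof.
move=> UF; split=> [|G PG fFG]; first exact: fmap_proper_filter.
apply/seteqP; split=> // A GA.
have [//|FnA] := in_ultra_setVsetC (f @^-1` A) UF.
have GnA : G (~` A) by exact: fFG.
by have [x []] := filter_ex (filterI GA GnA).
Qed.

Lemma compact_ultra_cvg {I : Type} {T : metricType R} (F : set_system I)
    (f : I -> T) :
  compact [set: T] -> UltraFilter F -> exists p : T, f @ F --> p.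
Proof.
rewrite compact_ultra => cT UF.
have [|p [_ ?]] := cT (f @ F) (ultra_fmap f UF); first exact: filterT.
by exists p.
Qed.

(** Without a finite net, the sets of points far from a finite list generate a proper filter, and a
    cluster point [p] contradicts the member given by the list [[:: p]]. *)
Lemma compact_net {T : metricType R} (e : R) : compact [set: T] -> 0 < e ->
  exists s : seq T, forall x, exists2 y, y \in s & mdist y x < e.
Proof.
move=> cT e0; apply: contrapT => /forallNP nnet.
pose C (s : seq T) := [set x | forall y, y \in s -> e <= mdist y x].
have FC : ProperFilter (filter_from setT C).
  apply: filter_from_proper => [|s _].
    apply: filter_fromT_filter; first by exists [::].
    move=> s t; exists (s ++ t) => x Cx.
    by split=> y ys; apply: Cx; rewrite mem_cat ys ?orbT.
  have /existsNP[x nx] := nnet s; exists x => y ys.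
  by rewrite leNgt; apply/negP => yx; apply: nx; exists y.
have [|p [_ clp]] := cT _ FC; first by exists [::].
have [||x [Cx]] := clp (C [:: p]) (ball p e); [by exists [:: p]| |].
  exact: nbhsx_ballx.
by rewrite ballEmdist/= ltNge Cx// mem_head.
Qed.

Lemma compact_separable {T : metricType R} : compact [set: T] ->
  exists2 A : set T, countable A & dense A.
Proof.
move=> cT.
have /choice[s sP] : forall n, exists s : seq T,
    forall x, exists2 y, y \in s & mdist y x < n.+1%:R^-1.
  by move=> n; apply: compact_net => //; rewrite invr_gt0.
exists (\bigcup_n [set` s n]).
  by apply: bigcup_countable => // n _; exact: finite_set_countable.
move=> U [x Ux] oU; have /nbhs_ballP[e /= e0 xeU] := open_nbhs_nbhs (conj oU Ux).
have [n] := ltr_add_invr (e0 : 0 < e); rewrite add0r => ne.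
have [y ys yx] := sP n x; exists y; split; last by exists n.
by apply: xeU; rewrite ballEmdist/= mdistC (lt_trans yx).
Qed.

Lemma open_enlarge {T : metricType R} (A : set T) (e : R) : open (enlarge A e).
Proof.
rewrite (_ : enlarge A e = \bigcup_(a in A) (mdist a @^-1` [set r | r < e])).
  apply: bigcup_open => a _; apply: open_comp => [u _|]; last exact: open_lt.
  exact: mdist_continuous.
by apply/seteqP; split=> x [a Aa ax]; exists a.
Qed.

Lemma sub_enlarge {T : metricType R} (A : set T) (e : R) :
  0 < e -> A `<=` enlarge A e.
Proof. by move=> e0 a Aa; exists a => //; rewrite mdistxx. Qed.

Lemma enlarge_enlarge {T : metricType R} (A : set T) (e e' : R) :
  enlarge (enlarge A e) e' `<=` enlarge A (e + e').
Proof.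
move=> x [y [a Aa ay] yx]; exists a => //.
by rewrite (le_lt_trans (metric_triangle _ y _))// ltrD.
Qed.

Lemma le_enlarge {T : metricType R} (A : set T) (e e' : R) : e <= e' ->
  enlarge A e `<=` enlarge A e'.
Proof. by move=> ee' x [a Aa ax]; exists a => //; exact: lt_le_trans ax ee'. Qed.

Lemma measurable_enlarge {T : metricType R} (r : T) (A : set T) (e : R) :
  measurable (enlarge A e : set (borel r)).
Proof. by apply: sub_sigma_algebra; exact: open_enlarge. Qed.

(* One half of the Prokhorov condition follows from the other applied to the
   complement of [enlarge B e]. *)
Lemma prokhorov_flip {T : metricType R} (r : T)
    (mu : set T -> \bar R) (nu : {measure set (borel r) -> \bar R}) (e eta : R) :
  (forall A, 0 <= mu A)%E ->
  (forall A : set T, measurable (A : set (borel r)) ->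
    mu setT <= mu A + mu (~` A))%E ->
  (nu setT = 1)%E -> ((1 - eta)%:E <= mu setT)%E ->
  (forall B : set T, measurable (B : set (borel r)) ->
    mu B <= nu (enlarge B e) + e%:E)%E ->
  forall B : set T, measurable (B : set (borel r)) ->
    (nu B <= mu (enlarge B e) + (e + eta)%:E)%E.
Proof.
move=> mu0 muC nu1 mu1 h B mB.
pose C : set T := ~` enlarge B e.
have mE := @measurable_enlarge _ r B e.
have mC : measurable (C : set (borel r)) by exact: measurableC.
have CB : enlarge C e `<=` ~` B.
  by move=> x [c nc cx] Bx; apply: nc; exists x => //; rewrite mdistC.
have nuB : (nu (~` B) = 1 - nu B)%E.
  rewrite -nu1 -[X in (_ = nu X - _)%E](setvU B) measureU ?setICl//; last first.
    exact: measurableC.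
  rewrite addeK// ge0_fin_numE// (le_lt_trans _ (ltry 1))// -nu1.
  by apply: le_measure; rewrite ?inE.
have nufin : (nu B \is a fin_num)%E.
  rewrite ge0_fin_numE// (le_lt_trans _ (ltry 1))// -nu1.
  by apply: le_measure; rewrite ?inE.
have h1 : (mu C <= 1 - nu B + e%:E)%E.
  apply: le_trans (h C mC) _; rewrite leeD2r// -nuB; apply: le_measure => //.
    by rewrite inE; exact: measurable_enlarge.
  by rewrite inE; exact: measurableC.
move: mu1 => /le_trans/(_ (muC _ mE))/le_trans/(_ (leeD2l _ h1)).
have := mu0 (enlarge B e).
rewrite -(fineK nufin); case: (mu (enlarge B e)) => [x| |]//=; last first.
  by move=> _ _; rewrite addye// leey.
rewrite -?EFinN -!EFinD !lee_fin; lra.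
Qed.

End compact_metric.

Lemma ler_distE {R : realDomainType} (p q : R) : p <= q -> `|p - q| = q - p.
Proof. by move=> pq; rewrite ler0_norm ?opprB// subr_le0. Qed.

Lemma ger_distE {R : realDomainType} (p q : R) : q <= p -> `|p - q| = p - q.
Proof. by move=> pq; rewrite ger0_norm// subr_ge0. Qed.

(** * Attaching segments *)

Section segment_tree.
Context {R : realType} (ell : R) (ell0 : 0 < ell).

Lemma seg_hyperbolic : hyperbolic_at (seg_of ell0 0).
Proof.
have d0 (u : seg ell) : mdist (seg_of ell0 0) u = val u.
  rewrite /mdist/= /maxr /minr ell0 ltxx sub0r normrN ger0_norm//.
  by case: u => u /= /andP[].
move=> u v w; rewrite /dgromov !d0 /mdist/=.
case: u v w => [u u0] [v v0] [w w0] /=.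
case: (leP u v) => uv; case: (leP u w) => uw; case: (leP w v) => wv;
  rewrite ?(ler_distE uv) ?(ler_distE uw) ?(ler_distE wv) ?(ger_distE (ltW uv))
    ?(ger_distE (ltW uw)) ?(ger_distE (ltW wv));
  by [left; lra|right; lra].
Qed.

Lemma seg_geodesic : @geodesic R (seg ell).
Proof.
move=> [x x0] [y y0] s; have /andP[x0' xl] := x0; have /andP[y0' yl] := y0.
rewrite /mdist/= => /andP[s0 sxy].
have [xy|yx] := leP x y.
  move: sxy; rewrite ler0_norm ?subr_le0// => sxy.
  have z0 : 0 <= x + s <= ell by apply/andP; split; lra.
  exists (exist (fun t : R => 0 <= t <= ell) _ z0); rewrite /mdist/= ler0_norm; lra.
move: sxy; rewrite gtr0_norm ?subr_gt0// => sxy.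
have z0 : 0 <= x - s <= ell by apply/andP; split; lra.
exists (exist (fun t : R => 0 <= t <= ell) _ z0); rewrite /mdist/= ger0_norm; lra.
Qed.

Lemma seg_compact : compact [set: seg ell].
Proof.
rewrite (_ : setT = seg_of ell0 @` `[0, ell]%classic).
  apply: (@continuous_compact R (seg ell)); last exact: segment_compact.
  apply: continuous_subspaceT.
  apply: (@lipschitz_continuous R R^o (seg ell) _ 1) => s t.
  by rewrite mul1r (le_trans (seg_of_lipschitz _ _ _))// distrC.
apply/seteqP; split=> // -[u u0] _; have /andP[u1 u2] := u0.
exists u; first by rewrite /= in_itv/= u1.
by apply/val_inj => /=; rewrite (min_idPl u2) (max_idPr u1).
Qed.

End segment_tree.

Section attach_tree.
Context {R : realType} {T : metricType R} (x : nat -> T) (l : nat -> R).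

Definition attach_proj (a : attach x l) : T :=
  match a with inl u => u | inr s => x (val s).1 end.

Definition attach_height (a : attach x l) : R :=
  match a with inl u => 0 | inr s => (val s).2 end.

Lemma attach_projE (a : attach x l) :
  mdist (inl (attach_proj a) : attach x l) a = attach_height a.
Proof. by case: a => [u|s]; rewrite /mdist/= mdistxx ?add0r. Qed.

Lemma attach_proj_lipschitz (a b : attach x l) :
  mdist (attach_proj a) (attach_proj b) <= mdist a b.
Proof.
case: a b => [u|[[i s] si]] [v|[[j t] tj]]; rewrite [leRHS]/mdist//=;
  move: (si) (tj) => /= /andP[? _] /andP[? _] || move: (si) => /= /andP[? _]
  || move: (tj) => /= /andP[? _]; rewrite ?lerDl; try lra.
by case: eqP => [->|_]; rewrite ?mdistxx//; lra.
Qed.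

(** Seen from a root in [T], a point of branch [i] has the same Gromov product as [x i] with every
    point outside this branch, and two points of one branch exceed the product of [x i] with itself
    by their smaller height. So either the inequality of [T] or a comparison of heights applies. *)
Lemma attach_hyperbolic (r : T) :
  hyperbolic_at r -> hyperbolic_at (inl r : attach x l).
Proof.
move=> hT [u|[[i s] si]] [v|[[j t] tj]] [w|[[k q] qk]]; rewrite /dgromov /mdist/=.
- exact: hT.
- by have := hT u v (x k); rewrite /dgromov => -[?|?]; [left|right]; lra.
- by have := hT u (x j) w; rewrite /dgromov => -[?|?]; [left|right]; lra.
- have [->|kj] := eqVneq k j; first by left; lra.
  by have := hT u (x j) (x k); rewrite /dgromov => -[?|?]; [left|right]; lra.
- by have := hT (x i) v w; rewrite /dgromov => -[?|?]; [left|right]; lra.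
- have [->|ik] := eqVneq i k; first by right; lra.
  by have := hT (x i) v (x k); rewrite /dgromov => -[?|?]; [left|right]; lra.
- move: si tj => /= /andP[s0 _] /andP[t0 _].
  have [->|ij] := eqVneq i j.
    left; have := metric_triangle r (x j) w.
    by case: (leP s t) => st; rewrite ?(ler_distE st) ?(ger_distE (ltW st)); lra.
  by have := hT (x i) (x j) w; rewrite /dgromov => -[?|?]; [left|right]; lra.
- move: si tj qk => /= /andP[s0 _] /andP[t0 _] /andP[q0 _].
  have [->|ij] := eqVneq i j; last first.
    have [ik|ik] := eqVneq i k; first by subst k; rewrite (negbTE ij); right; lra.
    have [->|kj] := eqVneq k j; first by left; lra.
    by have := hT (x i) (x j) (x k); rewrite /dgromov => -[?|?]; [left|right]; lra.
  have [->|jk] := eqVneq j k; last first.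
    left; have := metric_triangle r (x j) (x k).
    by case: (leP s t) => st; rewrite ?(ler_distE st) ?(ger_distE (ltW st)); lra.
  case: (leP s t) => st; case: (leP s q) => sq; case: (leP q t) => qt;
    rewrite ?(ler_distE st) ?(ler_distE sq) ?(ler_distE qt)
      ?(ger_distE (ltW st)) ?(ger_distE (ltW sq)) ?(ger_distE (ltW qt));
    by [left; lra|right; lra].
Qed.

Let geodesic_flip {S : metricType R} (a b : S) (s : R) :
  (exists2 c, mdist b c = mdist b a - s & mdist c a = mdist b a - (mdist b a - s)) ->
  exists2 c, mdist a c = s & mdist c b = mdist a b - s.
Proof.
by move=> [c bc ca]; exists c; rewrite mdistC ?ca ?bc ?(mdistC a b) ?subKr.
Qed.

Definition attach_inr i t (p : 0 < t <= l i) : attach x l :=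
  inr (exist (fun b : nat * R => 0 < b.2 <= l b.1) (i, t) p).

Lemma mdist_inl_inr u i t (p : 0 < t <= l i) :
  mdist (inl u : attach x l) (attach_inr p) = mdist u (x i) + t.
Proof. by []. Qed.

Lemma mdist_inr_inr i t (p : 0 < t <= l i) j s (q : 0 < s <= l j) :
  mdist (attach_inr p) (attach_inr q) =
  if i == j then `|t - s| else t + mdist (x i) (x j) + s.
Proof. by []. Qed.

Lemma attachP (a : attach x l) : (exists u, a = inl u) \/
  exists i t (p : 0 < t <= l i), a = attach_inr p.
Proof. by case: a => [u|[[i t] p]]; [left; exists u|right; exists i, t, p]. Qed.

Lemma attach_geodesic : @geodesic R T -> @geodesic R (attach x l).
Proof.
move=> gT.
have LL (u v : T) : mdist (inl u : attach x l) (inl v) = mdist u v by [].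
have LR u j t (tj : 0 < t <= l j) s :
  0 <= s <= mdist (inl u : attach x l) (attach_inr tj) ->
  exists2 z, mdist (inl u : attach x l) z = s &
    mdist z (attach_inr tj) = mdist (inl u : attach x l) (attach_inr tj) - s.
  rewrite mdist_inl_inr => /andP[s0 sd]; have /andP[t0 tl] := tj.
  have [su|us] := leP s (mdist u (x j)).
    have [|z uz zx] := gT u (x j) s; first by rewrite s0.
    by exists (inl z) => //; rewrite mdist_inl_inr zx; lra.
  have p : 0 < s - mdist u (x j) <= l j by apply/andP; split; lra.
  exists (attach_inr p); first by rewrite mdist_inl_inr; lra.
  by rewrite mdist_inr_inr eqxx ler_distE; lra.
move=> a b; case: (attachP a) (attachP b) => [[u ->]|[i [s [si ->]]]]
  [[v ->]|[j [t [tj ->]]]] c.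
- by rewrite LL => /gT[z uz zv]; exists (inl z).
- exact: LR.
- move=> cd; apply: geodesic_flip; apply: LR; rewrite mdistC.
  by move: cd => /andP[? ?]; apply/andP; split; lra.
have /andP[s0 sl] := si; have /andP[t0 tl] := tj.
rewrite mdist_inr_inr; case: eqVneq => [ij|ij] /andP[c0 cd].
  subst j; have [st|ts] := leP s t.
    move: cd; rewrite (ler_distE st) => cd.
    have p : 0 < s + c <= l i by apply/andP; split; lra.
    by exists (attach_inr p); rewrite mdist_inr_inr eqxx ler_distE; lra.
  move: cd; rewrite (ger_distE (ltW ts)) => cd.
  have p : 0 < s - c <= l i by apply/andP; split; lra.
  by exists (attach_inr p); rewrite mdist_inr_inr eqxx ger_distE; lra.
have [cs|sc] := ltP c s.
  have p : 0 < s - c <= l i by apply/andP; split; lra.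
  exists (attach_inr p); first by rewrite mdist_inr_inr eqxx ger_distE; lra.
  by rewrite mdist_inr_inr (negbTE ij); lra.
have [cs|cs] := leP c (s + mdist (x i) (x j)).
  have [|z xz zx] := gT (x i) (x j) (c - s); first by apply/andP; split; lra.
  by exists (inl z); rewrite ?(mdistC (attach_inr si)) mdist_inl_inr;
    rewrite ?(mdistC z (x i)) ?xz ?zx; lra.
have p : 0 < c - s - mdist (x i) (x j) <= l j by apply/andP; split; lra.
exists (attach_inr p); first by rewrite mdist_inr_inr (negbTE ij); lra.
by rewrite mdist_inr_inr eqxx ler_distE; lra.
Qed.

(** An ultrafilter either contains one branch, which is compact, or avoids any finite number of
    branches. In the second case the heights tend to 0 along it, and it converges to the limit of
    its projections to [T]. *)
Lemma attach_compact : (forall e, 0 < e -> exists N, forall i, (N <= i)%N -> l i < e) ->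
  compact [set: T] -> compact [set: attach x l].
Proof.
move=> l0 cT; rewrite compact_ultra => F UF _.
have PF : ProperFilter F by exact: ultra_proper.
pose B i := [set a : attach x l | exists2 s, a = inr s & (val s).1 = i].
have [[i FB]|nB] := pselect (exists i, F (B i)).
  have cB : compact (branch x l i @` `[0, l i]%classic).
    apply: (@continuous_compact R (attach x l)); last exact: segment_compact.
    apply: continuous_subspaceT.
    apply: (@lipschitz_continuous R R^o (attach x l) _ 1) => s t.
    by rewrite mul1r (le_trans (branch_lipschitz _ _ _ _ _))// distrC.
  move: cB; rewrite compact_ultra => /(_ F UF)[|p [_ Fp]]; last by exists p.
  apply: filterS FB => a [[[j t] tj]] -> /= ji; subst j.
  have /= /andP[t0 tl] := tj.
  exists t; first by rewrite /= in_itv/= (ltW t0).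
  rewrite /branch; case: insubP => [b _ vb|]/=; last by rewrite (min_idPl tl) t0 tl.
  by congr inr; apply/val_inj; rewrite /= vb (min_idPl tl).
have FnB N : F (\bigcap_(i in `I_N) ~` B i).
  elim: N => [|N IH]; first by apply: filterS filterT => a _ i.
  have [FB|FBn] := in_ultra_setVsetC (B N) UF; first by case: nB; exists N.
  apply: filterS (filterI IH FBn) => a [aN naN] i; rewrite /= ltnS leq_eqVlt.
  by move=> /predU1P[->//|]; exact: aN.
have [p Fp] := compact_ultra_cvg attach_proj cT UF.
exists (inl p); split=> //.
apply/metricType_numDomainType.fcvgrPdist_lt => e e0.
have e20 : 0 < e / 2 by rewrite divr_gt0.
have [N NP] := l0 _ e20.
move/metricType_numDomainType.cvgrPdist_lt : Fp => /(_ _ e20) Fp.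
apply: filterS (filterI Fp (FnB N)) => -[u|[[i s] si]] [/= pa aN]; rewrite /mdist/=.
  by lra.
have Ni : (N <= i)%N.
  rewrite leqNgt; apply/negP => iN; apply: (aN i iN).
    by exists (exist (fun b : nat * R => 0 < b.2 <= l b.1) _ si).
by have := NP _ Ni; have /= /andP[_ ?] := si; lra.
Qed.

End attach_tree.

(** Turns approximate intermediate points into exact ones in [tlim_geodesic]. *)
Lemma compact_zero {R : realType} {T : metricType R} (f : T -> R) :
  compact [set: T] -> continuous f -> (forall x, 0 <= f x) ->
  (forall e, 0 < e -> exists x, f x < e) -> exists x, f x = 0.
Proof.
move=> cT cf f0 fe.
pose C (e : R) := [set x | f x < e].
have FC : ProperFilter (filter_from [set e : R | 0 < e] C).
  apply: filter_from_proper => [|e e0]; last exact: fe.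
  apply: filter_from_filter; first by exists 1 => /=.
  move=> e e' /= e0 e0'; exists (minr e e') => /=; first by rewrite lt_min e0.
  by move=> x; rewrite /C/= lt_min => /andP[].
have [|p [_ clp]] := cT _ FC; first by exists 1 => //=.
exists p; apply: contrapT => /eqP fp0.
have fp : 0 < f p by rewrite lt_def fp0 f0.
have fp2 : 0 < f p / 2 by rewrite divr_gt0.
have fp2p : f p / 2 < f p by lra.
have [||x [/= x1 x2]] := clp (C (f p / 2)) (f @^-1` [set r | f p / 2 < r]).
- by exists (f p / 2).
- by apply: cf; apply: open_nbhs_nbhs; split; [exact: open_gt|].
- by have := lt_trans x1 x2; rewrite ltxx.
Qed.

(** * Inverse limits of metric spaces *)

(** Isometric inclusions with 1-Lipschitz retractions. One level adds at most a difference of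
    consecutive errors, so the contributions telescope and everything beyond level [n] lies within
    [tw_err n]. *)
Record tower (R : realType) := Tower {
  tw_space :> nat -> metricType R ;
  tw_up : forall n, tw_space n -> tw_space n.+1 ;
  tw_dn : forall n, tw_space n.+1 -> tw_space n ;
  tw_err : nat -> R ;
  tw_upK : forall n (u : tw_space n), tw_dn (tw_up u) = u ;
  tw_up_iso : forall n, isometric (@tw_up n) ;
  tw_dn_lip : forall n (u v : tw_space n.+1),
    mdist (tw_dn u) (tw_dn v) <= mdist u v ;
  tw_err_ge0 : forall n, 0 <= tw_err n ;
  tw_up_dn : forall n (u : tw_space n.+1),
    mdist (tw_up (tw_dn u)) u <= tw_err n - tw_err n.+1 ;
  tw_err_small : forall e, 0 < e -> exists n, tw_err n < e }.

Definition tlim {R : realType} (E : tower R) : Type :=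
  {u : forall n, E n | forall n, tw_dn (u n.+1) = u n}.

Section tlim_metric.
Context {R : realType} (E : tower R).
Implicit Types u v w : tlim E.

Lemma tlim_eq u v : (forall n, sval u n = sval v n) -> u = v.
Proof.
case: u v => [u pu] [v pv] /= uv; apply: eq_exist => /=.
exact: functional_extensionality_dep.
Qed.

(** The supremum is a limit: the distances of the components increase with the level because the
    projections are 1-Lipschitz. *)
Definition tlim_dist u v : R := sup (range (fun n => mdist (sval u n) (sval v n))).

Lemma tlim_component_le u v n k : (n <= k)%N ->
  mdist (sval u n) (sval v n) <= mdist (sval u k) (sval v k).
Proof.
move=> /subnK <-; elim: (k - n)%N => // j IH; apply: le_trans IH _.
by rewrite addSn -(svalP u) -(svalP v) tw_dn_lip.
Qed.

(** The factor 2 arises because both points are displaced when they are replaced by their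
    projections. *)
Lemma tlim_component_ge u v n k : (n <= k)%N -> mdist (sval u k) (sval v k) <=
  mdist (sval u n) (sval v n) + 2 * (tw_err E n - tw_err E k).
Proof.
move=> /subnK <-; elim: (k - n)%N => [|j IH]; first by rewrite add0n; lra.
rewrite addSn; set m := (j + n)%N in IH *.
have := tw_up_dn (sval u m.+1); have := tw_up_dn (sval v m.+1).
rewrite (svalP u) (svalP v).
have := metric_triangle (sval u m.+1) (tw_up (sval u m)) (sval v m.+1).
have := metric_triangle (tw_up (sval u m)) (tw_up (sval v m)) (sval v m.+1).
rewrite tw_up_iso (mdistC (sval u m.+1) (tw_up (sval u m))); lra.
Qed.

Lemma tlim_component_bound u v n k :
  mdist (sval u k) (sval v k) <= mdist (sval u n) (sval v n) + 2 * tw_err E n.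
Proof.
have e0 := tw_err_ge0 E; have [nk|kn] := leqP n k.
  by have := tlim_component_ge u v nk; have := e0 k; lra.
by have := tlim_component_le u v (ltnW kn); have := e0 n; lra.
Qed.

Lemma tlim_has_sup u v : has_sup (range (fun n => mdist (sval u n) (sval v n))).
Proof.
split; first by exists (mdist (sval u 0) (sval v 0)); exists 0%N.
exists (mdist (sval u 0) (sval v 0) + 2 * tw_err E 0) => _ [k _ <-].
exact: tlim_component_bound.
Qed.

Lemma tlim_dist_ge u v n : mdist (sval u n) (sval v n) <= tlim_dist u v.
Proof. by apply: sup_upper_bound; [exact: tlim_has_sup|exists n]. Qed.

Lemma tlim_dist_leP u v (c : R) :
  (forall n, mdist (sval u n) (sval v n) <= c) -> tlim_dist u v <= c.
Proof.
move=> uvc; apply: ge_sup; first by case: (tlim_has_sup u v).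
by move=> _ [n _ <-].
Qed.

Lemma tlim_dist_le u v n :
  tlim_dist u v <= mdist (sval u n) (sval v n) + 2 * tw_err E n.
Proof. by apply: tlim_dist_leP => k; exact: tlim_component_bound. Qed.

Let tlim_distxx u : tlim_dist u u = 0.
Proof.
apply/eqP; rewrite eq_le (le_trans _ (tlim_dist_ge u u 0)) ?mdist_ge0// andbT.
by apply: tlim_dist_leP => n; rewrite mdistxx.
Qed.

Let tlim_dist_positivity u v : tlim_dist u v = 0 -> u = v.
Proof.
move=> uv0; apply: tlim_eq => n; apply: mdist_positivity; apply/eqP.
by rewrite eq_le mdist_ge0 andbT -uv0 tlim_dist_ge.
Qed.

Let tlim_dist_sym u v : tlim_dist u v = tlim_dist v u.
Proof.
by rewrite /tlim_dist; congr (sup _); apply: eq_imagel => n _; exact: mdistC.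
Qed.

Let tlim_dist_triangle v u w : tlim_dist u w <= tlim_dist u v + tlim_dist v w.
Proof.
apply: tlim_dist_leP => n.
by rewrite (le_trans (metric_triangle _ (sval v n) _))// lerD ?tlim_dist_ge.
Qed.

HB.instance Definition _ := gen_eqMixin (tlim E).
HB.instance Definition _ := gen_choiceMixin (tlim E).
HB.instance Definition _ := isMetric.Build R (tlim E)
  tlim_distxx tlim_dist_positivity tlim_dist_sym tlim_dist_triangle.

Lemma tlim_mdist_ge u v n : mdist (sval u n) (sval v n) <= mdist u v.
Proof. exact: tlim_dist_ge. Qed.

Lemma tlim_mdist_le u v n :
  mdist u v <= mdist (sval u n) (sval v n) + 2 * tw_err E n.
Proof. exact: tlim_dist_le. Qed.

Lemma tlim_mdist_leP u v (c : R) :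
  (forall n, mdist (sval u n) (sval v n) <= c) -> mdist u v <= c.
Proof. exact: tlim_dist_leP. Qed.

(* Below level [n] the thread through [a] is obtained by projecting, above it by
   including. *)
Lemma tw_inj_subproof n (a : E n) : exists v : tlim E, sval v n = a /\
  forall k, (n <= k)%N -> sval v k.+1 = tw_up (sval v k).
Proof.
elim: n a => [a|n IH a].
  pose v := nat_rect (fun n => tw_space E n) a (fun k x => tw_up x).
  by exists (exist (fun u : forall n, E n => forall n, tw_dn (u n.+1) = u n) v
    (fun n => tw_upK (v n))).
have [v [vn vup]] := IH (tw_dn a).
(* The thread has [a] at level [n.+1], follows [v] below and inclusions above. The equality proof of
   the level is kept in order to transport [a] to the type of that level. *)
pose w := fix w k : E k := match k with
  | 0 => sval v 0
  | k'.+1 => match @eqP _ k' n with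
             | ReflectT e => ecast i (E i.+1) (esym e) a
             | ReflectF _ => if (k' < n)%N then sval v k'.+1 else tw_up (w k')
             end
  end.
have wle k : (k <= n)%N -> w k = sval v k.
  case: k => //= k kn; case: eqP => [kn'|_]; last by rewrite kn.
  by exfalso; move: kn; rewrite kn' ltnn.
have wn : w n.+1 = a by rewrite /=; case: eqP => // e; rewrite eq_axiomK.
have wgt k : (n < k)%N -> w k.+1 = tw_up (w k).
  move=> nk /=; case: eqP => [kn|_]; first by exfalso; move: nk; rewrite kn ltnn.
  by rewrite ltnNge (ltnW nk).
have wdn k : tw_dn (w k.+1) = w k.
  have [kn|nk|->] := ltngtP k n.
  - by rewrite !wle ?(ltnW kn)// (svalP v).
  - by rewrite wgt// tw_upK.
  - by rewrite wn wle// vn.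
by exists (exist (fun u : forall n, E n => forall n, tw_dn (u n.+1) = u n) w wdn).
Qed.

Definition tw_inj n (a : E n) : tlim E := sval (cid (tw_inj_subproof a)).

Lemma tw_injE n (a : E n) : sval (tw_inj a) n = a.
Proof. by rewrite /tw_inj; case: cid => v []. Qed.

Lemma tw_inj_upE n (a : E n) k : (n <= k)%N ->
  sval (tw_inj a) k.+1 = tw_up (sval (tw_inj a) k).
Proof. by rewrite /tw_inj; move: (cid _) => [v [vn h]]; exact: h. Qed.

Lemma tw_inj_iso n : isometric (@tw_inj n).
Proof.
move=> a b; apply/eqP; rewrite eq_le; apply/andP; split; last first.
  by have := tlim_mdist_ge (tw_inj a) (tw_inj b) n; rewrite !tw_injE.
apply: tlim_mdist_leP => k; have [kn|nk] := leqP k n.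
  by have := tlim_component_le (tw_inj a) (tw_inj b) kn; rewrite !tw_injE.
rewrite -(subnK (ltnW nk)); elim: (k - n)%N => [|j IH].
  by rewrite add0n !tw_injE.
by rewrite addSn !tw_inj_upE ?leq_addl// tw_up_iso.
Qed.

Lemma tlim_eq_from u v n :
  (forall k, (n <= k)%N -> sval u k = sval v k) -> u = v.
Proof.
move=> uv; apply: tlim_eq => k; apply: mdist_positivity; apply/eqP.
rewrite eq_le mdist_ge0 andbT.
have := tlim_component_le u v (leq_maxl k n).
by rewrite (uv (maxn k n)) ?leq_maxr// mdistxx.
Qed.

Lemma tw_inj_up n (a : E n) : tw_inj (tw_up a) = tw_inj a.
Proof.
apply: (@tlim_eq_from _ _ n.+1) => k /subnK <-; elim: (k - n.+1)%N => [|j IH].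
  by rewrite add0n tw_injE tw_inj_upE// tw_injE.
by rewrite addSn tw_inj_upE ?leq_addl// IH tw_inj_upE// (leq_trans _ (leq_addl _ _)).
Qed.

Lemma tw_inj_proj u n : mdist (tw_inj (sval u n)) u <= 2 * tw_err E n.
Proof.
have := tlim_mdist_le (tw_inj (sval u n)) u n.
by rewrite tw_injE mdistxx add0r.
Qed.

Hypothesis E_compact : forall n, compact [set: E n].

(** An ultrafilter converges at each level. The limits form a thread by continuity of the
    projections, and a single level with small error controls the distance in the limit space. *)
Lemma tlim_compact : compact [set: tlim E].
Proof.
rewrite compact_ultra => F UF _.
pose pc n := cid (compact_ultra_cvg (fun u : tlim E => sval u n) (@E_compact n) UF).
pose p n := sval (pc n).
have pP n : (fun u : tlim E => sval u n) @ F --> p n := svalP (pc n).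
have PF : ProperFilter F by exact: ultra_proper.
have pdn n : tw_dn (p n.+1) = p n.
  have h : (fun u : tlim E => sval u n) @ F --> tw_dn (p n.+1).
    have c : continuous (@tw_dn _ E n).
      by apply: (@lipschitz_continuous _ _ _ _ 1) => s t; rewrite mul1r tw_dn_lip.
    have := cvg_comp _ _ (pP n.+1) (c (p n.+1)).
    rewrite (_ : _ \o _ = (fun u : tlim E => sval u n))//.
    by apply/funext => u /=; rewrite (svalP u).
  by apply: (@cvg_unique _ (@metric_hausdorff _ (E n)) _ _ _ _ h (pP n)).
exists (exist (fun u : forall n, E n => forall n, tw_dn (u n.+1) = u n) p pdn).
split=> //; apply/metricType_numDomainType.fcvgrPdist_lt => e e0.
have e4 : 0 < e / 4 by rewrite divr_gt0.
have [n ne] := tw_err_small E e4.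
have /metricType_numDomainType.cvgrPdist_lt /(_ _ e4) := pP n.
apply: filterS => u pu; apply: le_lt_trans (tlim_mdist_le _ _ n) _.
by move: pu; rewrite /=; lra.
Qed.

Lemma tlim_hyperbolic (r : tlim E) :
  (forall n, hyperbolic_at (sval r n)) -> hyperbolic_at r.
Proof.
move=> hE u v w; apply/orP; rewrite -[_ || _]negbK negb_or -!ltNge.
apply/negP => /andP[h1 h2].
(* [g] measures a supposed violation. The two products compared involve six distances, each changed
   by at most twice the error at level [n], so an error below [g / 12] leaves a violation at that
   level. *)
pose g := minr (dgromov r u w - dgromov r u v) (dgromov r w v - dgromov r u v).
have g0 : 0 < g / 12 by rewrite divr_gt0// /g lt_min !subr_gt0 h1.
have [n ne] := tw_err_small E g0.
have g1 : g <= dgromov r u w - dgromov r u v by rewrite /g ge_min lexx.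
have g2 : g <= dgromov r w v - dgromov r u v by rewrite /g ge_min lexx orbT.
have := hE n (sval u n) (sval v n) (sval w n); move: g1 g2; rewrite /dgromov.
have := tlim_mdist_le r u n; have := tlim_mdist_ge r u n.
have := tlim_mdist_le r v n; have := tlim_mdist_ge r v n.
have := tlim_mdist_le r w n; have := tlim_mdist_ge r w n.
have := tlim_mdist_le u v n; have := tlim_mdist_ge u v n.
have := tlim_mdist_le u w n; have := tlim_mdist_ge u w n.
have := tlim_mdist_le w v n; have := tlim_mdist_ge w v n.
by move=> ? ? ? ? ? ? ? ? ? ? ? ? ? ? [] ?; lra.
Qed.

Lemma tlim_geodesic : (forall n, @geodesic R (E n)) -> @geodesic R (tlim E).
Proof.
move=> gE u v s /andP[s0 sD].
(* The zeros of [f] are the points sought. Intermediate points of the levels make [f] arbitrarily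
   small. *)
pose f (z : tlim E) : R := `|mdist u z - s| + `|mdist v z - (mdist u v - s)|.
have [|||z fz] := @compact_zero _ _ f tlim_compact; last 1 first.
- move/eqP : fz; rewrite paddr_eq0// !normr_eq0 !subr_eq0 => /andP[/eqP uz /eqP vz].
  by exists z => //; rewrite mdistC.
- have h w (c : R) : continuous (fun z : tlim E => `|mdist w z - c|).
    by move=> z; exact: (cvg_norm (cvgB (@mdist_continuous _ _ w z) (cvg_cst c))).
  by move=> z; exact: (cvgD (h _ _ z) (h _ _ z)).
- by move=> z; rewrite addr_ge0.
move=> e e0; have e12 : 0 < e / 12 by rewrite divr_gt0.
have [n ne] := tw_err_small E e12; have n0 := tw_err_ge0 E n.
have := tlim_mdist_le u v n; have := tlim_mdist_ge u v n => D1 D2.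
(* The minimum is taken because [s] may exceed the distance of the components at level [n], though
   only by a multiple of the error. *)
have [|z uz zv] := gE n (sval u n) (sval v n) (minr s (mdist (sval u n) (sval v n))).
  by rewrite le_min s0 mdist_ge0 ge_min lexx orbT.
exists (tw_inj z); rewrite /f.
have := tlim_mdist_le u (tw_inj z) n; have := tlim_mdist_ge u (tw_inj z) n.
have := tlim_mdist_le v (tw_inj z) n; have := tlim_mdist_ge v (tw_inj z) n.
rewrite !tw_injE uz (mdistC (sval v n)) zv => v1 v2 u1 u2.
have e0' : 0 < e by [].
have e2 : e = e / 2 + e / 2 by lra.
rewrite e2; apply: ltrD; rewrite ltr_norml; move: v1 v2 u1 u2;
  by case: (leP s (mdist (sval u n) (sval v n))) => ? ? ? ? ?; apply/andP; split; lra.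
Qed.

End tlim_metric.

Local Open Scope ereal_scope.

(** Rewrites a sum over the atoms of a new stage as a sum over parent atoms and over the atoms of
    each attached copy. *)
Lemma pair_series {R : realType} (e : nat -> nat * nat) (f : nat -> nat -> \bar R) :
  bijective e -> (forall i j, 0 <= f i j) ->
  \sum_(k <oo) f (e k).1 (e k).2 = \sum_(i <oo) \sum_(j <oo) f i j.
Proof.
move=> be f0; rewrite nneseries_esumT//.
rewrite -(@reindex_esum _ _ _ setT setT e (fun p => f p.1 p.2)); last first.
  by rewrite setTT_bijective.
rewrite nneseries_esumT; last by move=> i; exact: nneseries_ge0.
under [RHS]eq_esum do rewrite nneseries_esumT//.
rewrite (@esum_esum _ _ _ setT (fun=> setT) f)//.
by congr esum; apply/seteqP; split.
Qed.

(** * The stages of the construction *)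

Section string_mass.
Context {R : realType} (t : gstring R).

Lemma string_total : gs_diff t setT + \sum_(i <oo) ((gs_mass t i)%:num)%:E = 1.
Proof.
have mI : measurable (`[0%R, gs_len t]%classic : set R) by exact: measurable_itv.
rewrite gs_total -(setvU `[0%R, gs_len t]%classic).
rewrite measureU ?setICl//; last exact: measurableC.
rewrite [X in X + _ + _]gs_diff_out add0e addeC subeK//.
(* The nonnegative sum excludes an infinite diffuse mass, for which [1 - +oo] would be negative;
   only then may the subtraction be undone. *)
have S0 : 0 <= \sum_(i <oo) ((gs_mass t i)%:num)%:E.
  by apply: nneseries_ge0 => i _ _; rewrite lee_fin.
rewrite ge0_fin_numE//; move: S0; rewrite gs_total sube_ge0 ?orbT//.
by move=> /le_lt_trans; apply; exact: ltry.
Qed.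

Lemma string_mass_le1 k : (\sum_(j < k) (gs_mass t j)%:num <= 1)%R.
Proof.
rewrite -lee_fin -string_total -sumEFin -[leLHS]add0e leeD//.
by rewrite -(big_mkord predT (fun j => ((gs_mass t j)%:num)%:E)) nneseries_lim_ge.
Qed.

Lemma string_diff_le1 A : measurable A -> gs_diff t A <= 1.
Proof.
move=> mA; rewrite -string_total (le_trans (le_measure _ _ _ (@subsetT _ A)))//;
  rewrite ?inE//.
by rewrite leeDl// nneseries_ge0// => i _ _; rewrite lee_fin.
Qed.

End string_mass.

Definition branch_len {R : realType} (beta : R) (s0 : gstring R)
    (s : nat -> nat -> gstring R) (e : nat -> nat -> nat * nat) n i : R :=
  ((st_mass (stages beta s0 s e n) i)%:num `^ beta * gs_len (s n i))%R.

(* The construction at a fixed sample point; [td_err n] bounds the height that can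
   still be added after stage [n]. *)
Record treedata (R : realType) (beta : R) := TreeData {
  td_root : gstring R ;
  td_copy : nat -> nat -> gstring R ;
  td_enum : nat -> nat -> nat * nat ;
  td_err : nat -> R ;
  td_enum_bij : forall n, bijective (td_enum n) ;
  td_err_ge0 : forall n, (0 <= td_err n)%R ;
  td_err_small : forall e, (0 < e)%R -> exists n, (td_err n < e)%R ;
  td_len_le : forall n i,
    (branch_len beta td_root td_copy td_enum n i <= td_err n - td_err n.+1)%R ;
  td_len_small : forall n e, (0 < e)%R -> exists N, forall i, (N <= i)%N ->
    (branch_len beta td_root td_copy td_enum n i < e)%R }.

Section tree.
Context {R : realType} (beta : R) (beta_gt0 : (0 < beta)%R) (D : treedata beta).

Definition td_stage n := stages beta (td_root D) (td_copy D) (td_enum D) n.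
Definition td_mass n i : R := (st_mass (td_stage n) i)%:num.
Definition td_loc n i := st_loc (td_stage n) i.
Definition td_scale n i : R := (td_mass n i `^ beta)%R.
Definition td_branch n i (t : R) : st_space (td_stage n.+1) :=
  branch (td_loc n) (fun i => td_scale n i * gs_len (td_copy D n i))%R i
    (td_scale n i * t)%R.

Lemma td_massS n k : td_mass n.+1 k =
  (td_mass n (td_enum D n k).1
   * (gs_mass (td_copy D n (td_enum D n k).1) (td_enum D n k).2)%:num)%R.
Proof. by []. Qed.

Lemma td_locS n k : td_loc n.+1 k = td_branch n (td_enum D n k).1
  (gs_pos (td_copy D n (td_enum D n k).1) (td_enum D n k).2).
Proof. by []. Qed.

Lemma td_diffS n A : st_diff (td_stage n.+1) A =
  st_diff (td_stage n) (inl @^-1` A) +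
  \sum_(i <oo) (td_mass n i)%:E * gs_diff (td_copy D n i) (td_branch n i @^-1` A).
Proof. exact: measure_addE. Qed.

Lemma td_mass_ge0 n i : (0 <= td_mass n i)%R.
Proof. by rewrite /td_mass. Qed.

(** Each atom is replaced by a scaled string of total mass 1, so no mass is lost. *)
Lemma td_total n :
  st_diff (td_stage n) setT + \sum_(i <oo) (td_mass n i)%:E = 1.
Proof.
elim: n => [|n IH]; first exact: string_total.
rewrite td_diffS preimage_setT -addeA -[RHS]IH; congr (_ + _).
under [X in _ + X]eq_eseriesr do rewrite td_massS EFinM.
rewrite (pair_series (f := fun i j => (td_mass n i)%:E *
  ((gs_mass (td_copy D n i) j)%:num)%:E) (td_enum_bij D n)); last first.
  by move=> i j; rewrite mule_ge0// lee_fin ?td_mass_ge0.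
have h i : \sum_(j <oo) (td_mass n i)%:E * ((gs_mass (td_copy D n i) j)%:num)%:E =
    (td_mass n i)%:E * \sum_(j <oo) ((gs_mass (td_copy D n i) j)%:num)%:E.
  by apply: nneseriesZl => j _; rewrite lee_fin.
under [X in _ + X]eq_eseriesr do rewrite h.
rewrite -nneseriesD; last 2 first.
- by move=> i _ _; rewrite mule_ge0 ?lee_fin ?td_mass_ge0.
- move=> i _ _; rewrite mule_ge0 ?lee_fin ?td_mass_ge0//.
  by apply: nneseries_ge0 => j _ _; rewrite lee_fin.
apply: eq_eseriesr => i _; rewrite preimage_setT -muleDr ?string_total ?mule1//.
apply: ge0_adde_def; rewrite inE//.
by apply: nneseries_ge0 => j _ _; rewrite lee_fin.
Qed.

Lemma td_mass_sum_ge0 n : 0 <= \sum_(i <oo) (td_mass n i)%:E.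
Proof. by apply: nneseries_ge0 => i _ _; rewrite lee_fin td_mass_ge0. Qed.

Lemma td_mass_sum_le1 n : \sum_(i <oo) (td_mass n i)%:E <= 1.
Proof. by rewrite -(td_total n) leeDr. Qed.

Lemma td_mass_le1 n i : (td_mass n i <= 1)%R.
Proof.
rewrite -lee_fin (le_trans _ (td_mass_sum_le1 n))//.
rewrite (le_trans _ (nneseries_lim_ge i.+1 _))//; last first.
  by move=> k _ _; rewrite lee_fin td_mass_ge0.
rewrite big_nat_recr//= leeDr// sume_ge0// => k _.
by rewrite lee_fin td_mass_ge0.
Qed.

Lemma td_scale_ge0 n i : (0 <= td_scale n i)%R.
Proof. exact: powR_ge0. Qed.

Lemma td_scale_le1 n i : (td_scale n i <= 1)%R.
Proof.
have := @ge0_ler_powR R beta (ltW beta_gt0) (td_mass n i) 1%R.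
by rewrite !nnegrE powR1; apply; rewrite ?td_mass_ge0 ?td_mass_le1 ?ler01.
Qed.

Lemma td_branch_lipschitz n i s t :
  (mdist (td_branch n i s) (td_branch n i t) <= `|s - t|)%R.
Proof.
rewrite (le_trans (branch_lipschitz _ _ _ _ _))// -mulrBr normrM.
by rewrite ger0_norm ?td_scale_ge0// ler_piMl ?td_scale_le1.
Qed.

Lemma td_stage_hyperbolic n : hyperbolic_at (st_root (td_stage n)).
Proof.
elim: n => [|n IH]; first exact: seg_hyperbolic.
exact: attach_hyperbolic.
Qed.

Lemma td_stage_geodesic n : @geodesic R (st_space (td_stage n)).
Proof.
by elim: n => [|n IH]; [exact: seg_geodesic|exact: attach_geodesic].
Qed.

Lemma td_stage_compact n : compact [set: st_space (td_stage n)].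
Proof.
elim: n => [|n IH]; first exact: (seg_compact (gs_len_gt0 (td_root D))).
by apply: attach_compact => // e e0; exact: (td_len_small D n e0).
Qed.

Lemma td_stage_mu n : stage_measure (td_stage n) setT = 1.
Proof.
rewrite -(td_total n).
transitivity (st_diff (td_stage n) setT + \sum_(i <oo) (td_mass n i)%:E *
  \d_(td_loc n i : borel (st_root (td_stage n))) setT).
  exact: measure_addE.
congr (_ + _).
by apply: eq_eseriesr => i _; rewrite diracT mule1.
Qed.

Lemma td_stage_Rtree n : weighted_Rtree (stage_rmspace (td_stage n)).
Proof.
split; [|exact: td_stage_compact|exact: td_stage_mu].
apply: geodesic_four_point_Rtree.
- exact: hyperbolic_four_point (@td_stage_hyperbolic n).
- exact: compact_separable (@td_stage_compact n).
- exact: td_stage_geodesic.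
Qed.

Let td_up_dn n (u : st_space (td_stage n.+1)) :
  (mdist (inl (attach_proj u) : st_space (td_stage n.+1)) u
   <= td_err D n - td_err D n.+1)%R.
Proof.
apply: (le_trans (y := attach_height u)); first by rewrite attach_projE.
case: u => [u|[[i t] /= /andP[_ tl]]] /=.
  (* An old point has height 0; the decrement of the error is nonnegative since it dominates the
     length of a branch. *)
  apply: le_trans (td_len_le D n 0).
  by rewrite mulr_ge0 ?powR_ge0 ?(ltW (gs_len_gt0 _)).
exact: le_trans tl (td_len_le D n i).
Qed.

Definition td_tower : tower R :=
  @Tower R (fun n => st_space (td_stage n)) (fun n u => inl u)
    (fun n u => attach_proj u) (td_err D) (fun n u => erefl)
    (fun n u v => erefl) (fun n u v => attach_proj_lipschitz u v)
    (td_err_ge0 D) td_up_dn (td_err_small D).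

Definition td_lim := tlim td_tower.
Definition td_inj n (u : st_space (td_stage n)) : td_lim :=
  @tw_inj _ td_tower n u.
Definition td_lim_root : td_lim := td_inj (st_root (td_stage 0)).

Lemma td_inj_up n (u : st_space (td_stage n)) :
  td_inj (inl u : st_space (td_stage n.+1)) = td_inj u.
Proof. exact: (@tw_inj_up R td_tower n u). Qed.

Lemma td_inj_root n : td_inj (st_root (td_stage n)) = td_lim_root.
Proof.
by elim: n => // n <-; exact: td_inj_up.
Qed.

Lemma td_lim_compact : compact [set: td_lim].
Proof. by apply: tlim_compact => n; exact: td_stage_compact. Qed.

Lemma td_lim_Rtree : Rtree td_lim.
Proof.
apply: geodesic_four_point_Rtree.
- apply: (@hyperbolic_four_point _ _ td_lim_root).
  apply: tlim_hyperbolic => n; rewrite -(td_inj_root n) tw_injE.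
  exact: td_stage_hyperbolic.
- exact: compact_separable td_lim_compact.
- by apply: tlim_geodesic => n; [exact: td_stage_compact|exact: td_stage_geodesic].
Qed.

End tree.

(** * The limit measure *)

Section limit_measure.
Context {R : realType} (beta : R) (beta_gt0 : (0 < beta)%R) (D : treedata beta).
Local Open Scope ring_scope.

Let P := td_mass D.
Let X n i : td_lim D := td_inj (td_loc D n i).

(* Atom [i] of stage [n] is encoded by a half-open interval of Lebesgue measure
   [td_mass D n i], nested in the interval of its parent.  The mass which remains
   on atoms at every stage then becomes, in the limit, the image under
   [limit_atom] of Lebesgue measure on [cells_lim]. *)
Fixpoint cell_left n i : R := match n with
  | 0 => \sum_(j < i) td_mass D 0 j
  | m.+1 => let p := td_enum D m i in
      cell_left m p.1 + td_mass D m p.1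
        * \sum_(j < p.2) (gs_mass (td_copy D m p.1) j)%:num
  end.

Definition cell n i : set R :=
  `[cell_left n i, cell_left n i + td_mass D n i[%classic.

(** The children are laid side by side from the left end of the parent, and they fit because the
    atom masses of a string sum to at most 1. *)
Lemma cell_sub n k : cell n.+1 k `<=` cell n (td_enum D n k).1.
Proof.
move=> t; rewrite /cell /= !in_itv/= td_massS; case: (td_enum D n k) => i j /=.
set S := \sum_(_ < _) _; have S0 : 0 <= S by apply: sumr_ge0.
have := string_mass_le1 (td_copy D n i) j.+1; rewrite big_ord_recr/= -/S => S1.
set m := (gs_mass _ j)%:num in S1 *.
have P0 := td_mass_ge0 D n i => /andP[h1 h2]; apply/andP; split.
  by apply: le_trans h1; rewrite lerDl mulr_ge0.
apply: lt_le_trans h2 _; rewrite -addrA -mulrDr lerD2l.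
by rewrite ler_piMr.
Qed.

Let cell_disj_aux (S S' m P0 a t : R) : 0 <= P0 -> S + m <= S' ->
  t < a + P0 * S + P0 * m -> a + P0 * S' <= t -> False.
Proof.
move=> P00 SS h1 h2; have : P0 * (S + m) <= P0 * S' by exact: ler_wpM2l.
by rewrite mulrDr; lra.
Qed.

Let partial_sum_mono (f : nat -> R) i j : (forall k, 0 <= f k) -> (i < j)%N ->
  \sum_(k < i) f k + f i <= \sum_(k < j) f k.
Proof.
move=> f0 ij; rewrite -(big_mkord predT f) -(big_mkord predT f).
rewrite -big_nat_recr//= [leRHS](@big_cat_nat _ _ _ i.+1)//= lerDl.
exact: sumr_ge0.
Qed.

(** By induction the parents agree; within one parent the cells are consecutive, and a child is
    determined by its parent and its rank because the enumeration is bijective. *)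
Lemma cell_disjoint n i j t : cell n i t -> cell n j t -> i = j.
Proof.
elim: n i j => [|n IH] i j.
  rewrite /cell/= !in_itv/= => /andP[a b] /andP[c d].
  have P0 := td_mass_ge0 D 0; have [ij|ji|//] := ltngtP i j; exfalso.
    by have := partial_sum_mono P0 ij; lra.
  by have := partial_sum_mono P0 ji; lra.
move=> ti tj; have par := IH _ _ (cell_sub ti) (cell_sub tj).
apply: (bij_inj (td_enum_bij D n)); move: ti tj.
rewrite /cell /= !in_itv/= !td_massS.
move: par; case: (td_enum D n i) => i1 i2; case: (td_enum D n j) => j1 j2 /= <-.
move=> /andP[a b] /andP[c d]; congr pair.
have P0 := td_mass_ge0 D n i1.
pose m k := (gs_mass (td_copy D n i1) k)%:num.
have m0 k : 0 <= m k by rewrite /m.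
have [ij|ji|//] := ltngtP i2 j2; exfalso.
  exact: cell_disj_aux P0 (partial_sum_mono m0 ij) b c.
exact: cell_disj_aux P0 (partial_sum_mono m0 ji) d a.
Qed.

Definition cells n := \bigcup_i cell n i.
Definition cells_lim := \bigcap_n cells n.

Lemma measurable_cell n i : measurable (cell n i).
Proof. exact: measurable_itv. Qed.

Lemma measurable_cells n : measurable (cells n).
Proof. by apply: bigcupT_measurable => i; exact: measurable_cell. Qed.

Lemma measurable_cells_lim : measurable cells_lim.
Proof. by apply: bigcapT_measurable => n; exact: measurable_cells. Qed.

Lemma cell_mass n i : lebesgue_measure (cell n i) = (td_mass D n i)%:E.
Proof.
rewrite lebesgue_measure_itv/= lte_fin ltrDl.
case: ltP => [_|h]; first by rewrite -EFinD addrAC subrr add0r.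
by congr EFin; apply/esym/eqP; rewrite eq_le h td_mass_ge0.
Qed.

Lemma cells_mass n (Q : pred nat) :
  lebesgue_measure (\bigcup_(i in [set i | Q i]) cell n i) =
  (\sum_(i <oo | Q i) (td_mass D n i)%:E)%E.
Proof.
rewrite measure_bigcup//=.
- rewrite (@eq_eseriesl _ _ Q); last first.
    by move=> i; apply/idP/idP => [/set_mem|Qi]//; exact: mem_set.
  by apply: eq_eseriesr => i _; exact: cell_mass.
- by move=> i _; exact: measurable_cell.
- by move=> i j _ _ [t [ti tj]]; exact: cell_disjoint ti tj.
Qed.

Lemma cells_mass_all n :
  lebesgue_measure (cells n) = (\sum_(i <oo) (td_mass D n i)%:E)%E.
Proof. by rewrite -(cells_mass n xpredT) set_true. Qed.

Lemma cellsS n : cells n.+1 `<=` cells n.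
Proof. by move=> t [k _ /cell_sub]; exists (td_enum D n k).1. Qed.

Lemma cells_mass_cvg :
  lebesgue_measure (cells n) @[n --> \oo] --> lebesgue_measure cells_lim.
Proof.
have c0 : (lebesgue_measure (cells 0) < +oo)%E.
  by rewrite cells_mass_all (le_lt_trans (td_mass_sum_le1 D 0))// ltry.
apply: nonincreasing_cvg_mu; [exact: c0| | |].
- exact: measurable_cells.
- exact: measurable_cells_lim.
- by apply/nonincreasing_seqP => n; apply/subsetPset; exact: cellsS.
Qed.

(** This is what makes the locations along a nested sequence of cells a thread of the tower. *)
Lemma td_loc_proj n k :
  attach_proj (td_loc D n.+1 k) = td_loc D n (td_enum D n k).1.
Proof.
by rewrite td_locS /td_branch /branch; case: insubP => //= -[[i t] p] _ /= [->].
Qed.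

(** A point of [cells_lim] selects one cell at each stage, hence an infinite line of descent whose
    locations form a point of the limit. The root is a default value elsewhere. *)
Lemma limit_atom_subproof t : exists v : td_lim D,
  (cells_lim t -> forall n i, cell n i t -> sval v n = td_loc D n i) /\
  (~ cells_lim t -> v = td_lim_root D).
Proof.
have [tA|tA] := pselect (cells_lim t); last by exists (td_lim_root D).
have /choice[u uP] : forall n, exists i, cell n i t.
  by move=> n; have [i _ ti] := tA n I; exists i.
have uS n : (td_enum D n (u n.+1)).1 = u n.
  exact: cell_disjoint (cell_sub (uP n.+1)) (uP n).
have th n : @tw_dn _ (td_tower D) n (td_loc D n.+1 (u n.+1)) = td_loc D n (u n).
  by rewrite -(uS n); exact: td_loc_proj.
exists (exist (fun v : forall n, td_tower D n => forall n, tw_dn (v n.+1) = v n)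
  (fun n => td_loc D n (u n)) th).
by split=> // _ n i ti /=; rewrite (cell_disjoint (uP n) ti).
Qed.

Definition limit_atom t : td_lim D := sval (cid (limit_atom_subproof t)).

Lemma limit_atom_dist t n i : cells_lim t -> cell n i t ->
  mdist (X n i) (limit_atom t) <= 2 * td_err D n.
Proof.
move=> tA ti; rewrite /limit_atom; case: cid => v /= [/(_ tA n i ti) vn _].
by rewrite /X -vn; exact: (@tw_inj_proj R (td_tower D)).
Qed.

Lemma limit_atom_out t : ~ cells_lim t -> limit_atom t = td_lim_root D.
Proof. by move=> tA; rewrite /limit_atom; case: cid => v /= [_ /(_ tA)]. Qed.

(** On [cells_lim] the preimage of an open set is a countable union of cells: those whose atom has a
    closed ball of radius [2 * td_err D n] inside the set. Such a cell is found around each point of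
    the preimage because the radii tend to 0. Elsewhere the map is constant. *)
Lemma measurable_limit_atom :
  measurable_fun setT (limit_atom : R -> borel (td_lim_root D)).
Proof.
apply: measurable_borel => U oU.
pose good n i := `[< forall v : td_lim D,
  mdist (X n i) v <= 2 * td_err D n -> U v >].
pose W := \bigcup_n \bigcup_(i in [set i | good n i]) cell n i.
have -> : limit_atom @^-1` U = (cells_lim `&` W) `|`
    (if `[< U (td_lim_root D) >] then ~` cells_lim else set0).
  apply/seteqP; split=> t.
    move=> /= Ut; have [tA|tA] := pselect (cells_lim t); last first.
      by right; rewrite limit_atom_out// in Ut; case: asboolP.
    left; split=> //; have /nbhs_ballP[e /= e0 eU] := open_nbhs_nbhs (conj oU Ut).
    have e4 : 0 < e / 4 by rewrite divr_gt0.
    have [n ne] := td_err_small D e4.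
    have [i _ ti] := tA n I; exists n => //; exists i => //=.
    apply/asboolP => v vi; apply: eU; rewrite ballEmdist/=.
    have := limit_atom_dist tA ti; have := metric_triangle (limit_atom t) (X n i) v.
    by rewrite (mdistC (limit_atom t) (X n i)); lra.
  move=> [[tA [n _ [i /= /asboolP gi ti]]]|]; first exact/gi/limit_atom_dist.
  by case: asboolP => // U0 tA; rewrite /= limit_atom_out.
apply: measurableU.
  apply: measurableI; first exact: measurable_cells_lim.
  apply: bigcupT_measurable => n; apply: bigcup_measurable => i _.
  exact: measurable_cell.
by case: asboolP => _ //; apply: measurableC; exact: measurable_cells_lim.
Qed.

Definition piece0 (t : R) : td_lim D :=
  td_inj (seg_of (gs_len_gt0 (td_root D)) t : st_space (td_stage D 0)).
Definition piece n i (t : R) : td_lim D := td_inj (td_branch D n i t).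

Lemma td_inj_iso n (u v : st_space (td_stage D n)) :
  mdist (td_inj u) (td_inj v) = mdist u v.
Proof. exact: (@tw_inj_iso R (td_tower D)). Qed.

Lemma piece0_lipschitz s t : mdist (piece0 s) (piece0 t) <= `|s - t|.
Proof. by rewrite td_inj_iso; exact: seg_of_lipschitz. Qed.

Lemma piece_lipschitz n i s t : mdist (piece n i s) (piece n i t) <= `|s - t|.
Proof. by rewrite td_inj_iso td_branch_lipschitz. Qed.

Lemma measurable_piece0 :
  measurable_fun setT (piece0 : R -> borel (td_lim_root D)).
Proof.
apply: (@measurable_lipschitz_R _ _ _ _ 1) => s t.
by rewrite mul1r piece0_lipschitz.
Qed.

Lemma measurable_piece n i :
  measurable_fun setT (piece n i : R -> borel (td_lim_root D)).
Proof.
apply: (@measurable_lipschitz_R _ _ _ _ 1) => s t.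
by rewrite mul1r piece_lipschitz.
Qed.

Lemma measurable_td_inj n :
  measurable_fun setT (@td_inj _ _ D n : borel (st_root (td_stage D n)) ->
                       borel (td_lim_root D)).
Proof. by apply: (@measurable_lipschitz _ _ _ _ _ _ 1) => s t; rewrite mul1r td_inj_iso. Qed.

Local Open Scope ereal_scope.

Definition limit_diff : {measure set (borel (td_lim_root D)) -> \bar R} :=
  measure_add (image_measure (gs_diff (td_root D)) measurable_piece0)
    (mseries (fun n => mseries (fun i => mscale (st_mass (td_stage D n) i)
       (image_measure (gs_diff (td_copy D n i)) (measurable_piece n i))) 0) 0).

Definition limit_mu : {measure set (borel (td_lim_root D)) -> \bar R} :=
  measure_add limit_diff
    (image_measure (mrestr lebesgue_measure measurable_cells_lim)
       measurable_limit_atom).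

Definition limit_rmspace : rmspace R := RMSpace limit_mu.

Lemma limit_diffE B : limit_diff B = gs_diff (td_root D) (piece0 @^-1` B) +
  \sum_(n <oo) \sum_(i <oo) (P n i)%:E * gs_diff (td_copy D n i) (piece n i @^-1` B).
Proof. exact: measure_addE. Qed.

Lemma limit_muE B : limit_mu B = limit_diff B +
  lebesgue_measure (limit_atom @^-1` B `&` cells_lim).
Proof. exact: measure_addE. Qed.

Lemma stage_diffE n B : st_diff (td_stage D n) (@td_inj _ _ D n @^-1` B) =
  gs_diff (td_root D) (piece0 @^-1` B) +
  \sum_(m < n) \sum_(i <oo) (P m i)%:E * gs_diff (td_copy D m i) (piece m i @^-1` B).
Proof.
elim: n => [|n IH]; first by rewrite big_ord0 adde0.
rewrite big_ord_recr/= addeA -IH td_diffS; congr (_ + _); congr (st_diff _ _).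
by apply/seteqP; split=> u; rewrite /preimage/= td_inj_up.
Qed.

Lemma piece_mass_ge0 B n : 0 <=
  \sum_(i <oo) (P n i)%:E * gs_diff (td_copy D n i) (piece n i @^-1` B).
Proof.
apply: nneseries_ge0 => i _ _.
by rewrite mule_ge0 ?lee_fin ?td_mass_ge0 ?measure_ge0.
Qed.

Lemma stage_diff_le n B :
  st_diff (td_stage D n) (@td_inj _ _ D n @^-1` B) <= limit_diff B.
Proof.
rewrite stage_diffE limit_diffE leeD2l//.
rewrite -(big_mkord predT (fun m => \sum_(i <oo) (P m i)%:E *
  gs_diff (td_copy D m i) (piece m i @^-1` B))).
by apply: nneseries_lim_ge => m _ _; exact: piece_mass_ge0.
Qed.

Lemma stage_diff_cvg B :
  st_diff (td_stage D n) (@td_inj _ _ D n @^-1` B) @[n --> \oo] --> limit_diff B.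
Proof.
rewrite limit_diffE; under eq_fun do rewrite stage_diffE.
apply: cvgeD.
- apply: ge0_adde_def; rewrite inE ?measure_ge0//.
  by apply: nneseries_ge0 => m _ _; exact: piece_mass_ge0.
- exact: cvg_cst.
under eq_fun do rewrite -(big_mkord predT (fun m => \sum_(i <oo) (P m i)%:E *
  gs_diff (td_copy D m i) (piece m i @^-1` B))).
by apply: is_cvg_nneseries => m _ _; exact: piece_mass_ge0.
Qed.

(** This is [td_total] in the limit: the diffuse measures increase to [limit_diff] and the cells
    decrease to [cells_lim]. *)
Lemma limit_mu_total : limit_mu setT = 1.
Proof.
rewrite limit_muE preimage_setT setTI.
have c1 := @stage_diff_cvg setT; have c2 := cells_mass_cvg.
have : (fun n => st_diff (td_stage D n) (@td_inj _ _ D n @^-1` setT) +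
   lebesgue_measure (cells n)) @ \oo --> limit_diff setT + lebesgue_measure cells_lim.
  by apply: cvgeD => //; apply: ge0_adde_def; rewrite inE.
under eq_fun do rewrite preimage_setT cells_mass_all td_total.
by move=> /cvg_lim <-//; rewrite lim_cst.
Qed.

Lemma limit_weighted_Rtree : weighted_Rtree limit_rmspace.
Proof.
split; [exact: td_lim_Rtree|exact: td_lim_compact|exact: limit_mu_total].
Qed.

Definition atom_mass n : \bar R := \sum_(i <oo) (P n i)%:E.

Lemma atom_mass_fin n : atom_mass n \is a fin_num.
Proof.
rewrite ge0_fin_numE ?td_mass_sum_ge0//.
by rewrite (le_lt_trans (td_mass_sum_le1 D n))// ltry.
Qed.

Lemma cells_lim_fin : lebesgue_measure cells_lim \is a fin_num.
Proof.
rewrite ge0_fin_numE// (le_lt_trans _ (ltry 1))//.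
rewrite (le_trans _ (td_mass_sum_le1 D 0))// -cells_mass_all.
apply: le_measure; rewrite ?inE; [exact: measurable_cells_lim|exact: measurable_cells|].
by move=> t; exact.
Qed.

Lemma atom_mass_cvg : atom_mass n @[n --> \oo] --> lebesgue_measure cells_lim.
Proof.
by rewrite /atom_mass; under eq_fun do rewrite -cells_mass_all; exact: cells_mass_cvg.
Qed.

(** The atom mass of stage [n] that later stages turn into diffuse measure. *)
Definition mass_defect n : R := fine (atom_mass n - lebesgue_measure cells_lim).

Lemma mass_defectE n :
  (mass_defect n)%:E = lebesgue_measure (cells n `\` cells_lim).
Proof.
rewrite measureD /=; first last.
- by have := atom_mass_fin n; rewrite /atom_mass -cells_mass_all ge0_fin_numE.
- exact: measurable_cells_lim.
- exact: measurable_cells.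
rewrite setIidr ?cells_mass_all; last by move=> t; exact.
by rewrite fineK// fin_numB atom_mass_fin cells_lim_fin.
Qed.

Lemma mass_defect_ge0 n : (0 <= mass_defect n)%R.
Proof. by rewrite -lee_fin mass_defectE. Qed.

Lemma mass_defect_cvg : mass_defect n @[n --> \oo] --> 0%R.
Proof.
suff h : atom_mass n - lebesgue_measure cells_lim @[n --> \oo] --> 0%:E.
  exact: fine_cvg h.
have <- : lebesgue_measure cells_lim - lebesgue_measure cells_lim = 0%:E.
  exact: subee cells_lim_fin.
apply: cvgeB; [|exact: atom_mass_cvg|exact: cvg_cst].
by rewrite fin_num_adde_defr// cells_lim_fin.
Qed.

(** The diffuse part only grows. For an atom in [B], the codes in its cell that belong to
    [cells_lim] are sent to within [2 * td_err D n] of it, hence into the enlargement; the remaining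
    codes have total measure at most the mass defect. *)
Lemma stage_mu_le n (e : R) (B : set (td_lim D)) : (2 * td_err D n < e)%R ->
  measurable (B : set (borel (td_lim_root D))) ->
  stage_measure (td_stage D n) (@td_inj _ _ D n @^-1` B) <=
  limit_mu (enlarge B e) + (mass_defect n)%:E.
Proof.
move=> ne mB.
pose Q i := `[< B (X n i) >].
pose C := \bigcup_(i in [set i | Q i]) cell n i.
have mC : measurable C by apply: bigcup_measurable => i _; exact: measurable_cell.
have mE := @measurable_enlarge _ _ (td_lim_root D) B e.
have -> : stage_measure (td_stage D n) (@td_inj _ _ D n @^-1` B) =
    st_diff (td_stage D n) (@td_inj _ _ D n @^-1` B) + lebesgue_measure C.
  rewrite cells_mass eseries_mkcond.
  transitivity (st_diff (td_stage D n) (@td_inj _ _ D n @^-1` B) +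
    \sum_(i <oo) (P n i)%:E *
    \d_(td_loc D n i : borel (st_root (td_stage D n))) (@td_inj _ _ D n @^-1` B)).
    exact: measure_addE.
  congr (_ + _); apply: eq_eseriesr => i _; rewrite diracE /Q.
  case: asboolP => BX; first by rewrite mem_set// mule1.
  by rewrite memNset// mule0.
rewrite limit_muE -addeA; apply: leeD.
  apply: (le_trans (stage_diff_le n B)); apply: le_measure; rewrite ?inE//.
  by apply: sub_enlarge; apply: le_lt_trans ne; rewrite mulr_ge0// td_err_ge0.
have mL := measurable_cells_lim; have mn := measurable_cells n.
have mA : measurable (limit_atom @^-1` enlarge B e `&` cells_lim).
  apply: measurableI => //; rewrite -[X in measurable X]setTI.
  exact: measurable_limit_atom.
have mD : measurable (cells n `\` cells_lim) by exact: measurableD.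
rewrite mass_defectE; apply: le_trans (measureU2 lebesgue_measure mA mD).
apply: le_measure; rewrite ?inE//; first exact: measurableU.
move=> t [i /= /asboolP Bi ti]; have [tL|tL] := pselect (cells_lim t).
  left; split=> //; exists (X n i) => //.
  exact: le_lt_trans (limit_atom_dist tL ti) ne.
by right; split=> //; exists i.
Qed.

End limit_measure.

(** * Gromov-Hausdorff-Prokhorov distance *)

Section gromov_hausdorff_prokhorov.
Context {R : realType}.
Implicit Types X Y : rmspace R.

Lemma dGHP_le X Y (M : metricType R) (phi : rms_space X -> M)
    (psi : rms_space Y -> M) (e : R) :
  (0 < e)%R -> isometric phi -> isometric psi ->
  (mdist (phi (rms_root X)) (psi (rms_root Y)) <= e)%R ->
  (forall u, exists v, mdist (psi v) (phi u) < e)%R ->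
  (forall v, exists u, mdist (phi u) (psi v) < e)%R ->
  (forall B : set M, <<s open >> B -> rms_mu X (phi @^-1` B) <=
     rms_mu Y (psi @^-1` enlarge B e) + e%:E) ->
  (forall B : set M, <<s open >> B -> rms_mu Y (psi @^-1` B) <=
     rms_mu X (phi @^-1` enlarge B e) + e%:E) ->
  dGHP X Y <= e%:E.
Proof.
move=> e0 iphi ipsi root hX hY pX pY.
apply: (@le_trans _ _ (maxe (mdist (phi (rms_root X)) (psi (rms_root Y)))%:E
  (maxe (hausdorff_dist (range phi) (range psi))
    (prokhorov_dist (fun B => rms_mu X (phi @^-1` B))
                    (fun B => rms_mu Y (psi @^-1` B)))))).
  by apply: ereal_inf_lbound; exists M, phi, psi.
rewrite !ge_max lee_fin root /=; apply/andP; split.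
  apply: ereal_inf_lbound; exists e => //; split=> // _ [u _ <-].
    by have [v vu] := hX u; exists (psi v) => //; exists v.
  by have [v vu] := hY u; exists (phi v) => //; exists v.
apply: ereal_inf_lbound; exists e => //; split=> // B mB.
by split; [exact: pX|exact: pY].
Qed.

Lemma dGHP_ge0 X Y : 0 <= dGHP X Y.
Proof.
apply: le_ereal_inf_tmp => _ [M [phi [psi [_ _ ->]]]].
by rewrite le_max lee_fin mdist_ge0.
Qed.

Lemma rms_equiv_refl X : rms_equiv X X.
Proof.
exists id; split=> //.
by apply/seteqP; split=> // x _; exists x.
Qed.

Lemma Tw_dist_le (X Y : wRtree R) : Tw_dist (Tw_of X) (Tw_of Y) <= dGHP X Y.
Proof.
by apply: ereal_inf_lbound; exists X, Y; split=> //; exact: rms_equiv_refl.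
Qed.

Lemma Tw_dist_ge0 (c c' : Tw R) : 0 <= Tw_dist c c'.
Proof. by apply: le_ereal_inf_tmp => _ [X [Y [_ _ ->]]]; exact: dGHP_ge0. Qed.

End gromov_hausdorff_prokhorov.

(** * Convergence of the stages to the limit tree *)

Section stage_convergence.
Context {R : realType} (beta : R) (beta_gt0 : (0 < beta)%R) (D : treedata beta).
Local Open Scope ring_scope.

Lemma td_err_mono n k : (n <= k)%N -> td_err D k <= td_err D n.
Proof.
move=> /subnK <-; elim: (k - n)%N => // j IH; apply: le_trans IH.
have := td_len_le D (j + n) 0; rewrite addSn.
have : 0 <= branch_len beta (td_root D) (td_copy D) (td_enum D) (j + n) 0.
  by rewrite mulr_ge0 ?powR_ge0 ?(ltW (gs_len_gt0 _)).
by move=> h1 h2; rewrite -subr_ge0 (le_trans h1).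
Qed.

Lemma td_err_cvg : td_err D n @[n --> \oo] --> (0 : R).
Proof.
apply/cvgrPdist_lt => e e0; have [N Ne] := td_err_small D e0.
exists N => // n /= Nn; rewrite sub0r normrN ger0_norm ?td_err_ge0//.
exact: le_lt_trans (td_err_mono Nn) Ne.
Qed.

Definition stage_gap n : R := 2 * td_err D n + mass_defect D n.

Lemma stage_gap_cvg : stage_gap n @[n --> \oo] --> (0 : R).
Proof.
rewrite -(addr0 (0 : R)) -{1}(mulr0 (2 : R)).
apply: (cvgD (f := fun n => 2 * td_err D n)); last exact: mass_defect_cvg.
exact: (cvgM (cvg_cst _) td_err_cvg).
Qed.

Lemma stage_limit_mu_le n (e : R) (B : set (td_lim D)) : stage_gap n < e ->
  measurable (B : set (borel (td_lim_root D))) ->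
  (stage_measure (td_stage D n) (@td_inj _ _ D n @^-1` B) <=
   limit_mu beta_gt0 D (enlarge B e) + e%:E)%E.
Proof.
rewrite /stage_gap => gap mB; have := mass_defect_ge0 D n => d0.
have err0 := td_err_ge0 D n.
have ne : 2 * td_err D n < e by lra.
apply: (le_trans (stage_mu_le beta_gt0 ne mB)); rewrite leeD2l// lee_fin; lra.
Qed.

(** The stage measure and the limit measure both have mass 1, so [prokhorov_flip] applies to the
    opposite inequality without any loss. *)
Lemma stage_limit_mu_ge n (e : R) (B : set (td_lim D)) : stage_gap n < e ->
  measurable (B : set (borel (td_lim_root D))) ->
  (limit_mu beta_gt0 D B <=
   stage_measure (td_stage D n) (@td_inj _ _ D n @^-1` enlarge B e) + e%:E)%E.
Proof.
move=> gap mB.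
pose nu := image_measure (stage_measure (td_stage D n)) (measurable_td_inj (D:=D) (n:=n)).
have h := @prokhorov_flip R _ (td_lim_root D) nu (limit_mu beta_gt0 D) e 0.
rewrite addr0 in h; apply: h => //.
- by move=> A mA; rewrite -measureU ?setICr ?setUv//; exact: measurableC.
- exact: limit_mu_total.
- by rewrite subr0 [leRHS]td_stage_mu.
- by move=> A mA; exact: stage_limit_mu_le.
Qed.

Lemma stage_limit_dGHP n (e : R) : stage_gap n < e ->
  (dGHP (stage_rmspace (td_stage D n)) (limit_rmspace beta_gt0 D) <= e%:E)%E.
Proof.
rewrite /stage_gap => gap; have d0 := mass_defect_ge0 D n.
have err0 := td_err_ge0 D n; have e0 : 0 < e by lra.
have ne : 2 * td_err D n < e by lra.
apply: (@dGHP_le _ (stage_rmspace (td_stage D n)) (limit_rmspace beta_gt0 D)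
  (td_lim D) (@td_inj _ _ D n) id e) => //.
- by move=> u v; exact: td_inj_iso.
- by rewrite /= td_inj_root mdistxx ltW.
- by move=> u; exists (td_inj u); rewrite mdistxx.
- move=> v; exists (sval v n).
  exact: le_lt_trans (@tw_inj_proj R (td_tower D) v n) ne.
- by move=> B mB; exact: stage_limit_mu_le.
- by move=> B mB; exact: stage_limit_mu_ge.
Qed.

Lemma stage_limit_cvg (SP : forall n, weighted_Rtree (stage_rmspace (td_stage D n)))
    (LP : weighted_Rtree (limit_rmspace beta_gt0 D)) :
  (Tw_dist (Tw_of (WRtree (SP n))) (Tw_of (WRtree LP)) @[n --> \oo] --> 0)%E.
Proof.
apply: (@squeeze_cvge _ _ _ _ (fun=> 0%E) _ (fun n => (stage_gap n)%:E)).
- apply: nearW => n; rewrite Tw_dist_ge0/=; apply/lee_addgt0Pr => e e0.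
  rewrite -EFinD; apply: le_trans (Tw_dist_le _ _) _.
  by apply: stage_limit_dGHP; rewrite ltrDl.
- exact: cvg_cst.
- by apply: cvg_EFin; [exact: nearW|exact: stage_gap_cvg].
Qed.

End stage_convergence.

Definition weighted_atoms {R : realType} {I : Type} {T : Type} (S : seq I)
    (a : I -> R) (x : I -> T) (B : set T) : \bar R :=
  (\sum_(i <- S) a i * \1_B (x i))%:E.

(** * Gluing along a finite correspondence *)

Section prokhorov_transfer.
Context {R : realType} {I : eqType} (X Y : rmspace R) (M : metricType R)
  (phi : rms_space X -> M) (psi : rms_space Y -> M) (S : seq I)
  (x : I -> rms_space X) (y : I -> rms_space Y) (a b : I -> R) (e : R).
Local Open Scope ring_scope.

(** The comparison passes through the two weighted families. From [X] to the atoms of weight [a] it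
    costs mass [2 * e], since [prokhorov_flip] also pays for the mass that these atoms may miss;
    changing the weights and passing to [Y] cost [e] each. The displacements stay below [4 * e]. *)
Lemma prokhorov_transfer : 0 < e -> isometric phi -> isometric psi ->
  {in S, forall i, mdist (phi (x i)) (psi (y i)) <= e} ->
  (forall i, 0 <= a i) -> (forall i, 0 <= b i) ->
  \sum_(i <- S) `|a i - b i| <= e -> 1 - e <= \sum_(i <- S) a i ->
  rms_mu X setT = 1%E ->
  (forall B : set (rms_space X), measurable (B : set (borel (rms_root X))) ->
    (weighted_atoms S a x B <= rms_mu X (enlarge B e) + e%:E)%E) ->
  (forall B : set (rms_space Y), measurable (B : set (borel (rms_root Y))) ->
    (weighted_atoms S b y B <= rms_mu Y (enlarge B e) + e%:E)%E) ->
  forall B : set M, <<s open >> B ->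
  (rms_mu X (phi @^-1` B) <= rms_mu Y (psi @^-1` enlarge B (4 * e)) + (4 * e)%:E)%E.
Proof.
move=> e0 iphi ipsi xy a0 b0 ab a1 muX hX hY B mB.
have mphi : measurable_fun setT (phi : borel (rms_root X) -> borel (phi (rms_root X))).
  by apply: (@measurable_lipschitz _ _ _ _ _ _ 1) => s t; rewrite mul1r iphi.
have mpsi : measurable_fun setT (psi : borel (rms_root Y) -> borel (phi (rms_root X))).
  by apply: (@measurable_lipschitz _ _ _ _ _ _ 1) => s t; rewrite mul1r ipsi.
have mpB (C : set M) : <<s open >> C -> measurable (phi @^-1` C : set (borel (rms_root X))).
  by move=> mC; rewrite -[X in measurable X]setTI; exact: mphi.
have msB (C : set M) : <<s open >> C -> measurable (psi @^-1` C : set (borel (rms_root Y))).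
  by move=> mC; rewrite -[X in measurable X]setTI; exact: mpsi.
have moe (C : set M) r : <<s open >> (enlarge C r).
  by apply: sub_sigma_algebra; exact: open_enlarge.
have step1 : (rms_mu X (phi @^-1` B) <=
    weighted_atoms S a x (enlarge (phi @^-1` B) e) + (e + e)%:E)%E.
  apply: (@prokhorov_flip R _ (rms_root X) (weighted_atoms S a x) (rms_mu X) e e) => //.
  - by move=> A; rewrite lee_fin sumr_ge0// => i _; rewrite mulr_ge0// indicE ler0n.
  - move=> A _; rewrite -EFinD lee_fin -big_split/=; apply: ler_sum => i _.
    by rewrite -mulrDr ler_wpM2l// !indicE in_setT in_setC; case: (_ \in A); rewrite ?addr0 ?add0r.
  - rewrite lee_fin; apply: le_trans a1 _; apply: ler_sum => i _.
    by rewrite indicT mulr1.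
  - exact: mpB.
have step2 : (weighted_atoms S a x (enlarge (phi @^-1` B) e) <=
    weighted_atoms S b y (psi @^-1` enlarge B (3 * e)) + e%:E)%E.
  rewrite -EFinD lee_fin -lerBlDl -sumrB; apply: le_trans ab.
  rewrite !big_seq; apply: ler_sum => i iS.
  rewrite !indicE; case: (boolP (x i \in _)) => [|_] /=; last first.
    by rewrite mulr0 sub0r (le_trans _ (normr_ge0 _))// oppr_le0 mulr_ge0.
  rewrite inE => -[u Bu ux]; rewrite mem_set; first by rewrite !mulr1 ler_norm.
  exists (phi u) => //; have := xy i iS; rewrite -iphi in ux.
  by have := metric_triangle (phi u) (phi (x i)) (psi (y i)); lra.
have step3 := hY _ (msB _ (moe B (3 * e))).
have step4 : (rms_mu Y (enlarge (psi @^-1` enlarge B (3 * e)) e) <=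
    rms_mu Y (psi @^-1` enlarge B (4 * e)))%E.
  apply: le_measure; rewrite ?inE.
  - exact: measurable_enlarge.
  - exact: msB.
  - move=> v [u [z Bz zu] uv]; exists z => //; rewrite -ipsi in uv.
    by have := metric_triangle z (psi u) (psi v); lra.
apply: (le_trans step1); apply: (le_trans (leeD2r _ step2)).
apply: (le_trans (leeD2r _ (leeD2r _ step3))).
apply: (le_trans (leeD2r _ (leeD2r _ (leeD2r _ step4)))).
rewrite -!addeA leeD2l// -!EFinD lee_fin; lra.
Qed.

End prokhorov_transfer.

Section gluing.
Context {R : realType} {I : eqType} {X Y : metricType R}.
Local Open Scope ring_scope.

Record correspondence := Correspondence {
  co_list : seq I ;
  co_base : I ;
  co_baseP : co_base \in co_list ;
  co_x : I -> X ;
  co_y : I -> Y ;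
  co_eps : R ;
  co_eps_gt0 : 0 < co_eps ;
  co_dist : {in co_list &, forall i j,
    `|mdist (co_x i) (co_x j) - mdist (co_y i) (co_y j)| <= 2 * co_eps} }.

Variable c : correspondence.

Lemma seq_argmin (s : seq I) (i0 : I) (f : I -> R) : i0 \in s ->
  exists2 i, i \in s & {in s, forall j, f i <= f j}.
Proof.
elim: s i0 => // a s IH i0 _; case: s IH => [|b s] IH.
  by exists a; rewrite ?mem_head// => j; rewrite inE => /eqP ->.
have [i is_ imin] := IH b (mem_head _ _).
have [ai|ia] := leP (f a) (f i).
  exists a; rewrite ?mem_head// => j; rewrite inE => /predU1P[->//|js].
  exact: le_trans ai (imin j js).
exists i; first by rewrite inE is_ orbT.
by move=> j; rewrite inE => /predU1P[->|/imin//]; exact: ltW.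
Qed.

Definition cross_index u v : I := sval (cid2 (seq_argmin
  (fun i => mdist u (co_x c i) + mdist (co_y c i) v) (co_baseP c))).

(** The usual distance across a correspondence: go to some [co_x c i], jump to [co_y c i] at cost
    [co_eps c], and continue. The list is finite, so an optimal [i] exists. *)
Definition cross u v : R := mdist u (co_x c (cross_index u v)) +
  mdist (co_y c (cross_index u v)) v + co_eps c.

Lemma cross_ex u v : exists2 i, i \in co_list c &
  cross u v = mdist u (co_x c i) + mdist (co_y c i) v + co_eps c.
Proof.
by exists (cross_index u v) => //; rewrite /cross_index; case: cid2.
Qed.

Lemma cross_le u v i : i \in co_list c ->
  cross u v <= mdist u (co_x c i) + mdist (co_y c i) v + co_eps c.
Proof.
by move=> ic; rewrite /cross lerD2r /cross_index; case: cid2 => /= k _ /(_ i ic).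
Qed.

Lemma cross_gt0 u v : 0 < cross u v.
Proof.
have [i _ ->] := cross_ex u v; have := co_eps_gt0 c.
have := mdist_ge0 u (co_x c i); have := mdist_ge0 (co_y c i) v; lra.
Qed.

Lemma cross_triangle_l u u' v : cross u v <= mdist u u' + cross u' v.
Proof.
have [i ic ->] := cross_ex u' v; apply: le_trans (cross_le u v ic) _.
have := metric_triangle u u' (co_x c i); lra.
Qed.

Lemma cross_triangle_r u v v' : cross u v <= cross u v' + mdist v' v.
Proof.
have [i ic ->] := cross_ex u v'; apply: le_trans (cross_le u v ic) _.
have := metric_triangle (co_y c i) v' v; lra.
Qed.

(** The route through [v] crosses twice, and these two jumps pay exactly for the distortion
    [2 * co_eps c]. *)
Lemma cross_triangle_x u u' v : mdist u u' <= cross u v + cross u' v.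
Proof.
have [i ic ->] := cross_ex u v; have [j jc ->] := cross_ex u' v.
have := co_dist ic jc; rewrite ler_norml => /andP[_ h].
have := metric_triangle u (co_x c i) u'.
have := metric_triangle (co_x c i) (co_x c j) u'.
have := metric_triangle (co_y c i) v (co_y c j).
by rewrite (mdistC v) (mdistC (co_x c j) u'); lra.
Qed.

Lemma cross_triangle_y u v v' : mdist v v' <= cross u v + cross u v'.
Proof.
have [i ic ->] := cross_ex u v; have [j jc ->] := cross_ex u v'.
have := co_dist ic jc; rewrite ler_norml => /andP[h _].
have := metric_triangle v (co_y c i) v'.
have := metric_triangle (co_y c i) (co_y c j) v'.
have := metric_triangle (co_x c i) u (co_x c j).
by rewrite (mdistC v (co_y c i)) (mdistC (co_x c i) u); lra.
Qed.

(* The argument only keys the metric structure. *)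
Definition glue (_ : correspondence) : Type := (X + Y)%type.

Definition glue_dist (a b : glue c) : R :=
  match a, b with
  | inl u, inl v => mdist u v
  | inr u, inr v => mdist u v
  | inl u, inr v => cross u v
  | inr v, inl u => cross u v
  end.

Let glue_distxx a : glue_dist a a = 0.
Proof. by case: a => u /=; rewrite mdistxx. Qed.

Let glue_dist_positivity a b : glue_dist a b = 0 -> a = b.
Proof.
case: a b => [u|u] [v|v] /=; try by move/mdist_positivity => ->.
  by move=> h; have := cross_gt0 u v; rewrite h ltxx.
by move=> h; have := cross_gt0 v u; rewrite h ltxx.
Qed.

Let glue_dist_sym a b : glue_dist a b = glue_dist b a.
Proof. by case: a b => [u|u] [v|v] //=; exact: mdistC. Qed.

Let glue_dist_triangle b a e : glue_dist a e <= glue_dist a b + glue_dist b e.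
Proof.
case: a b e => [u|u] [v|v] [w|w] /=.
- exact: metric_triangle.
- exact: cross_triangle_l.
- exact: cross_triangle_x.
- exact: cross_triangle_r.
- by rewrite addrC (mdistC v w); exact: cross_triangle_l.
- exact: cross_triangle_y.
- by rewrite addrC (mdistC u v); exact: cross_triangle_r.
- exact: metric_triangle.
Qed.

HB.instance Definition _ := gen_eqMixin (glue c).
HB.instance Definition _ := gen_choiceMixin (glue c).
HB.instance Definition _ := isMetric.Build R (glue c)
  glue_distxx glue_dist_positivity glue_dist_sym glue_dist_triangle.

Lemma glue_pair i : i \in co_list c ->
  mdist (inl (co_x c i) : glue c) (inr (co_y c i)) <= co_eps c.
Proof.
move=> ic; apply: le_trans (cross_le _ _ ic) _.
by rewrite !mdistxx !add0r.
Qed.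

End gluing.

(** [L] indexes nets, which give the Hausdorff bound; the sublist [S] carries the masses for the
    Prokhorov bound, where the factor 4 originates. *)
Lemma dGHP_correspondence {R : realType} {I : eqType} (X Y : rmspace R)
    (L S : seq I) (i0 : I) (x : I -> rms_space X) (y : I -> rms_space Y)
    (a b : I -> R) (e : R) :
  (0 < e)%R -> i0 \in L -> {subset S <= L} ->
  x i0 = rms_root X -> y i0 = rms_root Y ->
  {in L &, forall i j, (`|mdist (x i) (x j) - mdist (y i) (y j)| <= 2 * e)%R} ->
  (forall u, exists2 i, i \in L & (mdist (x i) u < e)%R) ->
  (forall v, exists2 i, i \in L & (mdist (y i) v < e)%R) ->
  (forall i, (0 <= a i)%R) -> (forall i, (0 <= b i)%R) ->
  (\sum_(i <- S) `|a i - b i| <= e)%R ->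
  (1 - e <= \sum_(i <- S) a i)%R -> (1 - e <= \sum_(i <- S) b i)%R ->
  rms_mu X setT = 1 -> rms_mu Y setT = 1 ->
  (forall B : set (rms_space X), measurable (B : set (borel (rms_root X))) ->
    weighted_atoms S a x B <= rms_mu X (enlarge B e) + e%:E) ->
  (forall B : set (rms_space Y), measurable (B : set (borel (rms_root Y))) ->
    weighted_atoms S b y B <= rms_mu Y (enlarge B e) + e%:E) ->
  dGHP X Y <= (4 * e)%:E.
Proof.
move=> e0 i0L SL xi0 yi0 dxy netx nety a0 b0 ab a1 b1 muX muY hX hY.
pose c := Correspondence i0L e0 dxy.
pose phi (u : rms_space X) : glue c := inl u.
pose psi (v : rms_space Y) : glue c := inr v.
have pair i : i \in L -> (mdist (phi (x i)) (psi (y i)) <= e)%R.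
  by move=> iL; exact: (@glue_pair _ _ _ _ c i iL).
have iphi : isometric phi by [].
have ipsi : isometric psi by [].
apply: (@dGHP_le _ X Y (glue c) phi psi) => //.
- by rewrite mulr_gt0.
- by rewrite -xi0 -yi0; have := pair _ i0L; lra.
- move=> u; have [i iL iu] := netx u; exists (y i).
  have := metric_triangle (psi (y i)) (phi (x i)) (phi u).
  by rewrite iphi (mdistC _ (phi (x i))); have := pair i iL; lra.
- move=> v; have [i iL iv] := nety v; exists (x i).
  have := metric_triangle (phi (x i)) (psi (y i)) (psi v).
  by rewrite ipsi; have := pair i iL; lra.
- apply: (@prokhorov_transfer _ I X Y _ phi psi S x y a b e) => // i iS.
  exact/pair/SL.
- apply: (@prokhorov_transfer _ I Y X _ psi phi S y x b a e) => //.
    by move=> i iS; rewrite mdistC; exact/pair/SL.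
  by under eq_bigr do rewrite distrC.
Qed.

(** * Measurability of tree-valued maps *)

Section random_tree.
Context {R : realType} {d : measure_display} {Omega : measurableType d}.
Local Open Scope ring_scope.

Definition near_params {Theta : eqType} (theta : Theta -> Omega -> R)
    (F : seq Theta) (delta : R) (w w' : Omega) : Prop :=
  forall t, t \in F -> `|theta t w - theta t w'| < delta.

(* A map to [Tw R] which is continuous for the topology induced by countably
   many measurable real functions is measurable, since that topology has a
   countable base of measurable sets. *)
Lemma random_of_continuous {Theta : countType} (theta : Theta -> Omega -> R)
    (T : Omega -> Tw R) :
  (forall t, measurable_fun setT (theta t)) ->
  (forall w (e : R), 0 < e -> exists F (delta : R), 0 < delta /\
     forall w', near_params theta F delta w w' ->
       (Tw_dist (T w) (T w') < e%:E)%E) ->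
  random_wRtree T.
Proof.
move=> mtheta cT; suff mopen U : Tw_open U -> measurable [set w | U (T w)].
  move=> U; elim=> [V /mopen//|V _ mV|V _ mV].
    by rewrite (_ : [set w | _] = ~` [set w | V (T w)])//; exact: measurableC.
  rewrite (_ : [set w | _] = \bigcup_n [set w | V n (T w)]).
    exact: bigcupT_measurable.
  by apply/seteqP; split=> w; [move=> [n Vn]; exists n|move=> [n _ Vn]; exists n].
move=> oU; pose box (b : seq (Theta * (rat * rat))) : set Omega :=
  \bigcap_(p in [set` b]) [set w | ratr p.2.1 < theta p.1 w < ratr p.2.2].
have mbox b : measurable (box b).
  apply: fin_bigcap_measurable; first exact: finite_seq.
  move=> [t [q1 q2]] _ /=.
  rewrite (_ : [set w | _] = theta t @^-1` `]ratr q1, ratr q2[%classic); last first.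
    by apply/seteqP; split=> w /=; rewrite in_itv.
  by rewrite -[X in measurable X]setTI; apply: mtheta.
rewrite (_ : [set w | U (T w)] = \bigcup_(b in [set: seq (Theta * (rat * rat))])
    (if `[< box b `<=` [set w | U (T w)] >] then box b else set0)); last first.
  apply/seteqP; split=> w; last by move=> [b _]; case: asboolP => // h /h.
  move=> /= UTw; have [e e0 eU] := oU _ UTw.
  have [F [delta [d0 near]]] := cT w e e0.
  have /choice[q qP] : forall t, exists q : rat * rat,
      theta t w - delta < ratr q.1 < theta t w /\ theta t w < ratr q.2 < theta t w + delta.
    move=> t.
    have [|q1] := @rat_in_itvoo R (theta t w - delta) (theta t w).
      by rewrite ltrBlDr ltrDl.
    have [|q2] := @rat_in_itvoo R (theta t w) (theta t w + delta).
      by rewrite ltrDl.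
    by rewrite !in_itv/= => ? ?; exists (q1, q2).
  exists [seq (t, q t) | t <- F] => //; case: asboolP; last first.
    case=> w' bw'; apply: eU; apply: near => t tF.
    have /= /andP[h1 h2] := bw' (t, q t) (map_f (fun t => (t, q t)) tF).
    by have [/andP[? ?] /andP[? ?]] := qP t; rewrite ltr_norml; apply/andP; split; lra.
  move=> _ _ /= /mapP[t tF ->] /=.
  by have [/andP[_ ->] /andP[-> _]] := qP t.
apply: countable_bigcupT_measurable; first exact: countableP.
by move=> b; case: asboolP.
Qed.

Context {I J : countType} (X : Omega -> wRtree R).
Let Sp w := rms_space (X w).
Variables (sigma : I -> forall w, Sp w) (i0 : I).
Variables (S : J -> seq I) (a : J -> I -> Omega -> R) (err : J -> Omega -> R).
Hypothesis sigma0 : forall w, sigma i0 w = rms_root (X w).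
Hypothesis sigma_dense : forall w (u : Sp w) e, 0 < e ->
  exists i, mdist (sigma i w) u < e.
Hypothesis sigma_meas : forall i j,
  measurable_fun setT (fun w => mdist (sigma i w) (sigma j w)).
Hypothesis a_meas : forall j i, measurable_fun setT (a j i).
Hypothesis a_ge0 : forall j i w, 0 <= a j i w.
Hypothesis err_meas : forall j, measurable_fun setT (err j).
Hypothesis err_small : forall w e, 0 < e -> exists j, err j w < e.
Hypothesis a_total : forall j w, 1 - err j w <= \sum_(i <- S j) a j i w.
Hypothesis a_le : forall j w (e : R) (B : set (Sp w)), err j w < e ->
  measurable (B : set (borel (rms_root (X w)))) ->
  (weighted_atoms (S j) (a j ^~ w) (sigma ^~ w) B
    <= rms_mu (X w) (enlarge B e) + e%:E)%E.

(** Testing the net property on the countably many sections keeps the event measurable; by density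
    [net_dense] recovers the property for all points with a slightly larger radius. *)
Definition is_net (s : seq I) (n : nat) : set Omega :=
  \bigcap_(i in [set: I]) \bigcup_(k in [set` s])
    [set w | mdist (sigma k w) (sigma i w) <= n.+1%:R^-1].

Let Theta := ((I * I) + (J * I) + J + (seq I * nat))%type.
Let theta (t : Theta) : Omega -> R := match t with
  | inl (inl (inl (i, j))) => fun w => mdist (sigma i w) (sigma j w)
  | inl (inl (inr (j, i))) => a j i
  | inl (inr j) => err j
  | inr (s, n) => \1_(is_net s n)
  end.

Let measurable_is_net s n : measurable (is_net s n).
Proof.
have mle i k : measurable [set w | mdist (sigma k w) (sigma i w) <= n.+1%:R^-1].
  rewrite (_ : [set w | _] = (fun w => mdist (sigma k w) (sigma i w)) @^-1`
    `]-oo, n.+1%:R^-1]%classic); last by apply/seteqP; split=> w /=; rewrite in_itv.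
  by rewrite -[X in measurable X]setTI; apply: sigma_meas.
rewrite /is_net -(setCK (\bigcap_(_ in _) _)); apply: measurableC.
rewrite setC_bigcap; apply: countable_bigcupT_measurable; first exact: countableP.
move=> i; apply: measurableC; exact: fin_bigcup_measurable.
Qed.

Let theta_meas t : measurable_fun setT (theta t).
Proof.
case: t => [[[[i j]|[j i]]|j]|[s n]]; [exact: sigma_meas|exact: a_meas|
  exact: err_meas|].
exact: measurable_indic.
Qed.

Let net_dense s n w (e : R) : is_net s n w -> n.+1%:R^-1 < e ->
  forall u : Sp w, exists2 i, i \in s & mdist (sigma i w) u < e.
Proof.
move=> net ne u; have [|i iu] := @sigma_dense w u (e - n.+1%:R^-1).
  by rewrite subr_gt0.
have [k ks ki] := net i Logic.I; exists k => //; move: ki => /= ki.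
have := metric_triangle (sigma k w) (sigma i w) u.
move: (n.+1%:R^-1) iu ki => q; lra.
Qed.

Let net_exists n w : exists s, is_net s n w.
Proof.
have cX : compact [set: Sp w] by case: (wR_spaceP (X w)).
have n2 : 0 < (n.+1%:R^-1 / 2 : R) by rewrite divr_gt0// invr_gt0.
have [s sP] := compact_net cX n2.
have /choice[f fP] : forall u : Sp w, exists i, mdist (sigma i w) u < n.+1%:R^-1 / 2.
  by move=> u; have [i iu] := sigma_dense u n2; exists i.
exists (map f s) => i _; have [y ys yi] := sP (sigma i w).
exists (f y) => /=; first exact: map_f.
have := metric_triangle (sigma (f y) w) y (sigma i w).
by move: (fP y) yi; move: (n.+1%:R^-1) => q /=; lra.
Qed.

(** Near a sample point [w] the tree is determined up to [e] by finitely many parameters: the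
    distances within a finite net and the support of one approximating measure, the weights of that
    measure, its error, and the event that the net is one. If they are close at [w'], the two trees
    are in correspondence. *)
Theorem random_wRtree_of_sections : random_wRtree (fun w => Tw_of (X w)).
Proof.
apply: (random_of_continuous theta_meas) => w e e0.
(* [dGHP_correspondence] returns four times its parameter, and four fifths of [e] is below [e]. The
   error is chosen below [e / 10] at [w], so that it stays below [e / 5] at [w']. *)
have e5 : 0 < e / 5 by rewrite divr_gt0.
have e10 : 0 < e / 10 by rewrite divr_gt0.
have [n] := ltr_add_invr (e5 : 0 < e / 5); rewrite add0r => ne.
have [s snet] := net_exists n w.
have [j jw] := err_small w e10.
pose L := i0 :: s ++ S j.
pose F : seq Theta := [seq inl (inl (inl (p.1, p.2))) | p <- allpairs pair L L] ++
  [seq inl (inl (inr (j, i))) | i <- S j] ++ [:: inl (inr j); inr (s, n)].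
(* The first bound serves distances and errors. The second forces the indicator of [is_net s n] to
   agree at [w] and [w']. The third keeps the summed difference of weights below [e / 5]; adding 1
   to the size covers an empty support. *)
pose delta := minr (e / 10) (minr (2^-1) (e / 5 / ((size (S j))%:R + 1))).
have d0 : 0 < delta.
  by rewrite /delta !lt_min e10 invr_gt0 ltr0n/= divr_gt0// ltr_wpDl.
exists F, delta; split=> // w' near.
have dle1 : delta <= e / 10 by rewrite /delta ge_min lexx.
have dle2 : delta <= 2^-1 by rewrite /delta !ge_min lexx !orbT.
have dle3 : delta <= e / 5 / ((size (S j))%:R + 1) by rewrite /delta !ge_min lexx !orbT.
have snet' : is_net s n w'.
  have /near : inr (s, n) \in F by rewrite !mem_cat !inE eqxx !orbT.
  rewrite /= !indicE (mem_set snet); case: (boolP (w' \in _)) => [/set_mem//|_].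
  by rewrite subr0 normr1 => h; have := lt_le_trans h dle2; lra.
have jw' : err j w' < e / 5.
  have /near : inl (inr j) \in F by rewrite !mem_cat !inE eqxx !orbT.
  by rewrite /= ltr_norml => /andP[? ?]; lra.
have dist' : {in L &, forall i k,
    `|mdist (sigma i w) (sigma k w) - mdist (sigma i w') (sigma k w')| <= 2 * (e / 5)}.
  move=> i k iL kL; have /near /= : inl (inl (inl (i, k))) \in F.
    rewrite mem_cat; apply/orP; left; apply/mapP; exists (i, k) => //.
    exact: allpairs_f.
  by lra.
have sumS : \sum_(i <- S j) `|a j i w - a j i w'| <= e / 5.
  apply: (@le_trans _ _ (\sum_(i <- S j) (e / 5 / ((size (S j))%:R + 1)))).
    rewrite !big_seq; apply: ler_sum => i iS.
    have /near /= : inl (inl (inr (j, i))) \in F.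
      by rewrite mem_cat; apply/orP; right; rewrite mem_cat map_f.
    by move/ltW/le_trans; apply.
  rewrite big_const_seq count_predT iter_addr_0.
  have hc (c : R) k : 0 <= c -> c / (k%:R + 1) *+ k <= c.
    move=> c0; rewrite -(mulr_natr _ k) mulrAC ler_pdivrMr ?ltr_wpDl//.
    by rewrite ler_wpM2l// lerDl.
  exact/hc/ltW.
have LS k : k \in s -> (k \in L) by move=> ks; rewrite inE mem_cat ks orbT.
apply: le_lt_trans (Tw_dist_le _ _) _.
apply: (@le_lt_trans _ _ (4 * (e / 5))%:E); last by rewrite lte_fin; lra.
apply: (@dGHP_correspondence R I (X w) (X w') L (S j) i0 (sigma ^~ w) (sigma ^~ w')
  (a j ^~ w) (a j ^~ w') (e / 5)) => //.
- exact: mem_head.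
- by move=> i iS; rewrite inE mem_cat iS !orbT.
- exact: sigma0.
- exact: sigma0.
- by move=> u; have [i is_ iu] := net_dense snet ne u; exists i; rewrite ?LS.
- by move=> u; have [i is_ iu] := net_dense snet' ne u; exists i; rewrite ?LS.
- by apply: le_trans (a_total j w); lra.
- by apply: le_trans (a_total j w'); lra.
- by case: (wR_spaceP (X w)).
- by case: (wR_spaceP (X w')).
- by move=> B mB; apply: a_le => //; lra.
- by move=> B mB; apply: a_le.
Qed.

End random_tree.

(** * Measurable sections of the limit tree *)

Section gstring_measurability.
Context {R : realType}.

Lemma measurable_gs_len : measurable_fun setT (@gs_len R).
Proof.
by move=> _ Y mY; apply: sub_sigma_algebra; left; left; left; exists Y.
Qed.

Lemma measurable_gs_pos i : measurable_fun setT (fun s : gstring R => gs_pos s i).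
Proof.
by move=> _ Y mY; apply: sub_sigma_algebra; left; left; right; exists i => //; exists Y.
Qed.

Lemma measurable_gs_mass i :
  measurable_fun setT (fun s : gstring R => (gs_mass s i)%:num%R).
Proof.
by move=> _ Y mY; apply: sub_sigma_algebra; left; right; exists i => //; exists Y.
Qed.

Lemma measurable_gs_diff (A : set R) : measurable A ->
  measurable_fun setT (fun s : gstring R => gs_diff s A).
Proof.
by move=> mA _ Y mY; apply: sub_sigma_algebra; right; exists A => //; exists Y.
Qed.

End gstring_measurability.

Section countable_selection.
Context {d d' : measure_display} {Omega : measurableType d} {V : measurableType d'}.

(** Freezes a random index: on each of its countably many level sets the function is one of the
    [f k]. *)
Lemma measurable_select {K : countType} (N : Omega -> K) (f : K -> Omega -> V) :
  (forall k, measurable [set w | N w = k]) ->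
  (forall k, measurable_fun setT (f k)) ->
  measurable_fun setT (fun w => f (N w) w).
Proof.
move=> mN mf _ Y mY; rewrite setTI.
rewrite (_ : _ @^-1` Y = \bigcup_(k in [set: K]) ([set w | N w = k] `&` f k @^-1` Y)).
  apply: countable_bigcupT_measurable; first exact: countableP.
  by move=> k; apply: measurableI => //; rewrite -[X in measurable X]setTI; exact: mf.
by apply/seteqP; split=> w; [move=> fY; exists (N w)|move=> [k _ [/= ->]]].
Qed.

Lemma measurable_level_pair (N : Omega -> nat * nat) :
  measurable_fun setT N -> forall p, measurable [set w | N w = p].
Proof.
move=> mN [p q]; rewrite (_ : [set w | _] = N @^-1` ([set p] `*` [set q])).
  by rewrite -[X in measurable X]setTI; apply: mN => //; exact: measurableX.
by apply/seteqP; split=> w /=; case: (N w) => x y /=; [case=> -> ->|case=> -> ->].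
Qed.

Lemma measurable_level_fst (N : Omega -> nat * nat) :
  measurable_fun setT N -> forall p, measurable [set w | (N w).1 = p].
Proof.
move=> mN p; rewrite (_ : [set w | _] = \bigcup_q [set w | N w = (p, q)]).
  by apply: bigcupT_measurable => q; exact: measurable_level_pair.
apply/seteqP; split=> w /=; last by move=> [q _ ->].
by move=> <-; exists (N w).2 => //; exact: surjective_pairing.
Qed.

End countable_selection.

Section branch_distance.
Context {R : realType} {T : metricType R} (x : nat -> T) (l : nat -> R).
Local Open Scope ring_scope.

Definition branch_height i (t : R) : R := maxr 0 (minr t (l i)).

Lemma branchP i t :
  (branch x l i t = inl (x i) /\ branch_height i t = 0) \/
  exists p : 0 < branch_height i t <= l i, branch x l i t = attach_inr x p.
Proof.
rewrite /branch /branch_height; have [m0|m0] := leP (minr t (l i)) 0.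
  left; split=> //; case: insubP => // -[[j s] /= js] h _; exfalso.
  by move: h; rewrite ltNge m0.
right; have p : 0 < minr t (l i) <= l i by rewrite m0 ge_min lexx orbT.
exists p; case: insubP => [b _ vb|]; last by rewrite /= p.
by congr inr; apply/val_inj; rewrite vb.
Qed.

Lemma branch_attach_inr i t (p : 0 < t <= l i) : branch x l i t = attach_inr x p.
Proof.
have /andP[t0 tl] := p.
rewrite /branch; case: insubP => [b _ vb|]/=; last by rewrite (min_idPl tl) t0 tl.
by congr inr; apply/val_inj; rewrite /= vb (min_idPl tl).
Qed.

Lemma mdist_inl_branch u i t : mdist (inl u : attach x l) (branch x l i t) =
  mdist u (x i) + branch_height i t.
Proof.
by case: (branchP i t) => [[-> ->]|[p ->]]; rewrite ?addr0// mdist_inl_inr.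
Qed.

Lemma branch_height_ge0 i t : 0 <= branch_height i t.
Proof. by rewrite /branch_height le_max lexx. Qed.

Lemma mdist_branch_branch i j s t :
  mdist (branch x l i s) (branch x l j t) =
  if i == j then `|branch_height i s - branch_height j t|
  else branch_height i s + mdist (x i) (x j) + branch_height j t.
Proof.
case: (branchP i s) => [[-> ->]|[p ->]].
  rewrite mdist_inl_branch; case: eqP => [->|_]; last by rewrite add0r.
  by rewrite mdistxx add0r sub0r normrN ger0_norm ?branch_height_ge0.
case: (branchP j t) => [[-> ->]|[q ->]]; last exact: mdist_inr_inr.
rewrite [LHS]mdistC mdist_inl_inr; case: eqP => [->|_].
  by rewrite mdistxx add0r subr0 ger0_norm// branch_height_ge0.
by rewrite addr0 addrC mdistC.
Qed.

End branch_distance.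

Section stage_masses.
Context {R : realType} {d : measure_display} {Omega : measurableType d}.
Context (beta : R) (xi : Omega -> gstring R) (copy : nat -> nat -> Omega -> gstring R)
  (enum : nat -> Omega -> nat -> nat * nat).

Definition stage_mass n k w : R := (st_mass (stages beta (xi w)
  (fun m i => copy m i w) (fun m => enum m w) n) k)%:num%R.

Lemma stage_mass_ge0 n k w : (0 <= stage_mass n k w)%R.
Proof. by rewrite /stage_mass. Qed.

(** Only copies and enumerations of levels below [n] are assumed measurable, so that the lemma also
    applies to the sigma-algebra of the past of stage [n]. *)
Lemma measurable_stage_mass n k : measurable_fun setT xi ->
  (forall m i, (m < n)%N -> measurable_fun setT (copy m i)) ->
  (forall m i, (m < n)%N -> measurable_fun setT (fun w => enum m w i)) ->
  measurable_fun setT (stage_mass n k).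
Proof.
move=> mxi; elim: n k => [|n IH] k mcopy menum.
  exact: (measurableT_comp (measurable_gs_mass k) mxi).
apply: (@measurable_select _ _ _ _ _ (fun w => enum n w k)
  (fun p w => (stage_mass n p.1 w * (gs_mass (copy n p.1 w) p.2)%:num)%R)).
  by apply: measurable_level_pair; exact: menum.
move=> p; apply: measurable_funM.
  by apply: IH => m i mn; [apply: mcopy|apply: menum]; exact: ltnW.
exact: (measurableT_comp (measurable_gs_mass p.2) (mcopy n p.1 (ltnSn n))).
Qed.

End stage_masses.

Section measurable_sections.
Context {R : realType} {d : measure_display} {Omega : measurableType d}.
Context (beta : R) (beta_gt0 : (0 < beta)%R) (D : Omega -> treedata beta).
Hypothesis mroot : measurable_fun setT (fun w => td_root (D w)).
Hypothesis mcopy : forall n i, measurable_fun setT (fun w => td_copy (D w) n i).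
Hypothesis menum : forall n k, measurable_fun setT (fun w => td_enum (D w) n k).
Local Open Scope ring_scope.

Lemma measurable_td_mass n i : measurable_fun setT (fun w => td_mass (D w) n i).
Proof.
by apply: (@measurable_stage_mass _ _ _ beta (fun w => td_root (D w))
  (fun n i w => td_copy (D w) n i) (fun n w => td_enum (D w) n)).
Qed.

Lemma measurable_td_scale n i : measurable_fun setT (fun w => td_scale (D w) n i).
Proof.
exact: (measurableT_comp (measurable_powR beta) (measurable_td_mass n i)).
Qed.

Let blen w n i := td_scale (D w) n i * gs_len (td_copy (D w) n i).

Let measurable_blen n i : measurable_fun setT (fun w => blen w n i).
Proof.
apply: measurable_funM; first exact: measurable_td_scale.
exact: (measurableT_comp measurable_gs_len (mcopy n i)).
Qed.

(** The target space varies with the sample point, so measurability is stated through coordinates.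
    The branch index is random because the enumeration decides which parent carries a given atom. *)
Fixpoint msection n : (forall w, st_space (td_stage (D w) n)) -> Prop :=
  match n return (forall w, st_space (td_stage (D w) n)) -> Prop with
  | 0 => fun tau => exists2 t : Omega -> R, measurable_fun setT t & forall w,
      tau w = (seg_of (gs_len_gt0 (td_root (D w))) (t w) : st_space (td_stage (D w) 0))
  | m.+1 => fun tau =>
      (exists2 tau', msection tau' &
         forall w, tau w = (inl (tau' w) : st_space (td_stage (D w) m.+1))) \/
      exists (i : Omega -> nat) (t : Omega -> R),
        [/\ forall k, measurable [set w | i w = k], measurable_fun setT t
          & forall w, tau w = td_branch (D w) m (i w) (t w)]
  end.

Lemma msection_loc n i : msection (fun w => td_loc (D w) n i).
Proof.
case: n i => [|n] i.
  exists (fun w => gs_pos (td_root (D w)) i) => //.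
  exact: (measurableT_comp (measurable_gs_pos i) mroot).
right; exists (fun w => (td_enum (D w) n i).1),
  (fun w => gs_pos (td_copy (D w) n (td_enum (D w) n i).1) (td_enum (D w) n i).2).
split=> //; first exact: measurable_level_fst.
apply: (@measurable_select _ _ _ _ _ (fun w => td_enum (D w) n i)
  (fun p w => gs_pos (td_copy (D w) n p.1) p.2)).
  exact: measurable_level_pair.
by move=> p; exact: (measurableT_comp (measurable_gs_pos p.2) (mcopy n p.1)).
Qed.

Let measurable_height n i (t : Omega -> R) : measurable_fun setT t ->
  measurable_fun setT
    (fun w => branch_height (blen w n) i (td_scale (D w) n i * t w)).
Proof.
move=> mt; apply: measurable_maxr; first exact: measurable_cst.
apply: measurable_minr; last exact: measurable_blen.
by apply: measurable_funM => //; exact: measurable_td_scale.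
Qed.

(** The distance between branch points is given by heights and by the distance between attachment
    points. The latter are sections of the previous stage once the random branch indices are
    frozen. *)
Lemma measurable_msection_dist n (tau tau' : forall w, st_space (td_stage (D w) n)) :
  msection tau -> msection tau' ->
  measurable_fun setT (fun w => mdist (tau w) (tau' w)).
Proof.
elim: n tau tau' => [|n IH] tau tau'.
  move=> [t mt tauE] [t' mt' tauE'].
  under eq_fun do rewrite tauE tauE'.
  have mL : measurable_fun setT (fun w => gs_len (td_root (D w))).
    exact: (measurableT_comp measurable_gs_len mroot).
  have h (u : Omega -> R) : measurable_fun setT u -> measurable_fun setT
      (fun w => maxr 0 (minr (u w) (gs_len (td_root (D w))))).
    move=> mu; apply: measurable_maxr; first exact: measurable_cst.
    exact: measurable_minr.
  exact: (measurableT_comp (@normr_measurable R setT) (measurable_funB (h _ mt) (h _ mt'))).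
have inlr (sg : forall w, st_space (td_stage (D w) n)) (i : Omega -> nat) (t : Omega -> R) :
    msection sg -> (forall k, measurable [set w | i w = k]) -> measurable_fun setT t ->
    measurable_fun setT (fun w =>
      mdist (inl (sg w) : st_space (td_stage (D w) n.+1)) (td_branch (D w) n (i w) (t w))).
  move=> msg mi mt.
  pose f k w : R :=
    mdist (inl (sg w) : st_space (td_stage (D w) n.+1)) (td_branch (D w) n k (t w)).
  suff mf k : measurable_fun setT (f k) by exact: (measurable_select mi mf).
  rewrite /f.
  under eq_fun do rewrite mdist_inl_branch.
  apply: measurable_funD; last exact: measurable_height.
  exact/IH/msection_loc.
move=> [[sg msg tauE]|[i [t [mi mt tauE]]]] [[sg' msg' tauE']|[i' [t' [mi' mt' tauE']]]];
  under eq_fun do rewrite tauE tauE'.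
- exact: IH.
- exact: inlr.
- by under eq_fun do rewrite mdistC; exact: inlr.
pose f k k' w : R := mdist (td_branch (D w) n k (t w)) (td_branch (D w) n k' (t' w)).
suff mf k k' : measurable_fun setT (f k k').
  have mf' k : measurable_fun setT (fun w => f k (i' w) w).
    exact: (measurable_select mi' (mf k)).
  exact: (measurable_select mi mf').
rewrite /f.
under eq_fun do rewrite mdist_branch_branch.
case: (k == k').
  apply: (measurableT_comp (@normr_measurable R setT)).
  by apply: measurable_funB; exact: measurable_height.
apply: measurable_funD; last exact: measurable_height.
apply: measurable_funD; first exact: measurable_height.
by apply: IH; exact: msection_loc.
Qed.

Definition lim_section n (sg : forall w, td_lim (D w)) : Prop :=
  exists2 tau, @msection n tau & forall w, sg w = td_inj (tau w).

Lemma lim_section_up n m sg : (n <= m)%N -> lim_section n sg -> lim_section m sg.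
Proof.
move=> /subnK <-; elim: (m - n)%N => // j IH /IH[tau mtau tauE].
rewrite addSn; exists (fun w => inl (tau w)); first by left; exists tau.
by move=> w; rewrite tauE td_inj_up.
Qed.

Lemma measurable_lim_section_dist n m sg sg' :
  lim_section n sg -> lim_section m sg' ->
  measurable_fun setT (fun w => mdist (sg w) (sg' w)).
Proof.
move=> /(lim_section_up (leq_maxl n m))[tau mtau tauE].
move=> /(lim_section_up (leq_maxr n m))[tau' mtau' tauE'].
under eq_fun do rewrite tauE tauE' td_inj_iso.
exact: measurable_msection_dist.
Qed.

Lemma lim_section_root : lim_section 0 (fun w => td_lim_root (D w)).
Proof. by exists (fun w => st_root (td_stage (D w) 0)) => //; exists (fun=> 0). Qed.

Lemma lim_section_loc n i : lim_section n (fun w => td_inj (td_loc (D w) n i)).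
Proof. by exists (fun w => td_loc (D w) n i) => //; exact: msection_loc. Qed.

Lemma lim_section_piece0 t : lim_section 0 (fun w => piece0 (D w) t).
Proof.
exists (fun w => seg_of (gs_len_gt0 (td_root (D w))) t : st_space (td_stage (D w) 0)) => //.
by exists (fun=> t).
Qed.

Lemma lim_section_piece n i t : lim_section n.+1 (fun w => piece (D w) n i t).
Proof.
exists (fun w => td_branch (D w) n i t) => //; right; exists (fun=> i), (fun=> t).
split=> // k; have [->|ik] := eqVneq i k.
  by rewrite (_ : [set w | _] = setT)//; apply/seteqP; split.
rewrite (_ : [set w | _] = set0)//.
by apply/seteqP; split=> // w /= /eqP; rewrite (negbTE ik).
Qed.

Lemma measurable_atom_mass n : measurable_fun setT (fun w => atom_mass (D w) n).
Proof.
apply: ge0_emeasurable_sum => [k w _ _|k _]; first by rewrite lee_fin td_mass_ge0.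
by apply/measurable_EFinP; exact: measurable_td_mass.
Qed.

Lemma measurable_cells_lim_mass :
  measurable_fun setT (fun w => lebesgue_measure (cells_lim (D w))).
Proof.
apply: (@emeasurable_fun_cvg _ _ _ _ (fun n w => atom_mass (D w) n)).
  exact: measurable_atom_mass.
by move=> w _; exact: atom_mass_cvg.
Qed.

Lemma measurable_mass_defect n : measurable_fun setT (fun w => mass_defect (D w) n).
Proof.
apply: (@measurableT_comp _ _ _ _ _ _ fine); first exact: fine_measurable.
apply: emeasurable_funB; first exact: measurable_atom_mass.
exact: measurable_cells_lim_mass.
Qed.

End measurable_sections.

(** * Finite approximation of the limit measure *)

Section series_convergence.
Context {R : realType}.
Local Open Scope ring_scope.

Lemma cvg_seq_sum {I : Type} (r : seq I) (f : I -> nat -> R) (l : I -> R) :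
  (forall i, f i N @[N --> \oo] --> l i) ->
  \sum_(i <- r) f i N @[N --> \oo] --> \sum_(i <- r) l i.
Proof.
move=> fl; elim: r => [|i r IH].
  by under eq_fun do rewrite big_nil; rewrite big_nil; exact: cvg_cst.
by under eq_fun do rewrite big_cons; rewrite big_cons; exact: cvgD (fl i) IH.
Qed.

Lemma series_cvg_real (u : nat -> R) (V : R) : (forall i, 0 <= u i) ->
  (\sum_(i <oo) (u i)%:E)%E = V%:E ->
  \sum_(0 <= i < N) u i @[N --> \oo] --> V.
Proof.
move=> u0 uV.
have h : (\sum_(0 <= i < N) (u i)%:E)%E @[N --> \oo] --> V%:E.
  by rewrite -uV; apply: is_cvg_nneseries => i _ _; rewrite lee_fin.
by move: h; under eq_fun do rewrite sumEFin; exact: fine_cvg.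
Qed.

Lemma series_le_real (u : nat -> R) (V : R) N : (forall i, 0 <= u i) ->
  (\sum_(i <oo) (u i)%:E)%E = V%:E -> \sum_(0 <= i < N) u i <= V.
Proof.
move=> u0 uV; rewrite -lee_fin -uV -sumEFin; apply: nneseries_lim_ge => i _ _.
by rewrite lee_fin.
Qed.

(** The supports below are cut at the same [N] in both indices, hence square partial sums. They stay
    below [V], and eventually dominate the first [N1] rows cut at [N], whose sums approach those of
    full rows. *)
Lemma double_series_cvg (u : nat -> nat -> R) (U : nat -> R) (V : R) :
  (forall i j, 0 <= u i j) ->
  (forall i, (\sum_(j <oo) (u i j)%:E)%E = (U i)%:E) ->
  (\sum_(i <oo) (U i)%:E)%E = V%:E ->
  \sum_(0 <= i < N) \sum_(0 <= j < N) u i j @[N --> \oo] --> V.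
Proof.
move=> u0 uU UV.
have U0 i : 0 <= U i.
  by rewrite -lee_fin -uU; apply: nneseries_ge0 => j _ _; rewrite lee_fin.
apply/cvgrPdist_le => e e0; have e2 : 0 < e / 2 by rewrite divr_gt0.
have /cvgrPdist_lt/(_ _ e2)[N1 _ N1P] := series_cvg_real U0 UV.
have c : \sum_(0 <= i < N1) \sum_(0 <= j < N) u i j @[N --> \oo] -->
    \sum_(0 <= i < N1) U i.
  by apply: cvg_seq_sum => i; exact: series_cvg_real.
have /cvgrPdist_lt/(_ _ e2)[N2 _ N2P] := c.
exists (maxn N1 N2) => // N /=; rewrite geq_max => /andP[N1N N2N].
have := N1P N1 (leqnn _); have := N2P N N2N.
rewrite /= !ltr_norml => /andP[_ h1] /andP[_ h2].
have h3 : \sum_(0 <= i < N) \sum_(0 <= j < N) u i j <= V.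
  apply: le_trans (series_le_real N U0 UV); apply: ler_sum => i _.
  exact: series_le_real.
have h4 : \sum_(0 <= i < N1) \sum_(0 <= j < N) u i j <=
    \sum_(0 <= i < N) \sum_(0 <= j < N) u i j.
  rewrite [leRHS](@big_cat_nat _ _ _ N1)//= lerDl.
  by apply: sumr_ge0 => i _; exact: sumr_ge0.
by rewrite ger0_norm ?subr_ge0//; lra.
Qed.

End series_convergence.

Section grid.
Context {R : realType}.
Local Open Scope ring_scope.

Definition grid k j : R := j%:R / k.+1%:R.
Definition grid_cell k j : set R := `[grid k j, grid k j.+1[%classic.

Lemma measurable_grid_cell k j : measurable (grid_cell k j).
Proof. exact: measurable_itv. Qed.

Lemma gridS k j : grid k j.+1 = grid k j + k.+1%:R^-1.
Proof. by rewrite /grid -natr1 mulrDl mul1r. Qed.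

Lemma grid_near k j t : grid_cell k j t -> `|grid k j - t| < k.+1%:R^-1.
Proof.
rewrite /grid_cell/= in_itv/= gridS => /andP[h1 h2].
by rewrite distrC ger0_norm ?subr_ge0// ltrBlDl.
Qed.

Lemma grid_cell_ex k t : 0 <= t -> exists j, grid_cell k j t.
Proof.
move=> t0; have k0 : 0 < k.+1%:R :> R by rewrite ltr0n.
have tk : 0 <= t * k.+1%:R by rewrite mulr_ge0// ler0n.
have /andP[h1 h2] := truncn_itv tk.
exists (Num.truncn (t * k.+1%:R)); rewrite /grid_cell/= in_itv/= /grid.
by rewrite ler_pdivrMr// h1 ltr_pdivlMr.
Qed.

Lemma grid_cell_inj k i j t : grid_cell k i t -> grid_cell k j t -> i = j.
Proof.
have k0 : 0 < k.+1%:R^-1 :> R by rewrite invr_gt0 ltr0n.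
rewrite /grid_cell/= !in_itv/= /grid => /andP[a b] /andP[c d].
have := le_lt_trans a d; have := le_lt_trans c b.
rewrite !ltr_pM2r// !ltr_nat !ltnS => ji ij.
by apply/eqP; rewrite eqn_leq ij.
Qed.

Lemma grid_approx t (e : R) : 0 <= t -> 0 < e ->
  exists k j, `|grid k j - t| < e.
Proof.
move=> t0 e0; have [k] := ltr_add_invr (e0 : 0 < e); rewrite add0r => ke.
have [j jt] := grid_cell_ex k t0; exists k, j.
exact: lt_trans (grid_near jt) ke.
Qed.

Lemma grid_mass (s : gstring R) k (Q : pred nat) :
  gs_diff s (\bigcup_(j in [set j | Q j]) grid_cell k j) =
  (\sum_(j <oo | Q j) gs_diff s (grid_cell k j))%E.
Proof.
rewrite measure_bigcup//=.
- rewrite (@eq_eseriesl _ _ Q)//.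
  by move=> i; apply/idP/idP => [/set_mem|Qi]//; exact: mem_set.
- by move=> i _; exact: measurable_grid_cell.
- by move=> i j _ _ [t [ti tj]]; exact: grid_cell_inj ti tj.
Qed.

(** The cells cover the nonnegative half-line, and the measure of a string does not charge the
    rest. *)
Lemma grid_total (s : gstring R) k :
  (\sum_(j <oo) gs_diff s (grid_cell k j))%E = gs_diff s setT.
Proof.
rewrite -(grid_mass s k xpredT) set_true.
have mU : measurable (\bigcup_j grid_cell k j).
  by apply: bigcupT_measurable => j; exact: measurable_grid_cell.
apply/eqP; rewrite eq_le le_measure ?inE//=.
rewrite -(setvU (\bigcup_j grid_cell k j)) measureU ?setICl//; last exact: measurableC.
rewrite -[leRHS]add0e leeD2r// -(gs_diff_out s); apply: le_measure; rewrite ?inE.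
- exact: measurableC.
- by apply: measurableC; exact: measurable_itv.
apply: subsetC => t /=; rewrite in_itv/= => /andP[t0 _].
by have [j jt] := grid_cell_ex k t0; exists j.
Qed.

Lemma gs_diff_fin (s : gstring R) A : measurable A -> gs_diff s A \is a fin_num.
Proof.
by move=> mA; rewrite ge0_fin_numE// (le_lt_trans (string_diff_le1 s mA))// ltry.
Qed.

(** Moving the mass of each cell to its left endpoint displaces it by less than the mesh. *)
Lemma grid_discretize (s : gstring R) (T : metricType R) (r : T) (f : R -> T)
    (B : set T) k N :
  (forall t u, mdist (f t) (f u) <= `|t - u|) ->
  (\sum_(0 <= j < N) (fine (gs_diff s (grid_cell k j)) * \1_B (f (grid k j)))%:E
   <= gs_diff s (f @^-1` enlarge B k.+1%:R^-1))%E.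
Proof.
move=> fl; pose Q j := `[< B (f (grid k j)) >].
have mE : measurable (f @^-1` enlarge B k.+1%:R^-1).
  have mf : measurable_fun setT (f : R -> borel r).
    by apply: (@measurable_lipschitz_R _ _ _ _ 1) => t u; rewrite mul1r.
  by rewrite -[X in measurable X]setTI; apply: mf => //; exact: measurable_enlarge.
apply: (@le_trans _ _ (gs_diff s (\bigcup_(j in [set j | Q j]) grid_cell k j))).
  rewrite grid_mass eseries_mkcond.
  apply: (@le_trans _ _ (\sum_(0 <= j < N)
      if Q j then gs_diff s (grid_cell k j) else 0)%E); last first.
    by apply: nneseries_lim_ge => j _ _; case: ifP.
  apply: lee_sum => j _; rewrite /Q indicE; case: asboolP => Bj.
    by rewrite mem_set// mulr1 fineK// gs_diff_fin//; exact: measurable_grid_cell.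
  by rewrite memNset// mulr0.
apply: le_measure; rewrite ?inE//.
  by apply: bigcup_measurable => j _; exact: measurable_grid_cell.
move=> t [j /= /asboolP Bj jt]; exists (f (grid k j)) => //.
exact: le_lt_trans (fl _ _) (grid_near jt).
Qed.

End grid.

Section limit_approximation.
Context {R : realType} (beta : R) (beta_gt0 : (0 < beta)%R) (D : treedata beta).
Local Open Scope ring_scope.

Definition lim_index : Type :=
  option ((nat * nat) + (nat * nat) + ((nat * nat) * (nat * nat))).

Definition lim_point (i : lim_index) : td_lim D := match i with
  | None => td_lim_root D
  | Some (inl (inl (n, i))) => td_inj (td_loc D n i)
  | Some (inl (inr (k, j))) => piece0 D (grid k j)
  | Some (inr ((m, i), (k, j))) => piece D m i (grid k j)
  end.

Definition lim_weight (i : lim_index) : R := match i with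
  | None => 0
  | Some (inl (inl (n, i))) => td_mass D n i
  | Some (inl (inr (k, j))) => fine (gs_diff (td_root D) (grid_cell k j))
  | Some (inr ((m, i), (k, j))) =>
      td_mass D m i * fine (gs_diff (td_copy D m i) (grid_cell k j))
  end.

(** [n] is at once the stage to be approximated and the fineness of the grids; [N] truncates every
    infinite sum. *)
Definition lim_support n N : seq lim_index :=
  [seq Some (inl (inl (n, i))) | i <- index_iota 0 N] ++
  [seq Some (inl (inr (n, j))) | j <- index_iota 0 N] ++
  [seq Some (inr (p, (n, j))) |
     p <- allpairs pair (index_iota 0 n) (index_iota 0 N), j <- index_iota 0 N].

Lemma lim_support_sum n N (F : lim_index -> R) : \sum_(i <- lim_support n N) F i =
  \sum_(0 <= i < N) F (Some (inl (inl (n, i)))) +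
  (\sum_(0 <= j < N) F (Some (inl (inr (n, j)))) +
   \sum_(0 <= m < n) \sum_(0 <= i < N) \sum_(0 <= j < N)
     F (Some (inr ((m, i), (n, j))))).
Proof. by rewrite !big_cat/= !big_map !big_allpairs_dep. Qed.

Lemma lim_weight_ge0 i : 0 <= lim_weight i.
Proof.
case: i => [[[[n i]|[k j]]|[[m i] [k j]]]|] //=; rewrite ?td_mass_ge0 ?fine_ge0//.
by rewrite mulr_ge0 ?td_mass_ge0 ?fine_ge0.
Qed.

Let dense_level n (v : st_space (td_stage D n)) (e : R) : 0 < e ->
  exists i, mdist (lim_point i) (td_inj v) < e.
Proof.
elim: n v e => [|n IH] v e e0.
  have [t t0 ->] : exists2 t, 0 <= t & v = seg_of (gs_len_gt0 (td_root D)) t.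
    case: v => t tl; have /andP[t0 t1] := tl; exists t => //.
    by apply/val_inj; rewrite /= (min_idPl t1) (max_idPr t0).
  have [k [j kj]] := grid_approx t0 e0.
  exists (Some (inl (inr (k, j)))); exact: le_lt_trans (piece0_lipschitz D _ _) kj.
case: (attachP v) => [[u ->]|[i [t [p ->]]]].
  by rewrite td_inj_up; exact: IH.
have /andP[t0 tl] := p.
(* A branch that contains a point has positive length, so its scale can be divided out to recover
   the coordinate in the unscaled string. *)
have s0 : 0 < td_scale D n i.
  rewrite lt_def td_scale_ge0 andbT; apply/eqP => s0.
  by move: (lt_le_trans t0 tl); rewrite -/(td_mass D n i) -/(td_scale D n i) s0 mul0r ltxx.
have ts : 0 <= t / td_scale D n i by rewrite divr_ge0 ?ltW.
have [k [j kj]] := grid_approx ts e0.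
exists (Some (inr ((n, i), (k, j)))).
suff -> : attach_inr (td_loc D n) p = td_branch D n i (t / td_scale D n i).
  exact: le_lt_trans (piece_lipschitz beta_gt0 D n i _ _) kj.
rewrite /td_branch mulrCA divff ?gt_eqF// mulr1.
exact/esym/branch_attach_inr.
Qed.

Lemma lim_point_dense (u : td_lim D) (e : R) : 0 < e ->
  exists i, mdist (lim_point i) u < e.
Proof.
move=> e0; have e4 : 0 < e / 4 by rewrite divr_gt0.
have [n ne] := td_err_small D e4; have [i iu] := dense_level (sval u n) e4.
exists i; have := metric_triangle (lim_point i) (td_inj (sval u n)) u.
have h : mdist (td_inj (sval u n)) u <= 2 * td_err D n.
  exact: (@tw_inj_proj R (td_tower D) u n).
lra.
Qed.

(** Three sources of error: the passage from stage [n] to the limit, the mesh of the grids, and the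
    mass lost by truncation. *)
Definition lim_err n N : R := stage_gap D n + n.+1%:R^-1 +
  maxr 0 (1 - \sum_(i <- lim_support n N) lim_weight i).

Lemma lim_err_total n N : 1 - lim_err n N <= \sum_(i <- lim_support n N) lim_weight i.
Proof.
have h : 1 - \sum_(i <- lim_support n N) lim_weight i <=
    maxr 0 (1 - \sum_(i <- lim_support n N) lim_weight i) by rewrite le_max lexx orbT.
have g0 : 0 <= stage_gap D n.
  by rewrite addr_ge0 ?mass_defect_ge0// mulr_ge0 ?td_err_ge0.
have n0 : 0 <= n.+1%:R^-1 :> R by rewrite invr_ge0.
rewrite /lim_err; move: (n.+1%:R^-1) n0 h => q; lra.
Qed.

Let stage_muE n (B : set (td_lim D)) :
  stage_measure (td_stage D n) (@td_inj _ _ D n @^-1` B) =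
  (gs_diff (td_root D) (piece0 D @^-1` B) +
   \sum_(m < n) \sum_(i <oo) (td_mass D m i)%:E *
     gs_diff (td_copy D m i) (piece D m i @^-1` B) +
   \sum_(i <oo) (td_mass D n i * \1_B (td_inj (td_loc D n i)))%:E)%E.
Proof.
rewrite -stage_diffE.
transitivity (st_diff (td_stage D n) (@td_inj _ _ D n @^-1` B) +
  \sum_(i <oo) (td_mass D n i)%:E * \d_(td_loc D n i : borel (st_root (td_stage D n)))
    (@td_inj _ _ D n @^-1` B))%E.
  exact: measure_addE.
by congr (_ + _)%E; apply: eq_eseriesr => i _; rewrite EFinM diracE indicE.
Qed.

Lemma lim_weight_stage_le n N (B : set (td_lim D)) :
  (weighted_atoms (lim_support n N) lim_weight lim_point B <=
   stage_measure (td_stage D n) (@td_inj _ _ D n @^-1` enlarge B n.+1%:R^-1))%E.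
Proof.
have n0 : 0 < n.+1%:R^-1 :> R by rewrite invr_gt0 ltr0n.
rewrite /weighted_atoms lim_support_sum/= !EFinD stage_muE addeC; apply: leeD.
  apply: leeD.
    rewrite -sumEFin; apply: (grid_discretize _ (td_lim_root D)) => t u.
    exact: piece0_lipschitz.
  rewrite -sumEFin big_mkord; apply: lee_sum => m _.
  rewrite -sumEFin; set G := (fun i : nat => _ in leRHS).
  apply: (@le_trans _ _ (\sum_(0 <= i < N) (td_mass D m i)%:E *
    gs_diff (td_copy D m i) (piece D m i @^-1` enlarge B n.+1%:R^-1))%E); last first.
    apply: nneseries_lim_ge => i _ _.
    by rewrite mule_ge0 ?lee_fin ?td_mass_ge0.
  apply: lee_sum => i _.
  have := @grid_discretize R (td_copy D m i) _ (td_lim_root D) (piece D m i) B n N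
    (piece_lipschitz beta_gt0 D m i).
  move=> /(lee_wpmul2l (_ : 0 <= (td_mass D m i)%:E)%E) h.
  apply: le_trans (h _); last by rewrite lee_fin td_mass_ge0.
  rewrite sumEFin -EFinM lee_fin mulr_sumr; apply: ler_sum => j _.
  by rewrite mulrA.
rewrite -sumEFin; apply: (@le_trans _ _ (\sum_(0 <= i < N)
    (td_mass D n i * \1_(enlarge B n.+1%:R^-1) (td_inj (td_loc D n i)))%:E)%E); last first.
  apply: nneseries_lim_ge => i _ _.
  by rewrite lee_fin mulr_ge0 ?td_mass_ge0.
apply: lee_sum => i _; rewrite lee_fin ler_wpM2l ?td_mass_ge0// !indicE ler_nat.
case: (boolP (_ \in B)) => // /set_mem Bi; rewrite mem_set//.
exact: sub_enlarge Bi.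
Qed.

(** The finite measure is compared with stage [n] at the cost of the mesh, and the rest of [e] pays
    for the passage from the stage to the limit. *)
Lemma lim_weight_le n N (e : R) (B : set (td_lim D)) : lim_err n N < e ->
  measurable (B : set (borel (td_lim_root D))) ->
  (weighted_atoms (lim_support n N) lim_weight lim_point B <=
   limit_mu beta_gt0 D (enlarge B e) + e%:E)%E.
Proof.
move=> ne mB; have n0 : 0 < n.+1%:R^-1 :> R by rewrite invr_gt0 ltr0n.
have m0 : 0 <= maxr 0 (1 - \sum_(i <- lim_support n N) lim_weight i).
  by rewrite le_max lexx.
have gap : stage_gap D n < e - n.+1%:R^-1.
  by move: ne; rewrite /lim_err; move: (n.+1%:R^-1) => q; lra.
apply: le_trans (lim_weight_stage_le n N B) _.
apply: le_trans (stage_limit_mu_le beta_gt0 gap _) _.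
  exact: measurable_enlarge.
apply: leeD; last by rewrite lee_fin gerBl ltW.
apply: le_measure; rewrite ?inE; try exact: measurable_enlarge.
move=> u /enlarge_enlarge; apply: le_enlarge.
by rewrite subrKC.
Qed.

(** As [N] grows the weights exhaust the total mass of stage [n], which is 1 by [td_total]. *)
Let support_cvg n :
  \sum_(i <- lim_support n N) lim_weight i @[N --> \oo] --> (1 : R).
Proof.
under eq_fun do rewrite lim_support_sum/=.
have fT (s : gstring R) : gs_diff s setT \is a fin_num by exact: gs_diff_fin.
have gT (s : gstring R) : (\sum_(j <oo) (fine (gs_diff s (grid_cell n j)))%:E)%E =
    (fine (gs_diff s setT))%:E.
  rewrite fineK// -(grid_total s n); apply: eq_eseriesr => j _.
  by rewrite fineK// gs_diff_fin//; exact: measurable_grid_cell.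
pose V m := fine (\sum_(i <oo) (td_mass D m i)%:E * gs_diff (td_copy D m i) setT)%E.
have VE m : (\sum_(i <oo) (td_mass D m i)%:E * gs_diff (td_copy D m i) setT)%E = (V m)%:E.
  rewrite fineK// ge0_fin_numE; last first.
    by apply: nneseries_ge0 => i _ _; rewrite mule_ge0 ?lee_fin ?td_mass_ge0.
  apply: le_lt_trans (ltry 1); apply: le_trans (td_mass_sum_le1 D m).
  apply: lee_nneseries => i _; first by rewrite mule_ge0 ?lee_fin ?td_mass_ge0.
  rewrite -[leRHS]mule1 lee_wpmul2l ?lee_fin ?td_mass_ge0//.
  exact: string_diff_le1.
have tot : fine (atom_mass D n) + (fine (gs_diff (td_root D) setT) +
    \sum_(0 <= m < n) V m) = 1.
  apply/eqP; rewrite -eqe !EFinD fineK ?atom_mass_fin// fineK// -sumEFin big_mkord.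
  have := @stage_diffE R beta D n setT; rewrite !preimage_setT => h.
  apply/eqP; rewrite -[RHS](td_total D n) h addeC; congr (_ + _ + _)%E.
  by apply: eq_bigr => m _; rewrite -VE; apply: eq_eseriesr => i _; rewrite preimage_setT.
rewrite -tot; apply: cvgD.
  apply: series_cvg_real => [i|]; first exact: td_mass_ge0.
  by rewrite fineK ?atom_mass_fin.
apply: cvgD; first by apply: series_cvg_real => // j; exact: fine_ge0.
apply: cvg_seq_sum => m; apply: (double_series_cvg (U := fun i =>
    td_mass D m i * fine (gs_diff (td_copy D m i) setT))).
- by move=> i j; rewrite mulr_ge0 ?td_mass_ge0//; exact: fine_ge0.
- move=> i; under eq_eseriesr do rewrite EFinM.
  rewrite nneseriesZl; first by rewrite gT EFinM.
  by move=> j _; rewrite lee_fin; exact: fine_ge0.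
- by rewrite -VE; apply: eq_eseriesr => i _; rewrite EFinM fineK.
Qed.

Lemma lim_err_small (e : R) : 0 < e -> exists p : nat * nat, lim_err p.1 p.2 < e.
Proof.
move=> e0; have e4 : 0 < e / 4 by rewrite divr_gt0.
have /cvgrPdist_lt/(_ _ e4)[n1 _ n1P] := stage_gap_cvg D.
have [n2] := ltr_add_invr (e4 : 0 < e / 4); rewrite add0r => n2e.
pose n := maxn n1 n2.
have /cvgrPdist_lt/(_ _ e4)[N _ NP] := support_cvg n.
exists (n, N); rewrite /lim_err/=.
have := NP N (leqnn _); have := n1P n (leq_maxl _ _).
rewrite /= sub0r normrN !ltr_norml => /andP[_ h1] /andP[_ h2].
have h3 : n.+1%:R^-1 < e / 4.
  apply: le_lt_trans n2e; rewrite lef_pV2 ?posrE ?ltr0n// ler_nat ltnS.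
  exact: leq_maxr.
have h4 : maxr 0 (1 - \sum_(i <- lim_support n N) lim_weight i) < e / 4.
  by rewrite gt_max e4.
by move: (n.+1%:R^-1) h3 => q; lra.
Qed.

End limit_approximation.

(** * Measurability of the limit tree *)

Section random_limit.
Context {R : realType} {d : measure_display} {Omega : measurableType d}.
Context (beta : R) (beta_gt0 : (0 < beta)%R) (D : Omega -> treedata beta).
Hypothesis mroot : measurable_fun setT (fun w => td_root (D w)).
Hypothesis mcopy : forall n i, measurable_fun setT (fun w => td_copy (D w) n i).
Hypothesis menum : forall n k, measurable_fun setT (fun w => td_enum (D w) n k).
Hypothesis merr : forall n, measurable_fun setT (fun w => td_err (D w) n).
Local Open Scope ring_scope.

Lemma lim_section_point i : exists n, lim_section n (fun w => lim_point (D w) i).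
Proof.
case: i => [[[[n i]|[k j]]|[[m i] [k j]]]|].
- by exists n; exact: lim_section_loc.
- by exists 0%N; exact: lim_section_piece0.
- by exists m.+1; exact: lim_section_piece.
- by exists 0%N; exact: lim_section_root.
Qed.

Lemma measurable_lim_weight i : measurable_fun setT (fun w => lim_weight (D w) i).
Proof.
have mg (s : Omega -> gstring R) k j : measurable_fun setT s ->
    measurable_fun setT (fun w => fine (gs_diff (s w) (grid_cell k j))).
  move=> ms; apply: (@measurableT_comp _ _ _ _ _ _ fine); first exact: fine_measurable.
  exact: (measurableT_comp (measurable_gs_diff (measurable_grid_cell k j)) ms).
case: i => [[[[n i]|[k j]]|[[m i] [k j]]]|] //=.
- exact: measurable_td_mass.
- exact: mg.
- by apply: measurable_funM; [exact: measurable_td_mass|exact: mg].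
Qed.

Lemma measurable_lim_err n N : measurable_fun setT (fun w => lim_err (D w) n N).
Proof.
apply: measurable_funD.
  apply: measurable_funD; last exact: measurable_cst.
  apply: measurable_funD; last exact: measurable_mass_defect.
  by apply: measurable_funM; [exact: measurable_cst|exact: merr].
apply: measurable_maxr; first exact: measurable_cst.
apply: measurable_funB; first exact: measurable_cst.
by apply: measurable_sum => i; exact: measurable_lim_weight.
Qed.

Theorem random_limit : random_wRtree (fun w =>
  Tw_of (WRtree (limit_weighted_Rtree beta_gt0 (D w)))).
Proof.
apply: (@random_wRtree_of_sections R d Omega lim_index (nat * nat)%type
  (fun w => WRtree (limit_weighted_Rtree beta_gt0 (D w)))
  (fun i w => lim_point (D w) i) None (fun p => lim_support p.1 p.2)
  (fun _ i w => lim_weight (D w) i) (fun p w => lim_err (D w) p.1 p.2)) => //.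
- by move=> w u e; exact: lim_point_dense.
- move=> i j; have [n ni] := lim_section_point i; have [m mj] := lim_section_point j.
  exact: measurable_lim_section_dist ni mj.
- by move=> _ i; exact: measurable_lim_weight.
- by move=> _ i w; exact: lim_weight_ge0.
- by move=> p; exact: measurable_lim_err.
- by move=> w e; exact: lim_err_small.
- by move=> p w; exact: lim_err_total.
- by move=> p w e B ne mB; exact: lim_weight_le.
Qed.

End random_limit.

(** * Moments *)

Section independent_integrals.
Context {R : realType} {d d1 d2 : measure_display} {Omega : measurableType d}.
Context {T1 : measurableType d1} {T2 : measurableType d2} (P : probability Omega R).

Lemma integral_same_law (Z Z' : Omega -> T2) (g : T2 -> \bar R) :
  measurable_fun setT Z -> measurable_fun setT Z' ->
  (forall B, measurable B -> P (Z @^-1` B) = P (Z' @^-1` B)) ->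
  measurable_fun setT g -> (forall z, 0 <= g z) ->
  \int[P]_w g (Z w) = \int[P]_w g (Z' w).
Proof.
move=> mZ mZ' ZZ' mg g0.
rewrite -(@ge0_integral_pushforward _ _ _ _ _ _ mZ P setT g)//.
rewrite -(@ge0_integral_pushforward _ _ _ _ _ _ mZ' P setT g)//.
by apply: eq_measure_integral => B mB _; exact: ZZ'.
Qed.

(** The joint law is the product law, and Tonelli's theorem applies. [Y] may take values in any
    measurable space, so that it can be the identity from [Omega] to [Omega] with the past as
    sigma-algebra. *)
Lemma integral_independent (Y : Omega -> T1) (Z : Omega -> T2)
    (f : T1 -> \bar R) (g : T2 -> \bar R) :
  measurable_fun setT Y -> measurable_fun setT Z ->
  (forall A B, measurable A -> measurable B ->
    P (Y @^-1` A `&` Z @^-1` B) = P (Y @^-1` A) * P (Z @^-1` B)) ->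
  measurable_fun setT f -> measurable_fun setT g ->
  (forall y, 0 <= f y) -> (forall z, 0 <= g z) ->
  \int[P]_w (f (Y w) * g (Z w)) = \int[P]_w f (Y w) * \int[P]_w g (Z w).
Proof.
move=> mY mZ ind mf mg f0 g0.
pose Ym : {mfun Omega >-> T1} := HB.pack Y (isMeasurableFun.Build _ _ _ _ _ mY).
pose Zm : {mfun Omega >-> T2} := HB.pack Z (isMeasurableFun.Build _ _ _ _ _ mZ).
have mYZ : measurable_fun setT (fun w => (Y w, Z w)) by exact: measurable_fun_pair.
pose YZm : {mfun Omega >-> (T1 * T2)%type} :=
  HB.pack (fun w => (Y w, Z w)) (isMeasurableFun.Build _ _ _ _ _ mYZ).
pose m1 := distribution P Ym; pose m2 := distribution P Zm.
have mfg : measurable_fun setT (fun z : T1 * T2 => f z.1 * g z.2).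
  by apply: emeasurable_funM; apply: measurableT_comp.
have fg0 (z : T1 * T2) : 0 <= f z.1 * g z.2 by rewrite mule_ge0.
have h : \int[m1 \x m2]_z (f z.1 * g z.2) = \int[P]_w (f (Y w) * g (Z w)).
  transitivity (\int[distribution P YZm]_z (f z.1 * g z.2)); last first.
    by rewrite ge0_integral_pushforward.
  apply: eq_measure_integral => A mA _.
  apply: (@product_measure_unique _ _ _ _ _ m1 m2 (distribution P YZm)) => //.
rewrite -h fubini_tonelli1// /fubini_F /=.
under eq_integral => x _ do rewrite ge0_integralZl//.
rewrite ge0_integralZr//; last exact: integral_ge0.
by rewrite !ge0_integral_pushforward.
Qed.

End independent_integrals.

Section moments.
Context {R : realType} {d : measure_display} {Omega : measurableType d}.
Context (P : probability Omega R) (p beta : R).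
Context (p_ge1 : (1 <= p)%R).
Context (xi : Omega -> gstring R) (mxi : measurable_fun setT xi).
Context (copy : nat -> nat -> Omega -> gstring R)
  (mcopy : forall n i, measurable_fun setT (copy n i))
  (copy_law : forall n i (B : set (gstring R)), measurable B ->
    P (copy n i @^-1` B) = P (xi @^-1` B)).
Context (enum : nat -> Omega -> nat -> nat * nat)
  (menum : forall n k, measurable_fun setT (fun w => enum n w k))
  (enum_bij : forall n w, bijective (enum n w)).
Context (copy_indep : forall n, mutually_independent P
    (fun o : option nat =>
       if o is Some i then sigma_of (copy n i) else past xi copy enum n)).

Let mass := stage_mass beta xi copy enum.
Let b n i w : \bar R := ((mass n i w `^ (p * beta))%R)%:E.
Let g (s : gstring R) : \bar R :=
  \sum_(j <oo) (((gs_mass s j)%:num `^ (p * beta))%R)%:E.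
Let lp (s : gstring R) : \bar R := ((gs_len s `^ p)%R)%:E.

Let b_ge0 n i w : 0 <= b n i w.
Proof. by rewrite lee_fin powR_ge0. Qed.

Let g_ge0 s : 0 <= g s.
Proof. by apply: nneseries_ge0 => j _ _; rewrite lee_fin powR_ge0. Qed.

Let measurable_g : measurable_fun setT g.
Proof.
apply: ge0_emeasurable_sum => [j s _ _|j _]; first by rewrite lee_fin powR_ge0.
apply/measurable_EFinP.
exact: (measurableT_comp (measurable_powR (p * beta)) (measurable_gs_mass j)).
Qed.

Let measurable_lp : measurable_fun setT lp.
Proof.
apply/measurable_EFinP.
exact: (measurableT_comp (measurable_powR p) measurable_gs_len).
Qed.

Let measurable_b n i : measurable_fun setT (b n i).
Proof.
apply/measurable_EFinP; apply: (measurableT_comp (measurable_powR (p * beta))).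
by apply: measurable_stage_mass.
Qed.

Let past_gen n : set_system Omega := sigma_of xi `|`
  \bigcup_(m in `I_n) \bigcup_i sigma_of (copy m i) `|`
  \bigcup_(m in `I_n) \bigcup_k sigma_of (fun w => enum m w k).

(** The sample space with the sigma-algebra of the past of stage [n]: a quantity known at that stage
    is a measurable function on it, which brings independence into the form of
    [integral_independent]. *)
Let past_type n := g_sigma_algebraType (past_gen n).

Let past_gen_measurable n A : past_gen n A -> measurable A.
Proof.
move=> [[|[m _ [i _]]]|[m _ [k _]]] [B mB <-].
- exact: mxi.
- exact: mcopy.
- exact: menum.
Qed.

Let measurable_past n A : <<s past_gen n >> A -> measurable A.
Proof.
apply: smallest_sub => //; last exact: past_gen_measurable.
exact: sigma_algebra_measurable.
Qed.

Let measurable_past_id n : measurable_fun setT (id : Omega -> past_type n).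
Proof. by move=> _ A mA; rewrite setTI preimage_id; exact: (@measurable_past n). Qed.

Let past_fun n {d'} {T : measurableType d'} (f : Omega -> T) :
  (forall B, measurable B -> past_gen n (f @^-1` B)) ->
  measurable_fun setT (f : past_type n -> T).
Proof.
by move=> h _ B mB; rewrite setTI; apply: sub_sigma_algebra; exact: h.
Qed.

Let measurable_b_past n i : measurable_fun setT (b n i : past_type n -> \bar R).
Proof.
apply/measurable_EFinP; apply: (measurableT_comp (measurable_powR (p * beta))).
apply: (@measurable_stage_mass R _ (past_type n) beta xi copy enum n i).
- by apply: past_fun => B mB; left; left; exists B; rewrite ?setTI.
- move=> m j mn; apply: past_fun => B mB; left; right; exists m => //.
  by exists j => //; exists B; rewrite ?setTI.
- move=> m j mn; apply: past_fun => B mB; right; exists m => //.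
  by exists j => //; exists B; rewrite ?setTI.
Qed.

Let integral_b n i (h : gstring R -> \bar R) : measurable_fun setT h ->
  (forall s, 0 <= h s) -> \int[P]_w (b n i w * h (copy n i w)) =
  \int[P]_w b n i w * \int[P]_w h (xi w).
Proof.
move=> mh h0.
rewrite -(integral_same_law (mcopy n i) mxi (@copy_law n i) mh h0).
apply: (@integral_independent R _ _ _ Omega (past_type n) _ P id (copy n i)
  (b n i) h (@measurable_past_id n) (mcopy n i) _ (@measurable_b_past n i) mh
  (b_ge0 n i) h0).
move=> A B mA mB; rewrite preimage_id.
have := @copy_indep n [:: None; Some i]
  (fun o => if o is Some _ then copy n i @^-1` B else A) isT.
rewrite !big_cons big_nil mule1 => <-.
  congr (P _); apply/seteqP; split=> w /=.
    by move=> [wA wB] [j|] //=; rewrite !inE => /eqP.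
  move=> h1; split; first by apply: (h1 None); rewrite /= mem_head.
  by apply: (h1 (Some i)); rewrite /= !inE eqxx orbT.
move=> [j|]; rewrite !inE//= => /eqP[->].
by exists B; rewrite ?setTI.
Qed.

(** Each fresh copy is independent of the mass that scales it, so its moment factors out of every
    term. Taken with [g] it gives the recursion for the masses, with [lp] the moments of the branch
    lengths. *)
Let moment_step n (h : gstring R -> \bar R) (c : R) : measurable_fun setT h ->
  (forall s, 0 <= h s) -> \int[P]_w h (xi w) = c%:E ->
  \int[P]_w \sum_(i <oo) (b n i w * h (copy n i w)) =
  c%:E * \int[P]_w (\sum_(i <oo) b n i w).
Proof.
move=> mh h0 hc; have mhc i : measurable_fun setT (h \o copy n i).
  exact: measurableT_comp.
rewrite integral_nneseries//; last 2 first.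
- by move=> i; apply: emeasurable_funM => //; exact: mhc.
- by move=> i w _; rewrite mule_ge0.
under eq_eseriesr do rewrite integral_b// hc muleC.
rewrite integral_nneseries// nneseriesZl// => i _.
exact: integral_ge0.
Qed.

Let m : \bar R := \int[P]_w g (xi w).

Let mass_sumS n w : \sum_(k <oo) b n.+1 k w =
  \sum_(i <oo) (b n i w * g (copy n i w)).
Proof.
pose f i j : \bar R := b n i w * (((gs_mass (copy n i w) j)%:num `^ (p * beta))%R)%:E.
transitivity (\sum_(k <oo) f (enum n w k).1 (enum n w k).2).
  apply: eq_eseriesr => k _; rewrite /f /b -EFinM -powRM ?stage_mass_ge0//.
rewrite (pair_series (enum_bij n w)); last first.
  by move=> i j; rewrite mule_ge0// lee_fin powR_ge0.
by apply: eq_eseriesr => i _; rewrite /f /b nneseriesZl.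
Qed.

Lemma mass_moment_power (m0 : R) n : m = m0%:E ->
  \int[P]_w (\sum_(i <oo) b n i w) = ((m0 ^+ n.+1)%R)%:E.
(* The exponent is [n.+1] because stage 0 already carries the atoms of one string. *)
Proof.
move=> mm0; elim: n => [|n IH]; first by rewrite expr1 -mm0.
under eq_integral do rewrite mass_sumS.
by rewrite (moment_step _ measurable_g _ mm0)// IH -EFinM -exprS.
Qed.

Lemma length_moment_power (m0 l0 : R) n : m = m0%:E ->
  \int[P]_w lp (xi w) = l0%:E ->
  \int[P]_w (\sum_(i <oo) (b n i w * lp (copy n i w))) = ((l0 * m0 ^+ n.+1)%R)%:E.
Proof.
move=> mm0 ll0; have lp0 s : 0 <= lp s by rewrite lee_fin powR_ge0.
by rewrite (moment_step _ measurable_lp lp0 ll0) (mass_moment_power _ mm0) -EFinM.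
Qed.

Let weight (r : R) w : \bar R :=
  \sum_(n <oo) ((r ^- n)%R%:E * \sum_(i <oo) (b n i w * lp (copy n i w))).

Let lp_ge0 s : 0 <= lp s.
Proof. by rewrite lee_fin powR_ge0. Qed.

Let level_ge0 n w : 0 <= \sum_(i <oo) (b n i w * lp (copy n i w)).
Proof. by apply: nneseries_ge0 => i _ _; rewrite mule_ge0. Qed.

Let measurable_level n :
  measurable_fun setT (fun w => \sum_(i <oo) (b n i w * lp (copy n i w))).
Proof.
apply: ge0_emeasurable_sum => [i w _ _|i _]; first by rewrite mule_ge0.
by apply: emeasurable_funM => //; exact: measurableT_comp.
Qed.

Let measurable_weight (r : R) : (0 < r)%R -> measurable_fun setT (weight r).
Proof.
move=> r0; apply: ge0_emeasurable_sum => [n w _ _|n _].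
  by rewrite mule_ge0// lee_fin invr_ge0 exprn_ge0// ltW.
by apply: measurable_funeM.
Qed.

Let geometric_le (x : R) N : (0 <= x)%R -> (x < 1)%R ->
  (\sum_(0 <= n < N) x ^+ n <= (1 - x)^-1)%R.
Proof.
move=> x0 x1; have h : ((1 - x) * \sum_(0 <= n < N) x ^+ n = 1 - x ^+ N)%R.
  elim: N => [|N IH]; first by rewrite big_geq// mulr0 expr0 subrr.
  by rewrite big_nat_recr//= mulrDr IH exprS; ring.
rewrite -[leRHS]mul1r ler_pdivlMr ?subr_gt0// mulrC h.
by rewrite lerBlDr lerDl exprn_ge0.
Qed.

Let weight_integral (m0 l0 r : R) : m = m0%:E -> \int[P]_w lp (xi w) = l0%:E ->
  (0 <= m0 < r)%R -> \int[P]_w weight r w < +oo.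
Proof.
move=> mm0 ll0 /andP[m00 m0r]; have r0 : (0 < r)%R by exact: le_lt_trans m0r.
have l00 : (0 <= l0)%R by rewrite -lee_fin -ll0; exact: integral_ge0.
rewrite integral_nneseries//; last 2 first.
- by move=> n; exact: measurable_funeM.
- by move=> n w _; rewrite mule_ge0// lee_fin invr_ge0 exprn_ge0// ltW.
apply: (@le_lt_trans _ _ ((l0 * m0 * (1 - m0 / r)^-1)%R)%:E); last exact: ltry.
have mr : (0 <= m0 / r)%R by rewrite divr_ge0// ltW.
have mr1 : (m0 / r < 1)%R by rewrite ltr_pdivrMr// mul1r.
have tE n : \int[P]_w ((r ^- n)%R%:E * \sum_(i <oo) (b n i w * lp (copy n i w))) =
    ((l0 * m0 * (m0 / r) ^+ n)%R)%:E.
  rewrite ge0_integralZl//; last by rewrite lee_fin invr_ge0 exprn_ge0// ltW.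
  rewrite (length_moment_power n mm0 ll0) -EFinM; congr EFin.
  by rewrite exprMn exprVn exprS; ring.
under eq_eseriesr do rewrite tE.
apply: lime_le.
  by apply: is_cvg_nneseries => n _ _; rewrite lee_fin !mulr_ge0// exprn_ge0.
apply: nearW => N; rewrite sumEFin lee_fin -mulr_sumr.
by rewrite ler_wpM2l ?mulr_ge0// geometric_le.
Qed.

Let weight_level (r : R) w n : (0 < r)%R -> weight r w < +oo ->
  \sum_(i <oo) (b n i w * lp (copy n i w)) <= ((fine (weight r w) * r ^+ n)%R)%:E.
Proof.
move=> r0 Wfin.
have t0 k : 0 <= (r ^- k)%R%:E * \sum_(i <oo) (b k i w * lp (copy k i w)).
  by rewrite mule_ge0// lee_fin invr_ge0 exprn_ge0// ltW.
have W0 : 0 <= weight r w by apply: nneseries_ge0 => k _ _.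
have h : (r ^- n)%R%:E * \sum_(i <oo) (b n i w * lp (copy n i w)) <= weight r w.
  apply: (le_trans _ (nneseries_lim_ge n.+1 _)) => [|k _ _]; last exact: t0.
  by rewrite big_nat_recr//= leeDr// sume_ge0.
have rn : ((r ^- n) * r ^+ n = 1)%R.
  by rewrite mulVf// expf_neq0// gt_eqF.
rewrite -(mul1e (\sum_(i <oo) _)) -[1]/(1%R%:E) -rn EFinM muleAC EFinM.
rewrite fineK ?ge0_fin_numE//; apply: lee_wpmul2r => //.
by rewrite lee_fin exprn_ge0// ltW.
Qed.

Let blen n i w : R := branch_len beta (xi w) (fun m i => copy m i w)
  (fun m => enum m w) n i.

Let blen_ge0 n i w : (0 <= blen n i w)%R.
Proof. by rewrite mulr_ge0 ?powR_ge0// ltW// gs_len_gt0. Qed.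

Let blenE n i w : b n i w * lp (copy n i w) = ((blen n i w `^ p)%R)%:E.
Proof.
rewrite -EFinM /blen /branch_len powRM ?powR_ge0//; last exact/ltW/gs_len_gt0.
by rewrite -powRrM (mulrC p).
Qed.

Let p_gt0 : (0 < p)%R. Proof. exact: lt_le_trans ltr01 p_ge1. Qed.

Let blen_le (r : R) w n i : (0 < r)%R -> weight r w < +oo ->
  (blen n i w <= fine (weight r w) `^ p^-1 * (r `^ p^-1) ^+ n)%R.
Proof.
move=> r0 Wfin.
have W0 : (0 <= fine (weight r w))%R.
  apply: fine_ge0; apply: nneseries_ge0 => k _ _.
  by rewrite mule_ge0// lee_fin invr_ge0 exprn_ge0// ltW.
have h : (blen n i w `^ p <= fine (weight r w) * r ^+ n)%R.
  rewrite -lee_fin; apply: le_trans (weight_level n r0 Wfin).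
  under eq_eseriesr do rewrite blenE.
  apply: (le_trans _ (nneseries_lim_ge i.+1 _)) => [|k _ _]; last first.
    by rewrite lee_fin powR_ge0.
  by rewrite big_nat_recr//= leeDr// sume_ge0// => k _; rewrite lee_fin powR_ge0.
have pV : (0 <= p^-1)%R by rewrite invr_ge0 ltW.
have := @ge0_ler_powR R (p^-1)%R pV _ _ _ _ h.
rewrite !nnegrE powR_ge0 mulr_ge0 ?exprn_ge0 ?(ltW r0)// => /(_ isT isT).
rewrite -powRrM divff ?gt_eqF// powRr1// powRM ?exprn_ge0 ?(ltW r0)//.
suff -> : ((r ^+ n) `^ p^-1 = (r `^ p^-1) ^+ n)%R by [].
rewrite -(powR_mulrn n (ltW r0)) -(powR_mulrn n (powR_ge0 r _)) -!powRrM.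
by rewrite mulrC.
Qed.

(** Within one level the [p]-th powers of the lengths are summable, so the lengths tend to 0, as
    compactness of the next stage requires. *)
Let blen_small (r : R) w n (e : R) : (0 < r)%R -> weight r w < +oo -> (0 < e)%R ->
  exists N, forall i, (N <= i)%N -> (blen n i w < e)%R.
Proof.
move=> r0 Wfin e0.
have l0 := weight_level n r0 Wfin.
have sfin : \sum_(i <oo) (b n i w * lp (copy n i w)) \is a fin_num.
  by rewrite ge0_fin_numE// (le_lt_trans l0)// ltry.
have u0 i : (0 <= blen n i w `^ p)%R by exact: powR_ge0.
have sE : \sum_(i <oo) ((blen n i w `^ p)%R)%:E =
    (fine (\sum_(i <oo) (b n i w * lp (copy n i w))))%:E.
  by rewrite fineK//; apply: eq_eseriesr => i _; rewrite blenE.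
have c : cvgn (series (fun i => blen n i w `^ p)%R).
  by apply/cvg_ex; eexists; exact: (series_cvg_real u0 sE).
have /cvgrPdist_lt/(_ (e `^ p)%R (powR_gt0 _ e0))[N _ NP] := cvg_series_cvg_0 c.
exists N => i /NP /=; rewrite sub0r normrN ger0_norm// => h.
rewrite ltNge; apply/negP => ei; move: h; rewrite ltNge => /negP; apply.
have := @ge0_ler_powR R p (ltW p_gt0) e (blen n i w).
by rewrite !nnegrE (ltW e0) blen_ge0; exact.
Qed.

Context (length_moment : 'E_P[fun w => (gs_len (xi w) `^ p)%R] < +oo)
  (mass_moment :
    \int[P]_w (\sum_(j <oo) (((gs_mass (xi w) j)%:num `^ (p * beta))%R)%:E) < 1).

Lemma construction_regular : exists (G : set Omega) (C : Omega -> R) (q : R),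
  [/\ measurable G, P (~` G) = 0, measurable_fun setT C,
      forall w, (0 <= C w)%R & (0 <= q < 1)%R] /\
  forall w, G w -> (forall n i, (blen n i w <= C w * q ^+ n)%R) /\
    forall n e, (0 < e)%R -> exists N, forall i, (N <= i)%N -> (blen n i w < e)%R.
Proof.
have m0 : 0 <= m by exact: integral_ge0.
have mfin : m \is a fin_num.
  by rewrite ge0_fin_numE// (lt_trans mass_moment)// ltry.
have mE : m = (fine m)%:E by rewrite fineK.
have lE : \int[P]_w lp (xi w) = (fine (\int[P]_w lp (xi w)))%:E.
  rewrite fineK// ge0_fin_numE; last exact: integral_ge0.
  by move: length_moment; rewrite unlock.
have m1 : (fine m < 1)%R by rewrite -lte_fin -mE.
have m00 : (0 <= fine m)%R by exact: fine_ge0.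
(* Any value strictly between the mass moment and 1 would do: above the moment the weighted series
   is integrable, below 1 the branch lengths decay geometrically. *)
pose r : R := ((1 + fine m) / 2)%R.
have mr : (fine m < r)%R by rewrite /r; lra.
have r1 : (r < 1)%R by rewrite /r; lra.
have r0 : (0 < r)%R by exact: le_lt_trans mr.
have Wint := weight_integral mE lE (introT andP (conj m00 mr)).
have mW := measurable_weight r0.
have W0 w : 0 <= weight r w.
  apply: nneseries_ge0 => k _ _.
  by rewrite mule_ge0// lee_fin invr_ge0 exprn_ge0// ltW.
pose G := [set w | weight r w < +oo].
have mG : measurable G.
  by have := emeasurable_fun_infty_o measurableT mW (+oo); rewrite setTI.
have pV : (0 < p^-1)%R by rewrite invr_gt0.
exists G, (fun w => fine (weight r w) `^ p^-1)%R, (r `^ p^-1)%R; split.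
  split=> //.
  - have [|N [mN PN NG]] := @integrable_ae _ _ _ P setT measurableT (weight r).
      apply/integrableP; split=> //.
      by under eq_integral do rewrite gee0_abs//.
    apply: (subset_measure0 _ mN _ PN); first exact: measurableC.
    move=> w /= nG; apply: NG => /= /(_ Logic.I).
    by rewrite ge0_fin_numE.
  - apply: (measurableT_comp (measurable_powR (p^-1)%R)).
    apply: (@measurableT_comp _ _ _ _ _ _ fine); first exact: fine_measurable.
    exact: mW.
  - by move=> w; exact: powR_ge0.
  - rewrite powR_ge0/=.
    have := @gt0_ltr_powR R (p^-1)%R pV r 1%R; rewrite !nnegrE powR1.
    by apply; rewrite ?ler01 ?(ltW r0).
by move=> w Gw; split=> [n i|n e e0]; [exact: blen_le|exact: blen_small r0 Gw e0].
Qed.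

End moments.

(** * From the almost sure bounds to the theorem *)

(** The error at [n] is the tail of the geometric series of the bounds, so its decrement is exactly
    [C * q ^+ n]. *)
Lemma geometric_treedata {R : realType} (beta : R) (s0 : gstring R)
    (s : nat -> nat -> gstring R) (e : nat -> nat -> nat * nat) (C q : R) :
  (forall n, bijective (e n)) -> (0 <= C)%R -> (0 <= q < 1)%R ->
  (forall n i, (branch_len beta s0 s e n i <= C * q ^+ n)%R) ->
  (forall n eps, (0 < eps)%R -> exists N, forall i, (N <= i)%N ->
    (branch_len beta s0 s e n i < eps)%R) ->
  exists D : treedata beta, [/\ td_root D = s0, td_copy D = s, td_enum D = e &
    forall n, td_err D n = (C * q ^+ n / (1 - q))%R].
Proof.
move=> ebij C0 /andP[q0 q1] bC bs; have q1' : (0 < 1 - q)%R by rewrite subr_gt0.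
have err_ge0 n : (0 <= C * q ^+ n / (1 - q))%R.
  by rewrite divr_ge0 ?(ltW q1')// mulr_ge0// exprn_ge0.
have err_small (eps : R) : (0 < eps)%R -> exists n, (C * q ^+ n / (1 - q) < eps)%R.
  move=> eps0.
  have : ((C / (1 - q)) * q ^+ n @[n --> \oo] --> (C / (1 - q)) * 0)%R.
    by apply: cvgMr; apply: cvg_expr; rewrite ger0_norm.
  rewrite mulr0 => /cvgrPdist_lt/(_ _ eps0)[N _ /(_ N (leqnn _))] /=.
  rewrite sub0r normrN mulrAC ger0_norm//; first by exists N.
have len_le n i : (branch_len beta s0 s e n i <=
    C * q ^+ n / (1 - q) - C * q ^+ n.+1 / (1 - q))%R.
  rewrite (_ : (_ - _)%R = (C * q ^+ n)%R)// exprS.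
  by field; rewrite gt_eqF.
by exists (@TreeData R beta s0 s e (fun n => C * q ^+ n / (1 - q))%R
  ebij err_ge0 err_small len_le bs).
Qed.

Lemma td_stages_cvg {R : realType} (beta : R) (beta_gt0 : (0 < beta)%R)
    (D : treedata beta) s0 s e :
  td_root D = s0 -> td_copy D = s -> td_enum D = e ->
  exists SP : forall n, weighted_Rtree (stage_rmspace (stages beta s0 s e n)),
    Tw_dist (Tw_of (WRtree (SP n))) (Tw_of (WRtree (limit_weighted_Rtree beta_gt0 D)))
      @[n --> \oo] --> 0.
Proof.
move=> <- <- <-; exists (td_stage_Rtree D).
exact: stage_limit_cvg.
Qed.

Theorem theorem1p3 (R : realType) (d : measure_display)
  (Omega : measurableType d) (P : probability Omega R)
  (p beta : R) (p_ge1 : (1 <= p)%R) (beta_gt0 : (0 < beta)%R)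
  (xi : Omega -> gstring R) (mxi : measurable_fun setT xi)
  (length_moment : 'E_P[fun w => (gs_len (xi w) `^ p)%R] < +oo)
  (mass_moment :
    \int[P]_w (\sum_(j <oo) (((gs_mass (xi w) j)%:num `^ (p * beta))%R)%:E) < 1)
  (* copy n i is attached to the i-th atom of stage n *)
  (copy : nat -> nat -> Omega -> gstring R)
  (mcopy : forall n i, measurable_fun setT (copy n i))
  (copy_law : forall n i (B : set (gstring R)), measurable B ->
    P (copy n i @^-1` B) = P (xi @^-1` B))
  (* enum n enumerates the atoms of stage n + 1 *)
  (enum : nat -> Omega -> nat -> nat * nat)
  (menum : forall n k, measurable_fun setT (fun w => enum n w k))
  (enum_bij : forall n w, bijective (enum n w))
  (copy_indep : forall n, mutually_independent P
    (fun o : option nat =>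
       if o is Some i then sigma_of (copy n i) else past xi copy enum n)) :
  let stage_n n w := stage_rmspace
    (stages beta (xi w) (fun m i => copy m i w) (fun m => enum m w) n) in
  exists T : Omega -> Tw R, random_wRtree T /\
    \forall w \ae P, exists stage_wRtree : forall n, weighted_Rtree (stage_n n w),
      (fun n => Tw_dist (Tw_of (WRtree (stage_wRtree n))) (T w)) @ \oo --> 0.
Proof.
move=> stage_n.
have [G [C [q [[mG PG mC C0 q01] reg]]]] := construction_regular p_ge1
  mxi mcopy copy_law menum enum_bij copy_indep length_moment mass_moment.
have [w0 Gw0] : exists w0, G w0.
  apply: contrapT => nG; move: PG; rewrite (_ : ~` G = setT) ?probability_setT.
    by move/eqP; rewrite onee_eq0.
  by apply/seteqP; split=> // w _ Gw; apply: nG; exists w.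
(* The exceptional null set is sent to a regular sample point, which makes the
   limit tree defined, and measurable, everywhere. *)
pose proj w := if w \in G then w else w0.
have projG w : G (proj w) by rewrite /proj; case: ifPn => [/set_mem|].
have mproj : measurable_fun setT proj.
  apply: measurable_fun_ifT => //; apply: (@measurable_fun_bool _ _ _ _ true).
  rewrite setTI (_ : _ @^-1` _ = G)//.
  by apply/seteqP; split=> w; [move/set_mem|move/mem_set].
(* The choice of [D] need not be measurable: its strings, enumerations and errors are prescribed
   measurable functions of the sample point, and [random_limit] asks for no more. *)
have /choice[D DE] : forall w, exists D : treedata beta,
    [/\ td_root D = xi (proj w), td_copy D = (fun m i => copy m i (proj w)),
        td_enum D = (fun m => enum m (proj w)) &
        forall n, td_err D n = (C (proj w) * q ^+ n / (1 - q))%R].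
  move=> w; have [bC bs] := reg _ (projG w).
  by apply: geometric_treedata => // n; exact: enum_bij.
exists (fun w => Tw_of (WRtree (limit_weighted_Rtree beta_gt0 (D w)))); split.
  apply: random_limit.
  - rewrite (_ : (fun w => _) = xi \o proj); first exact: measurableT_comp.
    by apply/funext => w; have [->] := DE w.
  - move=> n i; rewrite (_ : (fun w => _) = copy n i \o proj).
      exact: measurableT_comp.
    by apply/funext => w; have [_ ->] := DE w.
  - move=> n k; rewrite (_ : (fun w => _) = (fun w => enum n w k) \o proj).
      exact: measurableT_comp.
    by apply/funext => w; have [_ _ ->] := DE w.
  - move=> n; rewrite (_ : (fun w => _) = (fun w => C w * q ^+ n / (1 - q))%R \o proj).
      apply: measurableT_comp => //; apply: measurable_funM; last exact: measurable_cst.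
      by apply: measurable_funM => //; exact: measurable_cst.
    by apply/funext => w; have [_ _ _ ->] := DE w.
exists (~` G); split=> //; first exact: measurableC.
apply: subsetC => w Gw; have [r c e _] := DE w.
have pw : proj w = w by rewrite /proj mem_set.
by rewrite pw in r c e; exact: td_stages_cvg r c e.
Qed.
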